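(* Let $B$ be a body and let $P$ be a $G_{3A}$-structure on $B$, i.e. the structure given by two two-dimensional distributions $D_1,D_2$, distinct at every point, and a volume form $\Omega$. Then $P$ is integrable if and only if $D_1$ and $D_2$ are both involutive.
   Context: A body is a $3$-dimensional smooth manifold which can be covered with one chart. $G_{3A}\subset GL(3,\mathbb{R})$ is, up to conjugation, the isotropy group of the subspaces $\langle e_1,e_2\rangle$, $\langle e_2,e_3\rangle$ and the tensor $e^1\wedge e^2\wedge e^3$, where $(e_i)$ is the canonical basis of $\mathbb{R}^3$ and $(e^i)$ its dual basis. The corresponding $G_{3A}$-structure $P$ is the set of linear frames $(v_1,v_2,v_3)$ at points $x\in B$ such that $v_1,v_2$ span $(D_1)_x$, $v_2,v_3$ span $(D_2)_x$ and $\Omega(v_1,v_2,v_3)=1$. A $G$-structure $P$ is integrable if around each point there are local coordinates $(x^1,x^2,x^3)$ whose coordinate frame is a section of $P$. *)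

(* Defs.v *)
From HB Require Import structures.
From mathcomp Require Import all_boot all_order all_algebra.
From mathcomp Require Import all_classical all_reals.
From mathcomp Require Import topology normedtype derive.

Set Implicit Arguments.
Unset Strict Implicit.
Unset Printing Implicit Defensive.

Import Order.TTheory GRing.Theory Num.Theory.
Import numFieldNormedType.Exports.

Local Open Scope classical_set_scope.
Local Open Scope ring_scope.

Fixpoint Ck (R : realType) (V W : normedModType R) (k : nat) (U : set V)
    (f : V -> W) : Prop :=
  match k with
  | 0%N => forall p, U p -> {for p, continuous f}
  | k'.+1 => (forall p, U p -> differentiable f p) /\
             (forall v : V, Ck k' U ('D_v f))
  end.

(* Meant for open U only. *)
Definition smooth_on (R : realType) (V W : normedModType R) (U : set V)
    (f : V -> W) : Prop :=
  forall k, Ck k U f.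

(* A 3-manifold covered by one chart: a space [T] with an open topological
   embedding [ref] into R^3, carrying the smooth structure generated by [ref].
   Hausdorffness and second countability follow.  The tangent space at each
   point is identified with R^3 = 'rV[R]_3 through [ref]: a tangent vector is
   the row of its components in the chart [ref]. *)
Record body (R : realType) := Body {
  body_sort :> topologicalType ;
  ref : body_sort -> 'rV[R]_3 ;
  ref_continuous : continuous ref ;
  ref_inj : injective ref ;
  ref_open : forall U : set body_sort, open U -> open (ref @` U)
}.

Section Geometry.
Context {R : realType} {B : body R}.

Local Notation vec := ('rV[R]_3).

(* The map f \o psi^-1 : psi(U) -> W, for psi injective on U, extended by 0
   outside psi(U). *)
Definition local_rep (W : normedModType R) (U : set B) (psi : B -> vec)
    (f : B -> W) (q : vec) : W :=
  xget 0 [set f x | x in [set x | U x /\ psi x = q]].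

Definition smooth_on_body (W : normedModType R) (U : set B) (f : B -> W) :
    Prop :=
  smooth_on (@ref R B @` U) (local_rep U (@ref R B) f).

(* (U, psi) is a chart of the smooth structure: psi is a diffeomorphism from
   the open set U onto an open subset of R^3. *)
Definition local_coords (U : set B) (psi : B -> vec) : Prop :=
  [/\ open U,
      {in U &, injective psi},
      open (psi @` U),
      smooth_on_body U psi &
      smooth_on (psi @` U) (local_rep U psi (@ref R B))].

(* d/dx^i at x, for the coordinates (x^0, x^1, x^2) = psi on U: its components
   in the reference chart are the i-th partials of ref \o psi^-1. *)
Definition coord_frame (U : set B) (psi : B -> vec) (x : B) (i : 'I_3) : vec :=
  'D_(delta_mx 0 i) (local_rep U psi (@ref R B)) (psi x).

(* [X, Y]^i = X^j d_j Y^i - Y^j d_j X^i in the reference chart. *)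
Definition lie_bracket (U : set B) (X Y : B -> vec) (x : B) : vec :=
  'D_(X x) (local_rep U (@ref R B) Y) (ref x)
  - 'D_(Y x) (local_rep U (@ref R B) X) (ref x).

Definition distribution2 (D : B -> {vspace vec}) : Prop :=
  (forall x, \dim (D x) = 2%N) /\
  (forall x0, exists U : set B, exists X Y : B -> vec,
     [/\ open U, U x0, smooth_on_body U X, smooth_on_body U Y &
         forall x, U x -> D x = <<[:: X x; Y x]>>%VS]).

Definition section_on (U : set B) (D : B -> {vspace vec}) (X : B -> vec) :
    Prop :=
  smooth_on_body U X /\ forall x, U x -> X x \in D x.

Definition involutive_distribution (D : B -> {vspace vec}) : Prop :=
  forall (U : set B) (X Y : B -> vec), open U ->
    section_on U D X -> section_on U D Y ->
    forall x, U x -> lie_bracket U X Y x \in D x.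

Definition alternating_trilinear (w : vec -> vec -> vec -> R) : Prop :=
  [/\ forall v2 v3, scalar (fun v => w v v2 v3),
      forall v1 v3, scalar (fun v => w v1 v v3),
      forall v1 v2, scalar (fun v => w v1 v2 v) &
      forall u v, [/\ w u u v = 0, w u v u = 0 & w v u u = 0]].

Definition volume_form (Omega : B -> vec -> vec -> vec -> R) : Prop :=
  [/\ forall x, alternating_trilinear (Omega x),
      forall v1 v2 v3 : vec,
        smooth_on_body (W := R^o) setT (fun x => Omega x v1 v2 v3) &
      forall x, exists v1 v2 v3, Omega x v1 v2 v3 != 0].

(* A set of linear frames at each point of the body. *)
Definition frame_set := B -> set ('I_3 -> vec).

(* The coordinate frame of psi is automatically smooth, so it is a section of P
   over U as soon as its values lie in P. *)
Definition integrable_structure (P : frame_set) : Prop :=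
  forall x0 : B, exists U : set B, exists psi : B -> vec,
    [/\ local_coords U psi, U x0 & forall x, U x -> P x (coord_frame U psi x)].

End Geometry.

Arguments frame_set {R} B.

Record G3A_structure (R : realType) (B : body R) := G3AStructure {
  D1 : B -> {vspace 'rV[R]_3} ;
  D2 : B -> {vspace 'rV[R]_3} ;
  Omega : B -> 'rV[R]_3 -> 'rV[R]_3 -> 'rV[R]_3 -> R ;
  D1_distribution : distribution2 D1 ;
  D2_distribution : distribution2 D2 ;
  D1_neq_D2 : forall x, D1 x != D2 x ;
  Omega_volume : volume_form Omega
}.

Definition G3A_frames (R : realType) (B : body R) (P : G3A_structure B) :
    frame_set B :=
  fun x => [set v : 'I_3 -> 'rV[R]_3 |
    [/\ basis_of fullv [:: v 0%R; v 1%R; v 2%R],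
        <<[:: v 0%R; v 1%R]>>%VS = D1 P x,
        <<[:: v 1%R; v 2%R]>>%VS = D2 P x &
        Omega P x (v 0%R) (v 1%R) (v 2%R) = 1]].

(* Main.v *)
Require Import Defs.
From HB Require Import structures.
From mathcomp Require Import all_boot all_order all_algebra.
From mathcomp Require Import all_classical all_reals.
From mathcomp Require Import topology normedtype landau sequences derive realfun.
From mathcomp Require Import exp.
From mathcomp Require measure lebesgue_measure lebesgue_integral ftc.
From mathcomp Require Import ring lra.

Set Implicit Arguments.
Unset Strict Implicit.
Unset Printing Implicit Defensive.

Import Order.TTheory GRing.Theory Num.Theory.
Import numFieldNormedType.Exports.

Local Open Scope classical_set_scope.
Local Open Scope ring_scope.

(** Locally [D1 = ker df] and [D2 = ker dg] for smooth [f], [g] if and only if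
    both distributions are involutive: one direction is Frobenius, the other is
    the symmetry of second derivatives.  Given [f] and [g], complete them to
    coordinates [(g, x, f)]; then [Omega = rho dg /\ dx /\ df], and replacing
    [x] by a primitive [h] of [rho] along the [x]-lines gives
    [Omega = dg /\ dh /\ df].  In the coordinates [(g, h, f)] the first two
    frame vectors span [ker df] and the last two span [ker dg].

    The only differential equation involved is a scalar one depending smoothly
    on parameters.  Its variational equation is linear and scalar, hence solved
    by an explicit formula with exponentials and integrals, from which
    smoothness follows by bootstrapping.  Solving [d_m F = 1 / d_m h] inverts
    [h] in the [m]-th variable, which replaces the inverse function theorem:
    coordinates are exchanged one at a time. *)

(** * Calculus of C^k functions *)

Section Chain.
Context {R : realType}.
Implicit Types V W : normedModType R.

(** Smoothness on a set means [Ck] for every [k] on that same set, so neighbourhoods may not shrink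
    with [k]. Hence the radius on which the differential equation is solved depends only on bounds
    for its right-hand side and two derivatives of it. The solution is found there as a merely
    continuous function of all coordinates; it then gains one derivative after another on the
    unchanged box, because its partial derivatives are given by formulas in data as regular as the
    solution itself. The order [(g, h, f)] is imposed by the frames: their middle vector spans the
    intersection of the two planes. Once [f] and [g] are fixed, replacing the middle coordinate only
    rescales this vector and adds multiples of it to the two others, so both planes stay and the
    value of [Omega] on the frame is multiplied by one function. *)

Lemma is_derive_line V W (f : V -> W) x v d :
  is_derive x v f d <-> is_derive (0 : R) 1 (fun h : R => f (h *: v + x)) d.
Proof.
have E : (fun h : R => h^-1 *: ((f \o shift x) (h *: v) - f x)) =
  (fun h : R => h^-1 *: (((fun h : R => f (h *: v + x)) \o shift 0) (h *: 1)
     - f (0 *: v + x))).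
  by apply/funext => h /=; rewrite scale0r add0r addr0 /GRing.scale /= mulr1.
split=> -[D <-]; split.
- by rewrite /derivable -E.
- by rewrite /derive -E.
- by rewrite /derivable E.
- by rewrite /derive E.
Qed.

(** The inner map only needs a derivative in the direction [u]: along a line it is a function of one
    real variable, for which derivability and differentiability coincide. *)
Lemma is_derive_chain V' V W (g : V' -> V) (F : V -> W) p u v :
  is_derive p u g v -> differentiable F (g p) ->
  is_derive p u (F \o g) ('D_v F (g p)).
Proof.
move=> /is_derive_line [/derivable1_diffP Dg gv] DF; apply/is_derive_line.
have G0 : g (0 *: u + p) = g p by rewrite scale0r add0r.
have DF' : differentiable F (g (0 *: u + p)) by rewrite G0.
have D : differentiable (F \o (fun h : R => g (h *: u + p))) 0.
  exact: (differentiable_comp Dg DF').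
split; first exact: diff_derivable.
have -> : (fun h : R => (F \o g) (h *: u + p)) = F \o (fun h : R => g (h *: u + p)) by [].
by rewrite deriveE// diff_comp //= -(deriveE _ Dg) gv G0 deriveE.
Qed.

Lemma is_derive_ext V W (f g : V -> W) (U : set V) x v d : open U -> U x ->
  (forall y, U y -> f y = g y) -> is_derive x v f d -> is_derive x v g d.
Proof.
move=> oU Ux fg; apply: near_eq_is_derive.
by apply: filterS (open_nbhs_nbhs (conj oU Ux)).
Qed.

Lemma diff_epsP V W (f : V -> W) x : differentiable f x <-> exists df : {linear V -> W},
  continuous df /\ forall e, 0 < e -> \forall h \near (0 : V),
    `|f (h + x) - f x - df h| <= e * `|h|.
Proof.
split=> [D|[df [cdf H]]].
  exists ('d f x); split; first exact: diff_continuous.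
  have /eqaddoP H := diff_locally D.
  move=> e /H; apply: filterS => h /=.
  by rewrite /cst /= -[X in `|X| <= _]/(_ + _) -[X in `|_ - X|]/(_ + _) opprD addrA.
have E : f \o shift x = cst (f x) + df +o_ 0 id.
  apply/eqaddoP => e /H; apply: filterS => h /=.
  by rewrite /cst /= -[X in _ -> `|X| <= _]/(_ + _) -[X in _ -> `|_ - X| <= _]/(_ + _) opprD
      addrA.
apply/diff_locallyP; rewrite (diff_unique cdf E); split => //.
Qed.

Lemma differentiable_ext V W (f g : V -> W) (U : set V) x : open U -> U x ->
  (forall y, U y -> f y = g y) -> differentiable f x -> differentiable g x.
Proof.
move=> oU Ux fg /diff_epsP[df [cdf H]]; apply/diff_epsP; exists df; split => // e /H.
have := (nbhs0P _ _).1 (open_nbhs_nbhs (conj oU Ux)).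
by apply: filterS2 => h Uh; rewrite !fg // addrC.
Qed.
End Chain.

Section Prelim.
Context {R : realType}.

Lemma mvt_abs (f df : R -> R) (a b M : R) :
  (forall x, Num.min a b <= x <= Num.max a b ->
     is_derive x 1 f (df x) /\ `|df x| <= M) ->
  `|f b - f a| <= M * `|b - a|.
Proof.
wlog ab : a b / a <= b => [H|].
  have /orP[ab|ba] := le_total a b; first exact: H.
  by rewrite minC maxC distrC (distrC b); exact: H.
rewrite (min_idPl ab) (max_idPr ab) => H.
have [c /=] : exists2 c, c \in `[a, b] & f b - f a = df c * (b - a).
  apply: MVT_segment => // [x|].
    by rewrite in_itv /= => /andP[/ltW ax /ltW xb]; case: (H x); rewrite ?ax ?xb.
  apply: derivable_within_continuous => x; rewrite in_itv /= => xab.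
  by case: (H x xab).
rewrite in_itv /= => cab ->; rewrite normrM ler_wpM2r //.
by case: (H c cab).
Qed.

Lemma normrV_ge n (p : 'rV[R]_n) i : `|p 0 i| <= `|p|.
Proof.
rewrite [leRHS]/Num.Def.normr/= mx_normrE.
exact: (le_bigmax _ (fun ij : 'I_1 * 'I_n => `|p ij.1 ij.2|) (0, i)).
Qed.

Lemma normrV_le n (p : 'rV[R]_n) e : 0 <= e -> (forall i, `|p 0 i| <= e) -> `|p| <= e.
Proof.
move=> e0 H; rewrite [leLHS]/Num.Def.normr/= mx_normrE.
by apply: bigmax_le => // -[i j] _ /=; rewrite (ord1 i).
Qed.

Lemma norm_delta n (i : 'I_n) : `|delta_mx 0 i : 'rV[R]_n| <= 1.
Proof. by apply: normrV_le => // j; rewrite mxE; case: (_ && _); rewrite ?normr1 ?normr0. Qed.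

Lemma fun_row_sum (T : Type) n (g : T -> 'rV[R]_n) :
  g = \sum_i (fun x => g x 0 i *: delta_mx 0 i).
Proof. by apply/funext => x; rewrite fct_sumE -row_sum_delta. Qed.

Lemma continuous_row (T : topologicalType) n (g : T -> 'rV[R]_n) p :
  (forall i, {for p, continuous (fun x => g x 0 i)}) -> {for p, continuous g}.
Proof.
move=> H; rewrite (fun_row_sum g).
elim/big_ind : _ => [|f h cf ch|i _]; first exact: cvg_cst.
  exact: (cvgD cf ch).
by apply: cvgZr_tmp; exact: H.
Qed.

Context {V : normedModType R}.

Lemma differentiable_row n (g : V -> 'rV[R]_n) p :
  (forall i, differentiable (fun x => g x 0 i) p) -> differentiable g p.
Proof.
move=> H; rewrite (fun_row_sum g); apply: differentiable_sum => i.
exact: differentiableZl.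
Qed.

Lemma continuous_coord n (i : 'I_n) : continuous (fun p : 'rV[R]_n => p 0 i).
Proof. by move=> p; apply: differentiable_continuous; exact: differentiable_coord. Qed.

Lemma derive_linear (W : normedModType R) (f : V -> W) p (a : R) u v : differentiable f p ->
  'D_(a *: u + v) f p = a *: 'D_u f p + 'D_v f p.
Proof. by move=> D; rewrite !deriveE // linearP. Qed.

Lemma derive_row n (f : 'rV[R]_n -> R) p v : differentiable f p ->
  'D_v f p = \sum_i v 0 i * 'D_(delta_mx 0 i) f p.
Proof.
move=> D; rewrite deriveE // {1}(row_sum_delta v) linear_sum.
by apply: eq_bigr => i _; rewrite linearZ /= deriveE.
Qed.

Lemma is_derive_coord n (g : V -> 'rV[R]_n) p v d i :
  is_derive p v g d -> is_derive p v (fun x => g x 0 i) (d 0 i).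
Proof.
move=> [D <-]; split; first exact: (derivable_mxP _ _ _).1.
by rewrite derive_mx // mxE.
Qed.

Lemma is_derive_row n (g : V -> 'rV[R]_n) p v (d : 'rV[R]_n) :
  (forall i, is_derive p v (fun x => g x 0 i) (d 0 i)) -> is_derive p v g d.
Proof.
move=> H; have D : derivable g p v.
  by apply/derivable_mxP => i j; rewrite (ord1 i); case: (H j).
by split=> //; rewrite derive_mx //; apply/rowP => i; rewrite mxE; case: (H i).
Qed.

End Prelim.

Section CkTheory.
Context {R : realType} {V : normedModType R}.
Implicit Types (U : set V) (f g : V -> R).

Lemma Ck_ext (W : normedModType R) k U (f g : V -> W) : open U ->
  (forall x, U x -> f x = g x) -> Ck k U f -> Ck k U g.
Proof.
move=> oU; elim: k f g => [|k IH] f g fg /=.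
  move=> cf p Up; have nU := open_nbhs_nbhs (conj oU Up).
  rewrite /prop_for /continuous_at -(fg p Up).
  apply: cvg_trans (cf p Up); apply: near_eq_cvg.
  by apply: filterS nU => x /fg.
move=> [Df Cf]; split=> [p Up|v].
  exact: differentiable_ext oU Up fg (Df p Up).
apply: IH (Cf v) => p Up.
apply: near_eq_derive; apply: filterS (open_nbhs_nbhs (conj oU Up)).
exact: fg.
Qed.

Lemma Ck_subset (W : normedModType R) k U U' (f : V -> W) : U' `<=` U -> Ck k U f -> Ck k U' f.
Proof.
move=> sU; elim: k f => [|k IH] f /=; first by move=> cf p /sU/cf.
by move=> [Df Cf]; split=> [p /sU/Df//|v]; exact: IH.
Qed.

Lemma Ck_pred (W : normedModType R) k U (f : V -> W) : Ck k.+1 U f -> Ck k U f.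
Proof.
elim: k f => [|k IH] f.
  by move=> [Df _] p Up; exact: differentiable_continuous (Df p Up).
by move=> [Df Cf]; split => // v; exact: IH.
Qed.

Lemma Ck_continuous (W : normedModType R) k U (f : V -> W) p : Ck k U f -> U p ->
    {for p, continuous f}.
Proof. by elim: k => [|k IH]; [exact|move/Ck_pred]. Qed.

Lemma Ck_differentiable (W : normedModType R) k U (f : V -> W) p : Ck k.+1 U f -> U p ->
    differentiable f p.
Proof. by move=> [Df _] /Df. Qed.

Lemma Ck_cst (W : normedModType R) k U (c : W) : Ck k U (fun=> c).
Proof.
elim: k c => [|k IH] c /=; first by move=> p _; exact: cvg_cst.
split=> [p _|v]; first exact: differentiable_cst.
by rewrite (_ : derive _ ^~ v = fun=> 0)//; apply/funext => p; rewrite derive_cst.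
Qed.

Lemma Ck_add (W : normedModType R) k U (f g : V -> W) : open U ->
  Ck k U f -> Ck k U g -> Ck k U (fun x => f x + g x).
Proof.
move=> oU; elim: k f g => [|k IH] f g Hf Hg.
  by move=> p Up; apply: cvgD; [exact: Hf|exact: Hg].
split=> [p Up|v]; first by apply: differentiableD;
    [exact: Ck_differentiable Hf Up|exact: Ck_differentiable Hg Up].
apply: (Ck_ext oU _ (IH _ _ (Hf.2 v) (Hg.2 v))) => p Up.
by rewrite deriveD //; apply: diff_derivable; [exact: Ck_differentiable Hf Up|exact:
    Ck_differentiable Hg Up].
Qed.

Lemma Ck_mul k U f g : open U ->
  Ck k U f -> Ck k U g -> Ck k U (fun x => f x * g x).
Proof.
move=> oU; elim: k f g => [|k IH] f g Hf Hg.
  by move=> p Up; apply: cvgM; [exact: Hf|exact: Hg].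
split=> [p Up|v]; first by apply: differentiableM;
    [exact: Ck_differentiable Hf Up|exact: Ck_differentiable Hg Up].
have H := Ck_add oU (IH _ _ (Ck_pred Hf) (Hg.2 v)) (IH _ _ (Ck_pred Hg) (Hf.2 v)).
apply: (Ck_ext oU _ H) => p Up.
by rewrite deriveM //; apply: diff_derivable; [exact: Ck_differentiable Hf Up|exact:
    Ck_differentiable Hg Up].
Qed.

Lemma Ck_opp k U f : open U -> Ck k U f -> Ck k U (fun x => - f x).
Proof.
move=> oU Hf; apply: (Ck_ext oU _ (Ck_mul oU (Ck_cst k U (-1 : R)) Hf)) => x _.
by rewrite mulN1r.
Qed.

Lemma Ck_sub k U f g : open U ->
  Ck k U f -> Ck k U g -> Ck k U (fun x => f x - g x).
Proof. by move=> oU Hf Hg; apply: Ck_add => //; exact: Ck_opp. Qed.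

Lemma Ck_sum (W : normedModType R) k U (I : finType) (F : I -> V -> W) : open U ->
  (forall i, Ck k U (F i)) -> Ck k U (fun x => \sum_i F i x).
Proof.
move=> oU H; elim: (index_enum I) => [|i s IH].
  apply: (Ck_ext oU _ (Ck_cst k U (0 : W))) => x _; by rewrite big_nil.
by apply: (Ck_ext oU _ (Ck_add oU (H i) IH)) => x _; rewrite big_cons.
Qed.

Lemma Ck_inv k U f : open U -> (forall x, U x -> f x != 0) ->
  Ck k U f -> Ck k U (fun x => (f x)^-1).
Proof.
move=> oU f0; elim: k => [|k IH] Hf.
  by move=> p Up; apply: cvgV; [exact: f0|exact: Hf].
split=> [p Up|v]; first by apply: differentiableV; [exact: Ck_differentiable Hf Up|exact: f0].
have I := IH (Ck_pred Hf).
apply: (Ck_ext oU _ (Ck_opp oU (Ck_mul oU (Ck_mul oU I I) (Hf.2 v)))) => p Up.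
rewrite [RHS](@deriveV _ _ f p v (f0 p Up)); last exact: diff_derivable (Ck_differentiable Hf Up).
by rewrite -exprVn expr2 /GRing.scale /= mulNr.
Qed.

Lemma is_derive_expR_comp f p v d : is_derive p v f d ->
  is_derive p v (fun x => expR (f x)) (expR (f p) * d).
Proof.
move=> H; have D : differentiable (@expR R) (f p).
  by apply/derivable1_diffP; exact: derivable_expR.
have -> : expR (f p) * d = 'D_d (@expR R) (f p).
  rewrite (deriveE _ D) -[d in RHS]mulr1 [d * 1]/(d *: 1) linearZ /=.
  by rewrite -(deriveE _ D) derive_val mulrC.
exact: is_derive_chain.
Qed.

Lemma Ck_expR k U f : open U -> Ck k U f -> Ck k U (fun x => expR (f x)).
Proof.
move=> oU; elim: k => [|k IH] Hf.
  by move=> p Up; apply: (@continuous_comp _ _ _ f (@expR R)); [exact: Hf|exact: continuous_expR].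
split=> [p Up|v].
  apply: differentiable_comp; first exact: Ck_differentiable Hf Up.
  by apply/derivable1_diffP; exact: derivable_expR.
apply: (Ck_ext oU _ (Ck_mul oU (IH (Ck_pred Hf)) (Hf.2 v))) => p Up.
have D := derivableP (diff_derivable (Ck_differentiable Hf Up)).
by have [_ <-] := is_derive_expR_comp (D v).
Qed.

End CkTheory.

Section CkComp.
Context {R : realType} {V : normedModType R}.
Implicit Types (U : set V).

(** The derivative of the composite is a sum of products of derivatives of the components of [g], of
    class [k] by assumption, with partials of [f] at [g], of class [k] by induction. *)
Lemma Ck_comp k U m (g : V -> 'rV[R]_m) (O : set 'rV[R]_m) (f : 'rV[R]_m -> R) :
  open U -> (forall x, U x -> O (g x)) ->
  (forall i, Ck k U (fun x => g x 0 i)) -> Ck k O f -> Ck k U (fun x => f (g x)).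
Proof.
move=> oU gO; elim: k f => [|k IH] f Hg Hf.
  move=> p Up; apply: (@continuous_comp _ _ _ g f); last exact: Hf (gO p Up).
  by apply: continuous_row => i; exact: Hg.
have Dg p : U p -> differentiable g p.
  by move=> Up; apply: differentiable_row => i; exact: Ck_differentiable (Hg i) Up.
split=> [p Up|v].
  by apply: (@differentiable_comp _ _ _ _ g f); [exact: Dg|exact: Ck_differentiable Hf (gO p Up)].
have H : Ck k U (fun p => \sum_i 'D_v (fun x => g x 0 i) p * 'D_(delta_mx 0 i) f (g p)).
  apply: Ck_sum => // i; apply: Ck_mul => //; first exact: (Hg i).2.
  by apply: (IH _ _ (Hf.2 _)) => j; exact: Ck_pred.
apply: (Ck_ext oU _ H) => p Up.
have [_ ->] := is_derive_chain (derivableP (diff_derivable (v:=v) (Dg p Up)))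
    (Ck_differentiable Hf (gO p Up)).
rewrite derive_row; last exact: Ck_differentiable Hf (gO p Up).
by apply: eq_bigr => i _; rewrite derive_mx ?mxE //; apply: diff_derivable; exact: Dg.
Qed.

Lemma Ck_rowP k U m (g : V -> 'rV[R]_m) : open U ->
  Ck k U g <-> (forall i, Ck k U (fun x => g x 0 i)).
Proof.
move=> oU; elim: k g => [|k IH] g.
  split=> [cg i p Up|H p Up].
    by apply: (@continuous_comp _ _ _ g (fun q => q 0 i)); [exact: cg|exact: continuous_coord].
  by apply: continuous_row => i; exact: H.
have E p v i : U p -> differentiable g p -> 'D_v (fun x => g x 0 i) p = ('D_v g p) 0 i.
  by move=> Up D; rewrite derive_mx ?mxE //; exact: diff_derivable.
split=> [[Dg Cg] i|H].
  split=> [p Up|v].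
    by apply: (@differentiable_comp _ _ _ _ g (fun q => q 0 i));
        [exact: Dg|exact: differentiable_coord].
  by apply: (Ck_ext oU _ ((IH _).1 (Cg v) i)) => p Up; rewrite E //; exact: Dg.
have D p : U p -> differentiable g p.
  by move=> Up; apply: differentiable_row => i; exact: Ck_differentiable (H i) Up.
split => // v; apply/IH => i.
by apply: (Ck_ext oU _ ((H i).2 v)) => p Up; rewrite E //; exact: D.
Qed.
End CkComp.

(** Subtracting [s * d] from [f] along the segment leaves a function whose derivative is at most
    [e]. The comparisons of increments with their linear parts below rest on this. *)
Lemma partial_increment {R : realType} {V : normedModType R} (f : V -> R) (d : R) q u (t e : R) :
  (forall s, Num.min 0 t <= s <= Num.max 0 t ->
     exists2 d', is_derive (q + s *: u) u f d' & `|d' - d| <= e) ->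
  `|f (q + t *: u) - f q - t * d| <= e * `|t|.
Proof.
move=> H.
pose w s := f (q + s *: u) - s * d.
pose d' s := 'D_u f (q + s *: u) - d.
have -> : f (q + t *: u) - f q - t * d = w t - w 0.
  by rewrite /w scale0r mul0r subr0 addr0 addrAC.
rewrite -[t in leRHS]subr0; apply: (@mvt_abs _ w d') => s /H[x [D <-] xe]; split; last exact: xe.
apply: is_deriveB; last first.
  have := is_deriveM (is_derive_id s 1) (is_derive_cst d s (1 : R)).
  by rewrite scaler0 add0r /GRing.scale /= mulr1.
apply/is_derive_line.
have /is_derive_line := derivableP D.
have -> // : (fun h : R => f (h *: u + (q + s *: u))) = (fun h => f (q + (h *: 1 + s) *: u)).
apply/funext => h; congr f; have -> : h *: (1 : R) = h by exact: mulr1.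
by rewrite scalerDl addrCA.
Qed.

(** * Regularity from partial derivatives *)

Section CkRow.
Context {R : realType} {n : nat}.
Implicit Types (U : set 'rV[R]_n) (f : 'rV[R]_n -> R).

Lemma Ck_coord k U i : open U -> Ck k U (fun p : 'rV[R]_n => p 0 i).
Proof.
move=> oU; case: k => [|k]; first by move=> p _; exact: continuous_coord.
split=> [p _|v]; first exact: differentiable_coord.
apply: (Ck_ext oU _ (Ck_cst k U (v 0 i))) => p Up.
by have [_ ->] := is_derive_coord i (is_derive_id p v).
Qed.

Let step (p h : 'rV[R]_n) (k : nat) : 'rV[R]_n :=
  p + \row_i (if (i < k)%N then h 0 i else 0).

(** The increment is telescoped along [step], which moves one coordinate at a time; to each term the
    mean value inequality and the continuity of one partial apply. *)
Lemma diff_partials U f (d : 'I_n -> 'rV[R]_n -> R) p : open U -> U p ->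
  (forall q i, U q -> is_derive q (delta_mx 0 i) f (d i q)) ->
  (forall i, {for p, continuous (d i)}) ->
  differentiable f p.
Proof.
move=> oU Up Hf Hd; apply/diff_epsP.
pose df (v : 'rV[R]_n) := \sum_i v 0 i * d i p.
have ldf : linear df.
  move=> a u v; rewrite /df scaler_sumr -big_split; apply: eq_bigr => i _ /=.
  by rewrite !mxE mulrDl -mulrA.
pose Ldf := GRing.isLinear.Build R 'rV[R]_n R _ df ldf.
pose ldf' : {linear 'rV[R]_n -> R} := HB.pack df Ldf.
exists ldf'; split => [v|e e0].
  have H : Ck 0 setT (fun v : 'rV[R]_n => \sum_i v 0 i * d i p).
    apply: Ck_sum => [|i]; first exact: openT.
    by apply: Ck_mul; [exact: openT|apply: Ck_coord; exact: openT|exact: Ck_cst].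
  exact: (H v I).
(* There are [n] increments; dividing by [n + 1] keeps the quotient positive when [n = 0]. *)
have e1 : 0 < e / n.+1%:R by rewrite divr_gt0.
have [r /= r0 Hr] : exists2 r, 0 < r & forall q, `|p - q| < r ->
    U q /\ forall i, `|d i q - d i p| <= e / n.+1%:R.
  have N : \forall q \near p, U q /\ forall i, `|d i q - d i p| <= e / n.+1%:R.
    apply: filterI; first exact: open_nbhs_nbhs.
    have FF : Filter (nbhs p) by exact: nbhs_filter.
    refine (@filter_forall _ _ (fun i q => `|d i q - d i p| <= e / n.+1%:R) (nbhs p) FF _) => i.
    have /cvgrPdist_le /(_ _ e1) := Hd i.
    by apply: filterS => q; rewrite distrC.
  have /nbhs_ballP[r r0 H] := N; exists r => // q pq; apply: H.
  by rewrite -ball_normE.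
have N : \forall h \near (0 : 'rV[R]_n), `|h| < r by exact: nbhs0_lt.
apply: filterS N => h hr; rewrite /ldf' /= /df.
have S0 : step p h 0 = p by apply/rowP => i; rewrite !mxE ltn0 addr0.
have Sn : step p h n = h + p by apply/rowP => i; rewrite !mxE ltn_ord addrC.
have SS (k : 'I_n) : step p h k.+1 = step p h k + h 0 k *: delta_mx 0 k.
  apply/rowP => i; rewrite !mxE ltnS -addrA; congr (_ + _).
  rewrite leq_eqVlt eqxx /=; have [->|ik] := eqVneq i k.
    by rewrite eqxx ltnn mulr1 add0r.
  by rewrite mulr0 addr0 -val_eqE /= in ik *; rewrite (negbTE ik).
rewrite -Sn -[in f p]S0.
rewrite -(telescope_sumr (fun k => f (step p h k))) // big_mkord -sumrB.
apply: le_trans (ler_norm_sum _ _ _) _.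
have B (i : 'I_n) : `|f (step p h i.+1) - f (step p h i) - h 0 i * d i p| <= e / n.+1%:R * `|h|.
  rewrite SS; apply: le_trans (_ : e / n.+1%:R * `|h 0 i| <= _); last first.
    by rewrite ler_wpM2l ?normrV_ge // ltW.
  apply: (@partial_increment _ _ f _ _ (delta_mx 0 i)) => s sh.
  have [|UQ dQ] := Hr (step p h i + s *: delta_mx 0 i).
    apply: le_lt_trans hr; rewrite distrC.
    rewrite /step addrAC [p + _]addrC addrK.
    apply: normrV_le => // j; rewrite !mxE /=.
    have [->|ji] := eqVneq j i.
      rewrite ltnn mulr1 add0r; apply: le_trans (normrV_ge h i).
      move: sh; case: (leP 0 (h 0 i)) => hi /andP[s1 s2].
        by rewrite !ger0_norm.
      by rewrite !ler0_norm ?lerN2 // ltW.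
    by rewrite mulr0 addr0; case: ifP => _; rewrite ?normrV_ge ?normr0.
  exists (d i (step p h i + s *: delta_mx 0 i)); first exact: Hf.
  exact: dQ.
apply: le_trans (ler_sum _ (fun i _ => B i)) _.
rewrite sumr_const card_ord -[leLHS]mulr_natl mulrA ler_wpM2r // mulrCA ger_pMr //.
by rewrite ler_pdivrMr ?ltr0n // mul1r ler_nat.
Qed.

(** [Ck] quantifies over all directions; once continuous partials give differentiability, the
    derivative in any direction is a fixed linear combination of partials. *)
Lemma Ck_partials k U f (d : 'I_n -> 'rV[R]_n -> R) : open U ->
  (forall q i, U q -> is_derive q (delta_mx 0 i) f (d i q)) ->
  (forall i, Ck k U (d i)) -> Ck k.+1 U f.
Proof.
move=> oU Hf Hd.
have D p : U p -> differentiable f p.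
  by move=> Up; apply: diff_partials Hf _ => // i; exact: Ck_continuous (Hd i) Up.
split=> // v; have H : Ck k U (fun p => \sum_i v 0 i * d i p).
  by apply: Ck_sum => // i; apply: Ck_mul => //; exact: Ck_cst.
apply: (Ck_ext oU _ H) => p Up; rewrite derive_row //; last exact: D.
by apply: eq_bigr => i _; have [_ ->] := Hf p i Up.
Qed.
End CkRow.

Lemma is_derive_shift_arg {R : realType} {V W : normedModType R} (f : V -> W) q v c d :
  is_derive (q + c) v f d -> is_derive q v (fun x => f (x + c)) d.
Proof.
move=> /is_derive_line H; apply/is_derive_line.
by rewrite (_ : (fun h => _) = (fun h : R => f (h *: v + (q + c)))) //; apply/funext => h;
    rewrite addrA.
Qed.

(** * Symmetry of second derivatives *)

Section Schwarz.
Context {R : realType} {V : normedModType R}.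

(** The second difference is the increment along [v] of the function [g q = f (q + h u) - f q]. The
    mean value inequality is used twice: along [v] for [g], then along [u] for [Dv]. *)
Let second_difference (U : set V) (f Dv D : V -> R) p u v e : open U -> U p ->
  {for p, continuous D} ->
  (forall q, U q -> is_derive q v f (Dv q)) ->
  (forall q, U q -> is_derive q u Dv (D q)) -> 0 < e ->
  \forall h \near (0 : R),
    `|f (p + h *: v + h *: u) - f (p + h *: v) - (f (p + h *: u) - f p) - h * (h * D p)|
      <= e * `|h| * `|h|.
Proof.
move=> oU Up cD Dg DD e0.
have N : \forall q \near p, U q /\ `|D q - D p| <= e.
  apply: filterI; first exact: open_nbhs_nbhs.
  have /cvgrPdist_le /(_ _ e0) := cD.
  by apply: filterS => q; rewrite distrC.
have /nbhs_ballP[r /= r0 H] := N.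
(* For [|h|] below this bound the parallelogram at [p] with sides [h v] and [h u] lies in the ball
   of radius [r]; the summand 1 covers [u = v = 0]. *)
have M : 0 < r / (1 + `|u| + `|v|).
  by rewrite divr_gt0 // -addrA ltr_wpDr ?addr_ge0.
have N' : \forall h \near (0 : R), `|h| < r / (1 + `|u| + `|v|) by exact: nbhs0_lt.
apply: filterS N' => h; rewrite ltr_pdivlMr; last by rewrite -addrA ltr_wpDr ?addr_ge0.
move=> hr.
have B s s' : `|s| <= `|h| -> `|s'| <= `|h| -> U (p + s *: v + s' *: u) /\
    `|D (p + s *: v + s' *: u) - D p| <= e.
  move=> sh sh'; apply: H; rewrite -ball_normE /=.
  rewrite -addrA opprD addNKr normrN.
  apply: le_lt_trans (ler_normD _ _) _; rewrite !normrZ.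
  apply: (@le_lt_trans _ _ (`|h| * `|v| + `|h| * `|u|)).
    by apply: lerD; apply: ler_wpM2r.
  have : 0 <= `|h| by [].
  by lra.
have K s (t : R) : Num.min 0 t <= s <= Num.max 0 t -> `|s| <= `|t|.
  case: (leP 0 t) => ht /andP[s1 s2]; first by rewrite !ger0_norm.
  by rewrite !ler0_norm ?lerN2 // ltW.
pose g q := f (q + h *: u) - f q.
have -> : f (p + h *: v + h *: u) - f (p + h *: v) - (f (p + h *: u) - f p) =
  g (p + h *: v) - g p by [].
apply: partial_increment => s /K sh.
have U0 : U (p + s *: v).
  by have [] := B s 0 sh; rewrite ?normr0 // scale0r addr0.
have U1 : U (p + s *: v + h *: u) by have [] := B s h sh.
exists (Dv (p + s *: v + h *: u) - Dv (p + s *: v)).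
  have H2 := is_deriveB (is_derive_shift_arg (Dg _ U1)) (Dg _ U0). exact: H2.
apply: partial_increment => s' /K s'h.
have [U2 ?] := B s s' sh s'h.
exists (D (p + s *: v + s' *: u)) => //.
exact: DD.
Qed.

(** The second difference is symmetric in [u] and [v], and divided by [h * h] it is within [e / 2]
    of either mixed derivative. *)
Lemma derive_comm (U : set V) (f : V -> R) p u v : open U -> U p -> Ck 2 U f ->
  'D_u ('D_v f) p = 'D_v ('D_u f) p.
Proof.
move=> oU Up Cf; apply/eqP; rewrite -subr_eq0 -normr_le0; apply/ler_addgt0Pr => e e0.
rewrite add0r; have e2 : 0 < e / 2 by rewrite divr_gt0.
have D1 w q : U q -> is_derive q w f ('D_w f q).
  by move=> Uq; apply: derivableP; apply: diff_derivable; exact: Ck_differentiable Cf Uq.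
have D2 w w' q : U q -> is_derive q w' ('D_w f) ('D_w' ('D_w f) q).
  move=> Uq; apply: derivableP; apply: diff_derivable.
  exact: (@Ck_differentiable _ _ _ 0 U _ q (Cf.2 w) Uq).
have N1 := second_difference oU Up ((Cf.2 v).2 u p Up) (D1 v) (D2 v u) e2.
have N2 := second_difference oU Up ((Cf.2 u).2 v p Up) (D1 u) (D2 u v) e2.
have N3 := filterI N1 N2.
have [r /= r0 H] := (@nbhs_ballP R R _ _).1 (N3 (nbhs_filter _)).
have [] := H (r / 2).
  by rewrite -ball_normE /= sub0r normrN gtr0_norm ?divr_gt0 // ltr_pdivrMr // ltr_pMr // ltr1n.
have : 0 < r / 2 by rewrite divr_gt0.
move: (r / 2) => h h0.
rewrite [p + h *: v + _]addrAC.
set a := f (_ + _ + _); set b := f (_ + _); set c := f (_ + _); set d := f p.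
move: ('D_u ('D_v f) p) ('D_v ('D_u f) p) => A B; rewrite (gtr0_norm h0) => H1 H2.
have : h * h * `|A - B| <= h * h * e.
  have -> : h * h * `|A - B| = `|h * (h * A) - h * (h * B)|.
    by rewrite -!mulrBr !normrM !(gtr0_norm h0) mulrA.
  rewrite (_ : h * _ - _ = (a - c - (b - d) - h * (h * B)) - (a - b - (c - d) - h * (h * A)));
      last by ring.
  apply: le_trans (ler_normB _ _) _.
  by apply: le_trans (lerD H2 H1) _; lra.
by rewrite ler_pM2l // mulr_gt0.
Qed.
End Schwarz.

(** * Primitives depending on parameters *)

Section Primitive.
Import measure lebesgue_measure lebesgue_integral ftc.
Context {R : realType}.
Notation mu := (@lebesgue_measure R).

Let primitive_closed (h : R -> R) (c s : R) : 0 < s ->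
  (forall x, `|x - c| <= s -> {for x, continuous h}) ->
  exists2 G : R -> R, G c = 0 & forall x, `|x - c| < s -> is_derive x 1 G (h x).
Proof.
move=> s0 ch.
pose F x := (\int[mu]_(t in [set` `[c - s, x]]) (h t))%R.
have ih : mu.-integrable `[c - s, c + s] (EFin \o h).
  apply: continuous_compact_integrable; first exact: segment_compact.
  apply: continuous_in_subspaceT => x; rewrite inE /= in_itv /= => xs.
  by apply: ch; rewrite ler_distl.
exists (fun x => F x - F c) => [|x xc]; first by rewrite subrr.
have /andP[x1 x2] : (c - s < x < c + s) by rewrite -ltr_distl.
have [D1 D2] := continuous_FTC1_closed x2 ih x1 (ch x (ltW xc)).
have HF : is_derive x 1 F (h x) by split; [exact: D1|rewrite -derive1E; exact: D2].
have := is_deriveB HF (is_derive_cst (F c) x 1).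
by rewrite subr0.
Qed.

Let derive0_unique (f g h : R -> R) (c s : R) :
  (forall x, `|x - c| < s -> is_derive x 1 f (h x)) ->
  (forall x, `|x - c| < s -> is_derive x 1 g (h x)) ->
  f c = g c -> forall x, `|x - c| < s -> f x = g x.
Proof.
move=> Hf Hg fg x xc; apply/eqP; rewrite -subr_eq0 -normr_le0.
have := @mvt_abs _ (f - g) (fun=> 0) c x 0; rewrite mul0r.
have -> : (f - g) c = 0 by rewrite /= -[LHS]/(f c - g c) fg subrr.
rewrite subr0; apply => y yb; split; last by rewrite normr0.
have yc : `|y - c| < s.
  apply: le_lt_trans xc; move: yb; case: (leP c x) => cx /andP[y1 y2].
    by rewrite !ger0_norm ?subr_ge0 // lerD2r.
  by rewrite !ler0_norm ?subr_le0 ?lerN2 ?lerD2r // ltW.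
by have := is_deriveB (Hf y yc) (Hg y yc); rewrite subrr.
Qed.

(** [h] may be unbounded near the ends of the open interval, so primitives on smaller concentric
    intervals are glued; they vanish at [c] and hence agree on common intervals. *)
Lemma primitive_exists (h : R -> R) (c s : R) : 0 < s ->
  (forall x, `|x - c| < s -> {for x, continuous h}) ->
  exists2 G : R -> R, G c = 0 & forall x, `|x - c| < s -> is_derive x 1 G (h x).
Proof.
move=> s0 ch.
have /choice [G HG] : forall r, exists G : R -> R, 0 < r < s ->
    G c = 0 /\ forall x, `|x - c| < r -> is_derive x 1 G (h x).
  move=> r; have [/andP[r0 rs]|N] := boolP (0 < r < s); last by exists (fun=> 0).
  have [|G G0 HG] := @primitive_closed h c r r0; last by exists G.
  by move=> x xr; apply: ch; exact: le_lt_trans rs.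
(* Half way between [|x - c|] and [s], so that the primitive chosen for [x] is valid on a
   neighbourhood of [x]. *)
pose r x := (`|x - c| + s) / 2.
have rP x : `|x - c| < s -> 0 < r x < s /\ `|x - c| < r x.
  by move=> xs; have : 0 <= `|x - c| by []; rewrite /r; split; lra.
exists (fun x => G (r x) x) => [|x xs].
  by have [|/HG[]//] := rP c; rewrite subrr normr0.
have [rx xr] := rP x xs; have [G0 DG] := HG _ rx.
have oU : open [set y | `|y - c| < r x].
  rewrite (_ : [set y | _] = ball c (r x)); first by apply: ball_open; case/andP: rx.
  by apply/seteqP; split=> y /=; rewrite -ball_normE /= distrC.
apply: is_derive_ext oU xr _ (DG x xr) => y /= yr.
have ys : `|y - c| < s by case/andP: rx => _; exact: lt_trans.
have [ry yry] := rP y ys; have [G0y DGy] := HG _ ry.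
have M z : `|z - c| < Num.min (r x) (r y) -> `|z - c| < r x /\ `|z - c| < r y.
  by rewrite lt_min => /andP[].
apply: (@derive0_unique _ _ h c (Num.min (r x) (r y))) => [z /M[? _]|z /M[_ ?]||].
- exact: DG.
- exact: DGy.
- by rewrite G0 G0y.
- by rewrite lt_min yr.
Qed.
End Primitive.

(** * Moving one coordinate; coordinate boxes *)

Section Upd.
Context {R : realType} {n : nat}.
Implicit Types (p : 'rV[R]_n) (i j k : 'I_n).

Definition upd p j (s : R) : 'rV[R]_n := \row_k (if k == j then s else p 0 k).

Lemma upd_at p j s : upd p j s 0 j = s.
Proof. by rewrite mxE eqxx. Qed.

Lemma upd_ne p j s k : k != j -> upd p j s 0 k = p 0 k.
Proof. by rewrite mxE => /negbTE ->. Qed.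

Lemma upd_upd p j s t : upd (upd p j s) j t = upd p j t.
Proof. by apply/rowP => k; rewrite !mxE; case: (k == j). Qed.

Lemma upd_id p j : upd p j (p 0 j) = p.
Proof. by apply/rowP => k; rewrite !mxE; case: eqP => [->|]. Qed.

Lemma upd_comm p j k s t : j != k -> upd (upd p j s) k t = upd (upd p k t) j s.
Proof.
move=> jk; apply/rowP => l; rewrite !mxE; case: eqP => // ->.
by move: jk; rewrite eq_sym => /negbTE ->.
Qed.

Lemma updE p j s : upd p j s = p + (s - p 0 j) *: delta_mx 0 j.
Proof.
apply/rowP => k; rewrite !mxE /=; case: (k =P j) => [->|_]; first by rewrite mulr1 addrC subrK.
by rewrite mulr0 addr0.
Qed.

Lemma upd_add p j s t : upd p j s + t *: delta_mx 0 j = upd p j (s + t).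
Proof.
apply/rowP => k; rewrite !mxE /=; case: (k =P j) => _; first by rewrite mulr1.
by rewrite mulr0 addr0.
Qed.

Lemma add_upd p j t : p + t *: delta_mx 0 j = upd p j (p 0 j + t).
Proof. by rewrite -upd_add upd_id. Qed.

Lemma is_derive_upd (W : normedModType R) (f : 'rV[R]_n -> W) p j s d :
  is_derive (upd p j s) (delta_mx 0 j) f d <-> is_derive s 1 (fun t => f (upd p j t)) d.
Proof.
split=> /is_derive_line H; apply/is_derive_line; move: H;
rewrite (_ : (fun h : R => f (h *: delta_mx 0 j + upd p j s)) =
    (fun h : R => f (upd p j (h *: 1 + s)))) //;
by apply/funext => h; rewrite addrC upd_add addrC (_ : h *: (1 : R) = h) //; exact: mulr1.
Qed.

Definition box (c : 'rV[R]_n) (r : R) : set 'rV[R]_n :=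
  [set p | forall k, `|p 0 k - c 0 k| < r].

Lemma box_upd c r p j s : box c r p -> `|s - c 0 j| < r -> box c r (upd p j s).
Proof. by move=> bp sj k; rewrite mxE; case: (k =P j) => [->|_]. Qed.

Lemma box_center c r : 0 < r -> box c r c.
Proof. by move=> r0 k; rewrite subrr normr0. Qed.

Lemma box_le c r r' : r <= r' -> box c r `<=` box c r'.
Proof. by move=> rr p H k; exact: lt_le_trans rr. Qed.

Lemma open_box c r : open (box c r).
Proof.
rewrite openE => p bp.
refine (@filter_forall _ _ (fun k (q : 'rV[R]_n) => `|q 0 k - c 0 k| < r) (nbhs p)
    (nbhs_filter p) _) => k.
have H : {for p, continuous (fun q : 'rV[R]_n => `|q 0 k - c 0 k|)}.
  have H := @continuous_coord R n k p.
  exact: (cvg_norm (cvgB H (cvg_cst (c 0 k)))).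
exact: (cvgr_lt _ H).
Qed.

Lemma nbhs_box c (U : set 'rV[R]_n) : nbhs c U -> exists2 r, 0 < r & box c r `<=` U.
Proof.
move=> /nbhs_ballP[r /= r0 H]; exists (r / 2); first by rewrite divr_gt0.
move=> p bp; apply: H; rewrite -ball_normE /=.
apply: (@le_lt_trans _ _ (r / 2)); last by rewrite ltr_pdivrMr // ltr_pMr // ltr1n.
apply: normrV_le => [|k]; first by rewrite divr_ge0 // ltW.
by rewrite !mxE distrC; exact: ltW.
Qed.

Lemma box_between c r p j s t : box c r p -> `|t - c 0 j| < r ->
  Num.min (p 0 j) t <= s <= Num.max (p 0 j) t -> `|s - c 0 j| < r.
Proof.
move=> /(_ j); rewrite !ltr_distl => /andP[a b] /andP[a' b'].
by case: (leP (p 0 j) t) => _ /andP[u v]; apply/andP; split; lra.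
Qed.
End Upd.

Lemma is_derive_eps {R : realType} {V : normedModType R} (f : V -> R) p v d :
  (forall e, 0 < e -> \forall h \near (0 : R), `|f (p + h *: v) - f p - h * d| <= e * `|h|) ->
  is_derive p v f d.
Proof.
move=> H.
have C : (fun h : R => h^-1 *: ((f \o shift p) (h *: v) - f p)) @ 0^' --> d.
  apply/cvgrPdist_le => e e0; rewrite near_withinE; apply: filterS (H e e0) => h /= Hh h0.
  rewrite distrC.
  have -> : h^-1 *: (f (h *: v + p) - f p) - d = h^-1 * (f (p + h *: v) - f p - h * d).
    by rewrite [h *: v + p]addrC; move: (f _ - f p) => X; rewrite mulrBr mulKf.
  by rewrite normrM normfV ler_pdivrMl ?normr_gt0 // [leRHS]mulrC.
by split; [apply/cvg_ex; exists d|exact: cvg_lim].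
Qed.

(** * Regularity of primitives in their parameters *)

Section ParamPrimitive.
Context {R : realType} {n : nat}.
Implicit Types (p q c : 'rV[R]_n) (i j k : 'I_n).

Lemma line_bound (f : 'rV[R]_n -> R) (df : R -> R) p j (a b M : R) :
  (forall s, Num.min a b <= s <= Num.max a b ->
     is_derive (upd p j s) (delta_mx 0 j) f (df s) /\ `|df s| <= M) ->
  `|f (upd p j b) - f (upd p j a)| <= M * `|b - a|.
Proof.
move=> H; apply: (@mvt_abs _ (fun s => f (upd p j s)) df) => s /H[D ?]; split => //.
exact/is_derive_upd.
Qed.

(** Compactness of the segment makes the continuity of [g] uniform in [s]: one neighbourhood of [p]
    serves the whole segment in direction [j]. *)
Lemma tube c (r : R) (g : 'rV[R]_n -> R) p j (a b e : R) :
  (forall q, box c r q -> {for q, continuous g}) -> box c r p ->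
  (forall s, a <= s <= b -> `|s - c 0 j| < r) -> 0 < e ->
  \forall q \near p, forall s, a <= s <= b -> `|g (upd q j s) - g (upd p j s)| <= e.
Proof.
move=> cg bp ab e0; have e2 : 0 < e / 2 by rewrite divr_gt0.
have := (compact_near_coveringP _).1 (@segment_compact R a b).
move=> /(_ 'rV[R]_n (nbhs p) (fun q s => `|g (upd q j s) - g (upd p j s)| <= e) (nbhs_filter p)).
have K (P : set R) : `[a, b] `<=` P -> forall s, a <= s <= b -> P s.
  by move=> H s sab; apply: H; rewrite /= in_itv.
move=> H; apply: filterS (H _) => [q /K //|s].
rewrite /= in_itv /= => /ab sc.
have /cvgrPdist_le /(_ _ e2) := cg _ (box_upd bp sc).
move=> /nbhs_ballP[d /= d0 Hd].
exists (ball s d, ball p d); first by split; exact: nbhsx_ballx.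
move=> [s' q] [/= ss' pq].
have B q' : `|p - q'| < d -> `|upd p j s - upd q' j s'| < d.
  move=> pq'; apply: (@le_lt_trans _ _ (Num.max `|s - s'| `|p - q'|)); last first.
    by rewrite gt_max pq' andbT; rewrite -ball_normE in ss'.
  apply: normrV_le => [|k]; first by rewrite le_max normr_ge0.
  rewrite !mxE le_max; case: (k == j); first by rewrite lexx.
  by apply/orP; right; have := normrV_ge (p - q') k; rewrite !mxE.
have HB q' : `|p - q'| < d -> `|g (upd p j s) - g (upd q' j s')| <= e / 2.
  by move=> /B pq'; apply: Hd; rewrite -ball_normE.
have H1 : `|g (upd p j s) - g (upd q j s')| <= e / 2.
  by apply: HB; rewrite -ball_normE in pq.
have H2 : `|g (upd p j s) - g (upd p j s')| <= e / 2.
  by apply: HB; rewrite subrr normr0.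
rewrite /= (_ : g _ - g _ = (g (upd p j s) - g (upd p j s')) -
    (g (upd p j s) - g (upd q j s'))); last by ring.
by apply: le_trans (ler_normB _ _) _; rewrite (splitr e); exact: lerD.
Qed.

(** A primitive is chosen for each line in direction [j]. Indexing the choice by [upd p j (c 0 j)],
    where the line meets the base hyperplane, gives all points of a line the same primitive. *)
Lemma param_primitive_exists c (r : R) j (g : 'rV[R]_n -> R) : 0 < r ->
  (forall p, box c r p -> {for p, continuous g}) ->
  exists2 G : 'rV[R]_n -> R, forall p, box c r p -> is_derive p (delta_mx 0 j) G (g p) &
    forall p, box c r p -> G (upd p j (c 0 j)) = 0.
Proof.
move=> r0 cg.
have /choice [P HP] : forall q, exists P : R -> R, box c r q ->
    P (c 0 j) = 0 /\ forall s, `|s - c 0 j| < r -> is_derive s 1 P (g (upd q j s)).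
  move=> q; have [bq|nq] := pselect (box c r q); last by exists (fun=> 0).
  have [s sr|P P0 HP] := @primitive_exists R (fun s => g (upd q j s)) (c 0 j) r r0.
    apply: (@continuous_comp _ _ _ (upd q j) g); last exact/cg/box_upd.
    apply: continuous_row => k; rewrite (_ : (fun x => _) = if k == j then id else fun=> q 0 k).
      by case: ifP => _; [exact: cvg_id|exact: cvg_cst].
    by apply/funext => x; rewrite mxE; case: ifP.
  by exists P.
exists (fun p => P (upd p j (c 0 j)) (p 0 j)) => p bp.
  rewrite -[p in is_derive p](upd_id p j); apply/is_derive_upd.
  have cj : `|c 0 j - c 0 j| < r by rewrite subrr normr0.
  have [_ /(_ _ (bp j))] := HP _ (box_upd bp cj).
  rewrite upd_upd upd_id.
  by rewrite (_ : (fun t => _) = P (upd p j (c 0 j))) //; apply/funext => t; rewrite upd_upd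
      upd_at.
have cj : `|c 0 j - c 0 j| < r by rewrite subrr normr0.
by have [H _] := HP _ (box_upd bp cj); rewrite upd_upd upd_at.
Qed.

Lemma between_norm (a b s : R) : Num.min a b <= s <= Num.max a b -> `|s - a| <= `|b - a|.
Proof.
case: (leP a b) => ab /andP[s1 s2]; first by rewrite !ger0_norm ?subr_ge0 // lerD2r.
by rewrite !ler0_norm ?subr_le0 ?lerN2 ?lerD2r // ltW.
Qed.

(** Differentiation under the integral sign: the partial of [G] in a direction [i] other than [j] is
    the primitive of the [i]-th partial of [g] vanishing on the same hyperplane, of class [k] by
    induction; the [j]-th partial is [g] itself. *)
Lemma Ck_param_primitive (k : nat) c (r : R) j (g G : 'rV[R]_n -> R) : 0 < r ->
  (forall p, box c r p -> is_derive p (delta_mx 0 j) G (g p)) ->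
  (forall p, box c r p -> G (upd p j (c 0 j)) = 0) ->
  Ck k (box c r) g -> Ck k (box c r) G.
Proof.
move=> r0; have oB := @open_box R n c r.
have cj : `|c 0 j - c 0 j| < r by rewrite subrr normr0.
have btw p s : box c r p -> Num.min (c 0 j) (p 0 j) <= s <= Num.max (c 0 j) (p 0 j) -> `|s - c
    0 j| < r.
  by move=> bp /between_norm H; exact: le_lt_trans (bp j).
have nB p : box c r p -> nbhs p (box c r) by move=> bp; exact: open_nbhs_nbhs.
elim: k g G => [|k IH] g G dG G0 Cg.
  move=> p bp; apply/(@cvgrPdist_le R R 'rV[R]_n (nbhs p) (nbhs_filter p)) => e e0.
  have e1 : 0 < e / 2 / r by rewrite !divr_gt0.
  have T := tube Cg bp (fun s => btw p s bp) e1.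
  have /cvgrPdist_le /(_ _ ltr01) /nbhs_ballP [d /= d0 Hd] := Cg p bp.
  have M0 : 0 < `|g p| + 1 by rewrite ltr_wpDl.
  have N : \forall q \near p, `|p - q| < d /\ `|p - q| <= e / 2 / (`|g p| + 1).
    have d1 : 0 < Num.min d (e / 2 / (`|g p| + 1)) by rewrite lt_min d0 !divr_gt0.
    apply/nbhs_ballP; exists (Num.min d (e / 2 / (`|g p| + 1))) => //= q.
    by rewrite -ball_normE /= lt_min => /andP[-> /ltW ->].
  apply: filterS3 T N (nB p bp) => q Tq [pq1 pq2] bq.
  (* The path from [q] to [p] first runs along [j], where the slope is at most [|g p| + 1], and then
     across the lines, where the tube controls the difference of the two primitives. *)
  have A1 : `|G (upd q j (q 0 j)) - G (upd q j (p 0 j))| <= (`|g p| + 1) * `|q 0 j - p 0 j|.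
    apply: (@line_bound G (fun s => g (upd q j s))) => s sb; split.
      by apply/dG/box_upd => //; apply: box_between bp (bq j) sb.
    have : `|g p - g (upd q j s)| <= 1.
      apply: Hd; rewrite -ball_normE /=; apply: le_lt_trans pq1.
      apply: normrV_le => // i; apply: le_trans (normrV_ge (p - q) i); rewrite !mxE.
      case: (i =P j) => [->|//]; rewrite -normrN opprB [leRHS]distrC.
      exact: between_norm.
    rewrite distrC => H; rewrite -[g (upd q j s)](subrK (g p)) addrC.
    by apply: le_trans (ler_normD _ _) _; rewrite lerD2l.
  have A2 : `|(G (upd q j (p 0 j)) - G (upd p j (p 0 j))) -
      (G (upd q j (c 0 j)) - G (upd p j (c 0 j)))| <= e / 2 / r * `|p 0 j - c 0 j|.
    apply: (@mvt_abs _ (fun s => G (upd q j s) - G (upd p j s))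
        (fun s => g (upd q j s) - g (upd p j s))) => s sb.
    have sr := btw p s bp sb; split; last exact: Tq.
    by apply: is_deriveB; apply/is_derive_upd/dG/box_upd.
  rewrite !G0 // subrr subr0 upd_id in A2; rewrite upd_id in A1.
  rewrite (_ : G p - G q = - (G q - G (upd q j (p 0 j))) - (G (upd q j (p 0 j)) - G p)); last
      by ring.
  apply: le_trans (ler_normB _ _) _; rewrite normrN (splitr e); apply: lerD.
    apply: le_trans A1 _; rewrite mulrC -ler_pdivlMr //; apply: le_trans pq2.
    by rewrite distrC; have := normrV_ge (p - q) j; rewrite !mxE.
  apply: le_trans A2 _; rewrite -[leRHS](divfK (lt0r_neq0 r0)).
  by rewrite ler_wpM2l ?ltW // bp.
have /choice [H HH] : forall i, exists H : 'rV[R]_n -> R,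
    (forall p, box c r p -> is_derive p (delta_mx 0 j) H ('D_(delta_mx 0 i) g p)) /\
    forall p, box c r p -> H (upd p j (c 0 j)) = 0.
  move=> i; have [|H H1 H2] := @param_primitive_exists c r j ('D_(delta_mx 0 i) g) r0; last by
      exists H.
  by move=> p bp; exact: Ck_continuous (Cg.2 _) bp.
have CH i : Ck k (box c r) (H i) by apply: IH (HH i).1 (HH i).2 (Cg.2 _).
pose dd i := if i == j then g else H i.
apply: (@Ck_partials _ _ _ _ _ dd) => // [p i bp|i]; last first.
  by rewrite /dd; case: ifP => _ //; exact: Ck_pred.
rewrite /dd; have [->|ij] := eqVneq i j; first exact: dG.
apply: is_derive_eps => e e0.
have e1 : 0 < e / r by rewrite divr_gt0.
have T := tube (fun q bq => Ck_continuous (Cg.2 (delta_mx 0 i)) bq) bp (fun s => btw p s bp) e1.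
have N0 := filterI (nB p bp) T.
have /nbhs_ballP[d /= d0 Hd] := N0 (nbhs_filter p).
have {}Hd t : `|t| < d -> box c r (p + t *: delta_mx 0 i) /\
    forall s, Num.min (c 0 j) (p 0 j) <= s <= Num.max (c 0 j) (p 0 j) ->
    `|'D_(delta_mx 0 i) g (upd (p + t *: delta_mx 0 i) j s) - 'D_(delta_mx 0 i) g (upd p j s)|
        <= e / r.
  move=> td; apply: Hd; rewrite -ball_normE /= opprD addNKr normrN normrZ.
  by apply: le_lt_trans td; rewrite ler_piMr // norm_delta.
have N : \forall h \near (0 : R), `|h| < d by exact: nbhs0_lt.
apply: filterS N => h hd.
have ji : j != i by rewrite eq_sym.
(* Error of the first-order expansion of [G] in direction [i], as a function of the [j]-th
   coordinate. It vanishes at [c 0 j]; its derivative is the same error for [g], at most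
   [e / r * |h|] by the tube, and the interval is shorter than [r]. *)
pose w s := G (upd p j s + h *: delta_mx 0 i) - G (upd p j s) - h * H i (upd p j s).
have wc : w (c 0 j) = 0.
  have [phd _] := Hd h hd.
  rewrite /w (HH i).2 // mulr0 subr0 G0 // subr0.
  have -> : upd p j (c 0 j) + h *: delta_mx 0 i = upd (p + h *: delta_mx 0 i) j (c 0 j).
    by rewrite !add_upd upd_comm // upd_ne.
  exact: G0.
have -> : G (p + h *: delta_mx 0 i) - G p - h * H i p = w (p 0 j) - w (c 0 j).
  by rewrite wc subr0 /w upd_id.
apply: (@le_trans _ _ (e / r * `|h| * `|p 0 j - c 0 j|)); last first.
  rewrite mulrAC ler_wpM2r // -[leRHS](divfK (lt0r_neq0 r0)).
  by rewrite ler_wpM2l ?ltW // bp.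
pose dw s := g (upd p j s + h *: delta_mx 0 i) - g (upd p j s) - h * 'D_(delta_mx 0 i) g
    (upd p j s).
apply: (@mvt_abs _ w dw) => s sb.
have sr := btw p s bp sb.
have bps : box c r (upd p j s) by exact: box_upd.
have K t : `|t| <= `|h| -> box c r (upd p j s + t *: delta_mx 0 i) /\
   `|'D_(delta_mx 0 i) g (upd p j s + t *: delta_mx 0 i) - 'D_(delta_mx 0 i) g (upd p j s)| <=
       e / r.
  move=> th; have [B1 B2] := Hd t (le_lt_trans th hd).
  have -> : upd p j s + t *: delta_mx 0 i = upd (p + t *: delta_mx 0 i) j s.
    by rewrite !add_upd upd_comm // upd_ne.
  by split; [exact: box_upd|exact: B2].
split.
  have D1 : is_derive s 1 (fun s => G (upd p j s + h *: delta_mx 0 i))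
      (g (upd p j s + h *: delta_mx 0 i)).
    have E t : upd p j t + h *: delta_mx 0 i = upd (p + h *: delta_mx 0 i) j t.
      by rewrite !add_upd upd_comm // upd_ne.
    rewrite (_ : (fun s => _) = (fun t => G (upd (p + h *: delta_mx 0 i) j t))); last first.
      by apply/funext => t; rewrite E.
    rewrite E; apply/is_derive_upd/dG; rewrite -E.
    by have [] := K h.
  have D2 : is_derive s 1 (fun s => G (upd p j s)) (g (upd p j s)) by apply/is_derive_upd/dG.
  have D3 : is_derive s 1 (fun s => H i (upd p j s)) ('D_(delta_mx 0 i) g (upd p j s)).
    by apply/is_derive_upd; exact: (HH i).1.
  exact: (is_deriveB (is_deriveB D1 D2) (is_deriveZ h D3)).
apply: partial_increment => t tb; have [|B1 B2] := K t.
  by have := between_norm tb; rewrite !subr0.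
exists ('D_(delta_mx 0 i) g (upd p j s + t *: delta_mx 0 i)) => //.
by apply: derivableP; apply: diff_derivable; exact: Ck_differentiable Cg B1.
Qed.
End ParamPrimitive.

(** * Scalar ordinary differential equations *)

(* On so short a time interval no exponential is needed: evaluate the mean value
   bound at a maximum of [`|w|] and absorb [L * `|t - a|] in the left-hand side. *)
Lemma gronwall_short {R : realType} (w dw : R -> R) (a t K L : R) : 0 <= L ->
  (forall s, Num.min a t <= s <= Num.max a t ->
     is_derive s 1 w (dw s) /\ `|dw s| <= L * `|w s| + K) ->
  L * `|t - a| <= 2^-1 -> `|w t| <= 2 * (`|w a| + K * `|t - a|).
Proof.
move=> L0 H Lt.
have mM : Num.min a t <= Num.max a t by rewrite ge_min !le_max lexx.
have cw : {within `[Num.min a t, Num.max a t], continuous (fun s => `|w s|)}.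
  have cw : {within `[Num.min a t, Num.max a t], continuous w}.
    apply: derivable_within_continuous => x; rewrite in_itv /= => xb.
    by have [[]] := H x xb.
  by move=> x; apply: cvg_norm; exact: cw.
have [s sb Hs] := EVT_max mM cw.
have {}Hs x : Num.min a t <= x <= Num.max a t -> `|w x| <= `|w s|.
  by move=> xb; apply: Hs; rewrite in_itv.
have {}sb : Num.min a t <= s <= Num.max a t by rewrite in_itv in sb.
have wa : `|w s| <= `|w a| + (L * `|w s| + K) * `|s - a|.
  have : `|w s - w a| <= (L * `|w s| + K) * `|s - a|.
    apply: (@mvt_abs _ w dw) => x xb.
    have xb' : Num.min a t <= x <= Num.max a t.
      move: sb xb; case: (leP a t) => at_ /andP[s1 s2].
        by rewrite (min_idPl s1) (max_idPr s1) => /andP[-> /le_trans ->].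
      by rewrite (min_idPr s2) (max_idPl s2) => /andP[/(le_trans s1) -> ->].
    have [D B] := H x xb'; split => //; apply: le_trans B _; rewrite lerD2r.
    by rewrite ler_wpM2l // Hs.
  have : `|w s| <= `|w s - w a| + `|w a|.
    by apply: le_trans (ler_normD _ _); rewrite subrK.
  by lra.
have sa : `|s - a| <= `|t - a| by exact: between_norm.
have LK : 0 <= L * `|w s| + K by have [_] := H s sb; apply: le_trans.
have ta : Num.min a t <= t <= Num.max a t by rewrite ge_min le_max !lexx !orbT.
have := Hs t ta.
have : (L * `|w s| + K) * `|s - a| <= (L * `|w s| + K) * `|t - a| by rewrite ler_wpM2l.
have : L * `|t - a| * `|w s| <= 2^-1 * `|w s| by rewrite ler_wpM2r.
by lra.
Qed.

Lemma term_le_sum {R : realType} (I : finType) (F : I -> R) k :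
  (forall l, 0 <= F l) -> F k <= \sum_l F l.
Proof. by move=> F0; rewrite (bigD1 k) //= lerDl sumr_ge0. Qed.

(** * Bounds of second order on a box *)

Section LocalBounds.
Context {R : realType} {n : nat}.
Implicit Types (p q c : 'rV[R]_n) (i j k : 'I_n).

(** A single constant plays three parts: as bound on [b] it confines solutions, as bound on the
    first partials it yields the contraction, as bound on the second ones the quadratic
    remainder. *)
Definition C2_bounded (c : 'rV[R]_n) (r C : R) (b : 'rV[R]_n -> R) :=
  [/\ 0 < r, 0 < C, forall q, box c r q -> `|b q| <= C,
   forall q k, box c r q -> is_derive q (delta_mx 0 k) b ('D_(delta_mx 0 k) b q) /\
     `|'D_(delta_mx 0 k) b q| <= C &
   forall q k l, box c r q ->
     is_derive q (delta_mx 0 l) ('D_(delta_mx 0 k) b)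
         ('D_(delta_mx 0 l) ('D_(delta_mx 0 k) b) q) /\
     `|'D_(delta_mx 0 l) ('D_(delta_mx 0 k) b) q| <= C].

Lemma C2_bounded_exists c (U : set 'rV[R]_n) b : open U -> U c -> Ck 2 U b ->
  exists r C, box c r `<=` U /\ C2_bounded c r C b.
Proof.
move=> oU Uc Cb.
pose N0 := `|b c|; pose N1 k := `|'D_(delta_mx 0 k) b c|.
pose N2 k l := `|'D_(delta_mx 0 l) ('D_(delta_mx 0 k) b) c|.
(* The sums dominate each of the values at [c]; the summand 1 is the growth that continuity allows
   nearby. *)
pose C := 1 + N0 + \sum_k N1 k + \sum_k \sum_l N2 k l.
have near_le (f : 'rV[R]_n -> R) : {for c, continuous f} -> \forall q \near c, `|f q| <= `|f c|
    + 1.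
  move=> /cvgrPdist_le /(_ _ ltr01); apply: filterS => q H.
  by rewrite -[f q](subKr (f c)); apply: le_trans (ler_normB _ _) _; rewrite lerD2l.
have S1 : 0 <= \sum_k N1 k by apply: sumr_ge0 => k _; exact: normr_ge0.
have S2 : 0 <= \sum_k \sum_l N2 k l.
  by apply: sumr_ge0 => k _; apply: sumr_ge0 => l _; exact: normr_ge0.
have S0 : 0 <= N0 by exact: normr_ge0.
have I1 k : N1 k <= \sum_k N1 k.
  by apply: term_le_sum => l; exact: normr_ge0.
have I2 k l : N2 k l <= \sum_k \sum_l N2 k l.
  apply: (@le_trans _ _ (\sum_l N2 k l)).
    by apply: term_le_sum => m; exact: normr_ge0.
  apply: (@term_le_sum _ _ (fun k => \sum_l N2 k l)) => m.
  by apply: sumr_ge0 => m' _; exact: normr_ge0.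
have E0 : \forall q \near c, `|b q| <= C.
  apply: filterS (near_le _ (Ck_continuous Cb Uc)) => q H; apply: le_trans H _.
  by rewrite /C -/N0; lra.
have E1 : \forall q \near c, forall k, `|'D_(delta_mx 0 k) b q| <= C.
  refine (@filter_forall _ _ (fun k (q : 'rV[R]_n) => `|'D_(delta_mx 0 k) b q| <= C) (nbhs c)
      (nbhs_filter c) _) => k.
  have H1 : {for c, continuous ('D_(delta_mx 0 k) b)} by exact:
      (@Ck_continuous _ _ _ 1 U _ c (Cb.2 _) Uc).
  apply: filterS (near_le _ H1) => q H; apply: le_trans H _.
  by have := I1 k; rewrite /C /N1; lra.
have E2 : \forall q \near c, forall k l, `|'D_(delta_mx 0 l) ('D_(delta_mx 0 k) b) q| <= C.
  refine (@filter_forall _ _ (fun k (q : 'rV[R]_n) => forall l, `|'D_(delta_mx 0 l)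
      ('D_(delta_mx 0 k) b) q| <= C) (nbhs c) (nbhs_filter c) _) => k.
  refine (@filter_forall _ _ (fun l (q : 'rV[R]_n) => `|'D_(delta_mx 0 l) ('D_(delta_mx 0 k) b)
      q| <= C) (nbhs c) (nbhs_filter c) _) => l.
  have H1 : {for c, continuous ('D_(delta_mx 0 l) ('D_(delta_mx 0 k) b))} by exact:
      ((Cb.2 _).2 _ c Uc).
  apply: filterS (near_le _ H1) => q H; apply: le_trans H _.
  by have := I2 k l; rewrite /C /N2; lra.
have N := filterI (open_nbhs_nbhs (conj oU Uc)) (filterI E0 (filterI E1 E2) ).
have F := nbhs_filter c.
have [r r0 Hr] := nbhs_box (N F F F).
have {}Hr q : box c r q -> [/\ U q, `|b q| <= C, forall k, `|'D_(delta_mx 0 k) b q| <= C &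
   forall k l, `|'D_(delta_mx 0 l) ('D_(delta_mx 0 k) b) q| <= C].
  by move=> /Hr [? [? []]].
exists r, C; split; first by move=> q /Hr[].
split => //.
- by rewrite /C; lra.
- by move=> q /Hr[].
- move=> q k /Hr[Uq _ B _]; split => //.
  by apply: derivableP; apply: diff_derivable; exact: Ck_differentiable Cb Uq.
- move=> q k l /Hr[Uq _ _ B]; split => //.
  by apply: derivableP; apply: diff_derivable; exact:
      (@Ck_differentiable _ _ _ 0 U _ q (Cb.2 _) Uq).
Qed.

Lemma box_segment c (r : R) q k (t s : R) : box c r q -> box c r (q + t *: delta_mx 0 k) ->
  Num.min 0 t <= s <= Num.max 0 t -> box c r (q + s *: delta_mx 0 k).
Proof.
rewrite !add_upd => bq bt st; apply: box_upd => //.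
apply: (box_between bq (bt k)); rewrite upd_at.
by rewrite -[X in Num.min X _]addr0 -[X in Num.max X _]addr0 -addr_minr -addr_maxr !lerD2l.
Qed.

(** Taylor estimates for two successive displacements. They will be the change [u] of a parameter
    and the resulting change [v] of the unknown; [k = i] is allowed. *)
Lemma C2_increment c (r C : R) b q k i (u v : R) : C2_bounded c r C b ->
  box c r q -> box c r (q + u *: delta_mx 0 k) ->
  box c r (q + u *: delta_mx 0 k + v *: delta_mx 0 i) ->
  `|b (q + u *: delta_mx 0 k + v *: delta_mx 0 i) - b q| <= C * (`|u| + `|v|) /\
  `|b (q + u *: delta_mx 0 k + v *: delta_mx 0 i) - b q
    - u * 'D_(delta_mx 0 k) b q - v * 'D_(delta_mx 0 i) b q| <= C * (`|u| + `|v|) ^+ 2.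
Proof.
move=> [r0 C0 B0 B1 B2]; set q1 := q + _ => bq bq1; set q2 := q1 + _ => bq2.
have lip (f : 'rV[R]_n -> R) x l (t : R) :
    (forall y, box c r y -> exists2 d', is_derive y (delta_mx 0 l) f d' & `|d'| <= C) ->
    box c r x -> box c r (x + t *: delta_mx 0 l) ->
    `|f (x + t *: delta_mx 0 l) - f x| <= C * `|t|.
  move=> Hf bx bt; have := @partial_increment R _ f 0 x (delta_mx 0 l) t C.
  rewrite mulr0 subr0; apply=> s st.
  have [d' D dC] := Hf _ (box_segment bx bt st).
  by exists d'; rewrite ?subr0.
have K (t s : R) : Num.min 0 t <= s <= Num.max 0 t -> `|s| <= `|t|.
  by move=> /between_norm; rewrite !subr0.
have L0 : forall l y, box c r y -> exists2 d', is_derive y (delta_mx 0 l) b d' & `|d'| <= C.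
  by move=> l y /(B1 _ l) []; exists ('D_(delta_mx 0 l) b y).
have L1 : forall l m y, box c r y -> exists2 d', is_derive y (delta_mx 0 l)
    ('D_(delta_mx 0 m) b) d' & `|d'| <= C.
  by move=> l m y /(B2 _ m l) []; exists ('D_(delta_mx 0 l) ('D_(delta_mx 0 m) b) y).
split.
  have A1 := lip b q k u (L0 k) bq bq1; have A2 := lip b q1 i v (L0 i) bq1 bq2.
  rewrite -(subrKA (b q1)); apply: le_trans (ler_normD _ _) _.
  by rewrite mulrDr addrC; apply: lerD.
have A1 : `|b q1 - b q - u * 'D_(delta_mx 0 k) b q| <= C * `|u| * `|u|.
  apply: partial_increment => s su; have bs := box_segment bq bq1 su.
  exists ('D_(delta_mx 0 k) b (q + s *: delta_mx 0 k)); first by have [] := B1 _ k bs.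
  apply: le_trans (lip _ q k s (L1 k k) bq bs) _.
  by rewrite ler_wpM2l ?K // ltW.
have A2 : `|b q2 - b q1 - v * 'D_(delta_mx 0 i) b q| <= C * (`|u| + `|v|) * `|v|.
  apply: partial_increment => s sv; have bs := box_segment bq1 bq2 sv.
  exists ('D_(delta_mx 0 i) b (q1 + s *: delta_mx 0 i)); first by have [] := B1 _ i bs.
  rewrite -(subrKA ('D_(delta_mx 0 i) b q1)); apply: le_trans (ler_normD _ _) _.
  rewrite mulrDr addrC; apply: lerD; first exact: lip (L1 k i) bq bq1.
  apply: le_trans (lip _ q1 i s (L1 i i) bq1 bs) _.
  by rewrite ler_wpM2l ?K // ltW.
rewrite (_ : _ - _ = (b q1 - b q - u * 'D_(delta_mx 0 k) b q) +
    (b q2 - b q1 - v * 'D_(delta_mx 0 i) b q)); last first.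
  by move: ('D_(delta_mx 0 k) b q) ('D_(delta_mx 0 i) b q) => X Y; ring.
apply: le_trans (ler_normD _ _) _; apply: le_trans (lerD A1 A2) _.
have -> : C * (`|u| + `|v|) ^+ 2 =
    C * `|u| * `|u| + C * (`|u| + `|v|) * `|v| + C * `|u| * `|v| by ring.
by rewrite lerDl !mulr_ge0 // ltW.
Qed.
End LocalBounds.

(** * Picard iteration with parameters *)

Section Picard.
Context {R : realType} {n : nat}.
Variables (c : 'rV[R]_n) (d C r : R) (b : 'rV[R]_n -> R) (i j : 'I_n).
Hypothesis Hb : C2_bounded c d C b.
Hypothesis Sb : forall k, Ck k (box c d) b.
Hypothesis r0 : 0 < r.
Hypothesis rd : r + C * r <= d.
Hypothesis Cr : C * r <= 2^-1.
Implicit Types (p q : 'rV[R]_n) (f g h : 'rV[R]_n -> R).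

Local Notation Q := (box c r).
Let C0 : 0 < C. Proof. by case: Hb. Qed.
Let oQ : open Q. Proof. exact: open_box. Qed.
Let rd' : r <= d. Proof. by move: rd (mulr_gt0 C0 r0); lra. Qed.
Let cj : `|c 0 j - c 0 j| < r. Proof. by rewrite subrr normr0. Qed.
Let btw p s : Q p -> Num.min (c 0 j) (p 0 j) <= s <= Num.max (c 0 j) (p 0 j) -> `|s - c 0 j| < r.
Proof. by move=> bp /between_norm H; exact: le_lt_trans (bp j). Qed.

Let Cb : Ck 0 (box c d) b. Proof. exact: Sb. Qed.

Let b_lip p (u v : R) : box c d (upd p i u) -> box c d (upd p i v) ->
  `|b (upd p i u) - b (upd p i v)| <= C * `|u - v|.
Proof.
move=> bu bv; have E : v + (u - v) = u by rewrite addrC subrK.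
have := @C2_increment _ _ _ _ _ b (upd p i v) i i 0 (u - v) Hb.
by rewrite scale0r addr0 upd_add E normr0 add0r => /(_ bv bv bu) [].
Qed.

(** The initial value sits in slot [i] of the point with time reset to [c 0 j]. For [i = j] the
    reset affects this slot too, and the initial value is the constant [c 0 j]. *)
Let init p := (upd p j (c 0 j)) 0 i.
Let slot f p := upd p i (f p).

(** The values stay in a cone of slope [C] around the initial value. The Picard operator [T]
    preserves this, and it passes to the limit of the iterates. *)
Let adm f := Ck 0 Q f /\ forall p, Q p -> `|f p - c 0 i| <= `|init p - c 0 i| + C * `|p 0 j - c
    0 j|.

(** The initial value is less than [r] away from [c 0 i], and slope [C] over a time shorter than [r]
    adds at most [C * r]; [rd] keeps the total below [d]. *)
Let init_lt p : Q p -> `|init p - c 0 i| + C * `|p 0 j - c 0 j| < d.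
Proof.
move=> bp; have /ltW := bp j; rewrite -(ler_pM2l C0) => H.
suff : `|init p - c 0 i| < r by move: rd; lra.
rewrite /init mxE; case: (i =P j) => [->|_] //.
Qed.

Let adm_slot f p : adm f -> Q p -> box c d (slot f p).
Proof.
move=> [_ H] bp; apply: box_upd; first exact: box_le bp.
exact: le_lt_trans (H p bp) (init_lt bp).
Qed.

Let Ck_slot k f g : (forall p, Q p -> box c d (slot f p)) -> Ck k Q f -> Ck k (box c d) g ->
  Ck k Q (fun p => g (slot f p)).
Proof.
move=> Hf Cf Cg; apply: (@Ck_comp _ _ _ _ _ _ (box c d)) => // l.
have [->|li] := eqVneq l i.
  by apply: Ck_ext Cf => // x _; rewrite /slot upd_at.
by apply: (Ck_ext oQ _ (Ck_coord k l oQ)) => x _; rewrite /slot upd_ne.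
Qed.

Let Ck_init k : Ck k Q init.
Proof.
have [ij|ij] := eqVneq i j.
  by apply: (Ck_ext oQ _ (Ck_cst k Q (c 0 j))) => p _; rewrite /init ij upd_at.
by apply: (Ck_ext oQ _ (Ck_coord k i oQ)) => p _; rewrite /init upd_ne.
Qed.

(** A total integration operator, so that [T] can be iterated; it is specified on continuous
    integrands only. *)
Let prim_spec : {I : ('rV[R]_n -> R) -> 'rV[R]_n -> R | forall g, Ck 0 Q g ->
   (forall p, Q p -> is_derive p (delta_mx 0 j) (I g) (g p)) /\
   (forall p, Q p -> I g (upd p j (c 0 j)) = 0)}.
Proof.
apply: cid; have /choice [I HI] : forall g, exists G, Ck 0 Q g ->
   (forall p, Q p -> is_derive p (delta_mx 0 j) G (g p)) /\
   (forall p, Q p -> G (upd p j (c 0 j)) = 0).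
  move=> g; have [Cg|N] := pselect (Ck 0 Q g); last by exists (fun=> 0).
  by have [G G1 G2] := param_primitive_exists j r0 Cg; exists G.
by exists I.
Qed.
Let I := sval prim_spec.

Let I_derive g p : Ck 0 Q g -> Q p -> is_derive p (delta_mx 0 j) (I g) (g p).
Proof. by move=> /(svalP prim_spec) [H _] /H. Qed.
Let I0 g p : Ck 0 Q g -> Q p -> I g (upd p j (c 0 j)) = 0.
Proof. by move=> /(svalP prim_spec) [_ H] /H. Qed.
Let Ck_I k g : Ck 0 Q g -> Ck k Q g -> Ck k Q (I g).
Proof. by move=> H0; have [H1 H2] := svalP prim_spec g H0; exact: Ck_param_primitive H1 H2. Qed.

Let I_le g h p e : Ck 0 Q g -> Ck 0 Q h -> Q p -> (forall q, Q q -> `|g q - h q| <= e) ->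
  `|I g p - I h p| <= e * `|p 0 j - c 0 j|.
Proof.
move=> Cg Ch bp H.
have E : I g p - I h p = (I g (upd p j (p 0 j)) - I h (upd p j (p 0 j)))
   - (I g (upd p j (c 0 j)) - I h (upd p j (c 0 j))) by rewrite !I0 // subrr subr0 upd_id.
rewrite E; apply: (@mvt_abs _ (fun s => I g (upd p j s) - I h (upd p j s))
  (fun s => g (upd p j s) - h (upd p j s))) => s sb.
have bs : Q (upd p j s) by apply: box_upd => //; exact: btw sb.
split; last exact: H.
exact: (is_deriveB ((is_derive_upd _ _ _ _ _).1 (I_derive Cg bs))
    ((is_derive_upd _ _ _ _ _).1 (I_derive Ch bs))).
Qed.

Let T f p := init p + I (fun p => b (slot f p)) p.

Let C_slot f : adm f -> Ck 0 Q (fun p => b (slot f p)).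
Proof. by move=> Hf; apply: Ck_slot Cb; [move=> p; exact: adm_slot|case: Hf]. Qed.

Let I_bound f p : adm f -> Q p -> `|I (fun p => b (slot f p)) p| <= C * `|p 0 j - c 0 j|.
Proof.
move=> Hf bp; have Cs := C_slot Hf.
have := @line_bound _ _ (I (fun p => b (slot f p))) (fun s => b (slot f (upd p j s))) p j
    (c 0 j) (p 0 j) C.
rewrite upd_id I0 // subr0; apply=> s sb.
have bs : Q (upd p j s) by apply: box_upd => //; exact: btw sb.
split; first exact: (I_derive Cs bs).
by case: Hb => _ _ B0 _ _; apply: B0; exact: adm_slot.
Qed.

Let adm_T f : adm f -> adm (T f).
Proof.
move=> Hf; have Cs := C_slot Hf; split.
  exact: (Ck_add (k:=0) oQ (Ck_init 0) (Ck_I (k:=0) Cs Cs)).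
move=> p bp; rewrite /T addrAC; apply: le_trans (ler_normD _ _) _; rewrite lerD2l.
exact: I_bound.
Qed.

(** The Lipschitz constant [C] of [b] in the slot times the time span [r] is at most one half by
    [Cr]. *)
Let T_contract f g e : adm f -> adm g -> (forall p, Q p -> `|f p - g p| <= e) ->
  forall p, Q p -> `|T f p - T g p| <= e / 2.
Proof.
move=> Hf Hg fg p bp; have e0 : 0 <= e by apply: le_trans (fg p bp).
rewrite (_ : T f p - T g p = I (fun p => b (slot f p)) p - I (fun p => b (slot g p)) p); last
    first.
  by rewrite /T opprD addrACA subrr add0r.
apply: (@le_trans _ _ (C * e * `|p 0 j - c 0 j|)).
  apply: (I_le (C_slot Hf) (C_slot Hg) bp) => q bq.
  apply: le_trans (b_lip (adm_slot Hf bq) (adm_slot Hg bq)) _.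
  by rewrite ler_pM2l // fg.
rewrite mulrAC mulrC ler_wpM2l //; apply: le_trans Cr.
by rewrite ler_pM2l //; exact/ltW/bp.
Qed.

Let phi m := iter m T init.

Let adm_phi m : adm (phi m).
Proof.
elim: m => [|m IH]; last exact: adm_T.
by split; [exact: Ck_init|move=> p bp; rewrite lerDl mulr_ge0 // ltW].
Qed.

Let phiS m p : Q p -> `|phi m.+1 p - phi m p| <= (2^-1) ^+ m.
Proof.
elim: m p => [|m IH] p bp.
  rewrite expr0 /phi /= /T addrAC subrr add0r.
  apply: le_trans (I_bound (adm_phi 0) bp) _.
  have : C * `|p 0 j - c 0 j| <= C * r by rewrite ler_pM2l //; exact/ltW/bp.
  by move: Cr; lra.
by rewrite exprSr; exact: (T_contract (adm_phi m.+1) (adm_phi m) IH).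
Qed.

(** The bound is the sum of the geometric series from [m] to [m + l - 1], in closed form so that the
    induction on [l] closes. *)
Let phi_cauchy m l p : Q p -> `|phi (m + l)%N p - phi m p| <= 2 * (2^-1) ^+ m - 2 * (2^-1) ^+
    (m + l).
Proof.
move=> bp; elim: l => [|l IH]; first by rewrite addn0 !subrr normr0.
rewrite addnS -(subrKA (phi (m + l)%N p)); apply: le_trans (ler_normD _ _) _.
have := phiS (m + l) bp; rewrite exprS; move: IH.
by move: (_ ^+ (m + l)) => X; lra.
Qed.

Let pow2_gt0 m : 0 < (2^-1 : R) ^+ m.
Proof. by rewrite exprn_gt0 // invr_gt0. Qed.

(** Every left end of an interval of radius [2 * 2^-m] around [phi m p] lies below every right end,
    so the supremum of the left ends belongs to all of these intervals. *)
Let phi_dist m l p : Q p -> phi m p - 2 * (2^-1) ^+ m <= phi l p + 2 * (2^-1) ^+ l.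
Proof.
move=> bp; have [ml|/ltnW lm] := leqP m l.
  have := phi_cauchy m (l - m) bp; rewrite subnKC // ler_norml.
  by have := pow2_gt0 l; move: (_ ^+ _) (_ ^+ _) => X Y ? /andP[? ?]; lra.
have := phi_cauchy l (m - l) bp; rewrite subnKC // ler_norml.
by have := pow2_gt0 m; move: (_ ^+ _) (_ ^+ _) => X Y ? /andP[? ?]; lra.
Qed.

(* The limit of [phi m p]: a supremum spares the completeness argument. *)
Let lim_phi p := sup [set x | exists m, x = phi m p - 2 * (2^-1) ^+ m].

Let lim_phiP m p : Q p -> `|lim_phi p - phi m p| <= 2 * (2^-1) ^+ m.
Proof.
move=> bp; rewrite ler_distl; apply/andP; split.
  apply: sup_upper_bound; last by exists m.
  split; first by exists (phi 0 p - 2 * (2^-1) ^+ 0); exists 0%N.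
  by exists (phi 0 p + 2 * (2^-1) ^+ 0) => _ [l ->]; exact: phi_dist.
apply: sup_le_ub; first by exists (phi 0 p - 2 * (2^-1) ^+ 0); exists 0%N.
by move=> _ [l ->]; exact: phi_dist.
Qed.

Let pow2_small (e : R) : 0 < e -> exists m, 2 * (2^-1) ^+ m <= e.
Proof.
move=> e0; have : (fun m => (2^-1 : R) ^+ m) @ \oo --> 0.
  by apply: cvg_expr; rewrite gtr0_norm ?invr_gt0 // invf_lt1 // ltr1n.
have e2 : 0 < e / 2 by rewrite divr_gt0.
move=> /cvgrPdist_le /(_ _ e2) [m _ /(_ m (leqnn m))] /=.
by rewrite sub0r normrN (gtr0_norm (pow2_gt0 m)) => H; exists m; lra.
Qed.

Let adm_lim : adm lim_phi.
Proof.
split=> [p bp|p bp].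
  apply/(@cvgrPdist_le R R 'rV[R]_n (nbhs p) (nbhs_filter p)) => e e0.
  have e3 : 0 < e / 3 by rewrite divr_gt0.
  have [m Hm] := pow2_small e3.
  have /cvgrPdist_le /(_ _ e3) H := (adm_phi m).1 p bp.
  apply: filterS2 H (open_nbhs_nbhs (conj oQ bp)) => q H bq.
  have A1 := le_trans (lim_phiP m bp) Hm; have A2 := le_trans (lim_phiP m bq) Hm.
  rewrite (_ : _ - _ = (lim_phi p - phi m p) + (phi m p - phi m q) - (lim_phi q - phi m q));
      last by ring.
  apply: le_trans (ler_normB _ _) _; apply: le_trans (lerD (ler_normD _ _) (lexx _)) _.
  by lra.
apply/ler_addgt0Pr => e e0; have [m Hm] := pow2_small e0.
rewrite -(subrKA (phi m p)); apply: le_trans (ler_normD _ _) _; rewrite addrC.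
by apply: lerD; [exact: (adm_phi m).2|exact: le_trans (lim_phiP m bp) Hm].
Qed.

Let fix_lim p : Q p -> lim_phi p = T lim_phi p.
Proof.
move=> bp; apply/eqP; rewrite -subr_eq0 -normr_le0; apply/ler_addgt0Pr => e e0.
have [m Hm] := pow2_small e0; rewrite add0r.
have A1 := lim_phiP m.+1 bp.
have A2 := T_contract adm_lim (adm_phi m) (@lim_phiP m) bp.
rewrite -(subrKA (phi m.+1 p)); apply: le_trans (ler_normD _ _) _.
rewrite (distrC (phi _ _)); apply: le_trans (lerD A1 A2) _.
by apply: le_trans Hm; rewrite exprS; lra.
Qed.

(** The derivative of the fixed point equation along [j] is the differential equation, because
    [init] does not depend on the [j]-th coordinate. In other directions the solution is so far only
    continuous. *)
Lemma picard : exists2 f, Ck 0 Q f & [/\ forall p, Q p -> box c d (upd p i (f p)),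
  forall p, Q p -> is_derive p (delta_mx 0 j) f (b (upd p i (f p))) &
  forall p, Q p -> f (upd p j (c 0 j)) = (upd p j (c 0 j)) 0 i].
Proof.
exists lim_phi; first by case: adm_lim.
have Cs := C_slot adm_lim.
split=> p bp; first exact: adm_slot adm_lim bp.
  apply: (is_derive_ext oQ bp (fun q bq => esym (fix_lim bq))).
  rewrite -[b _]add0r; apply: is_deriveD; last exact: (I_derive Cs bp).
  rewrite -[p in is_derive p](upd_id p j); apply/is_derive_upd.
  rewrite (_ : (fun t => _) = fun=> init p); first exact: is_derive_cst.
  by apply/funext => t; rewrite /init upd_upd.
by rewrite fix_lim ?/T ?I0 ?addr0 // /init ?upd_upd //; exact: box_upd.
Qed.

End Picard.

(** * Smooth dependence on parameters *)

Section OdeSmooth.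
Context {R : realType} {n : nat}.
Variables (c : 'rV[R]_n) (d C r : R) (b : 'rV[R]_n -> R) (i j : 'I_n).
Hypothesis Hb : C2_bounded c d C b.
Hypothesis Sb : forall k, Ck k (box c d) b.
Hypothesis r0 : 0 < r.
Hypothesis rd : r <= d.
Hypothesis Cr : C * r <= 2^-1.
Variable f : 'rV[R]_n -> R.
Local Notation Q := (box c r).
Hypothesis Cf : Ck 0 Q f.
Hypothesis f_box : forall p, Q p -> box c d (upd p i (f p)).
Hypothesis f_ode : forall p, Q p -> is_derive p (delta_mx 0 j) f (b (upd p i (f p))).
Hypothesis f_init : forall p, Q p -> f (upd p j (c 0 j)) = (upd p j (c 0 j)) 0 i.
Implicit Types (p q : 'rV[R]_n) (g h : 'rV[R]_n -> R).

Let C0 : 0 < C. Proof. by case: Hb. Qed.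
Let oQ : open Q. Proof. exact: open_box. Qed.
Let cj : `|c 0 j - c 0 j| < r. Proof. by rewrite subrr normr0. Qed.
Let btw p s : Q p -> Num.min (c 0 j) (p 0 j) <= s <= Num.max (c 0 j) (p 0 j) -> `|s - c 0 j| < r.
Proof. by move=> bp /between_norm H; exact: le_lt_trans (bp j). Qed.
Let slot p := upd p i (f p).

Let Ck_slot k g : Ck k Q f -> (forall k, Ck k (box c d) g) -> Ck k Q (fun p => g (slot p)).
Proof.
move=> Ckf Cg; apply: (@Ck_comp _ _ _ _ _ _ (box c d)) => // l.
have [->|li] := eqVneq l i.
  by apply: Ck_ext Ckf => // x _; rewrite /slot upd_at.
by apply: (Ck_ext oQ _ (Ck_coord k l oQ)) => x _; rewrite /slot upd_ne.
Qed.

Let alpha p := 'D_(delta_mx 0 i) b (slot p).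
Let beta k p := (k != i)%:R * 'D_(delta_mx 0 k) b (slot p).

(* [g] is the candidate for the [k]-th partial derivative of [f]: it solves the
   variational equation, with [beta k] vanishing for [k = i] because the [i]-th
   coordinate of [slot p] does not depend on that of [p]. *)
Let linear_solution k : k != j -> exists g, [/\ forall m, Ck m Q f -> Ck m Q g,
  forall p, Q p -> is_derive p (delta_mx 0 j) g (alpha p * g p + beta k p) &
  forall p, Q p -> g (upd p j (c 0 j)) = (k == i)%:R].
Proof.
move=> kj.
have Ca m : Ck m Q f -> Ck m Q alpha by move=> H; apply: (Ck_slot (g:='D_(delta_mx 0 i) b) H)
    => l; have [_] := Sb l.+1; apply.
have Cb m : Ck m Q f -> Ck m Q (beta k).
  move=> H; apply: (Ck_mul oQ (Ck_cst m Q _)).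
  by apply: (Ck_slot (g:='D_(delta_mx 0 k) b) H) => l; have [_] := Sb l.+1; apply.
have [A dA A0] := param_primitive_exists j r0 (Ca 0%N Cf).
have CA m : Ck m Q f -> Ck m Q A by move=> H; exact: (Ck_param_primitive r0 dA A0 (Ca m H)).
(* Variation of constants: the solution is [expR A] multiplied by the sum of the initial value and
   the primitive [J] of [h]. Each operation preserves the class inherited from [f]. *)
pose h p := expR (- A p) * beta k p.
have Ch m : Ck m Q f -> Ck m Q h.
  by move=> H; exact: (Ck_mul oQ (Ck_expR oQ (Ck_opp oQ (CA m H))) (Cb m H)).
have [J dJ J0] := param_primitive_exists j r0 (Ch 0%N Cf).
have CJ m : Ck m Q f -> Ck m Q J by move=> H; exact: (Ck_param_primitive r0 dJ J0 (Ch m H)).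
exists (fun p => expR (A p) * ((k == i)%:R + J p)); split.
- move=> m H.
  exact: (Ck_mul oQ (Ck_expR oQ (CA m H)) (Ck_add oQ (Ck_cst m Q (_ : R)) (CJ m H))).
- move=> p bp.
  have D1 := is_derive_expR_comp (dA p bp).
  have D2 := is_deriveD (is_derive_cst ((k == i)%:R : R) p (delta_mx 0 j)) (dJ p bp).
  apply: (is_derive_eq (is_deriveM D1 D2)).
  rewrite /GRing.scale /= add0r /h expRN mulrA divff; last exact/lt0r_neq0/expR_gt0.
  by move: (_%:R) => u; rewrite mul1r -[(cst u + J) p]/(u + J p); ring.
- by move=> p bp; rewrite A0 // J0 // expR0 mul1r addr0.
Qed.

(* Gronwall is applied to the increment [w1] of [f], which is [O(h)], and then to
   [w2 = w1 - h g], which is [O(h^2)]. *)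
Let derive_param k g : k != j -> Ck 0 Q g ->
  (forall p, Q p -> is_derive p (delta_mx 0 j) g (alpha p * g p + beta k p)) ->
  (forall p, Q p -> g (upd p j (c 0 j)) = (k == i)%:R) ->
  forall p, Q p -> is_derive p (delta_mx 0 k) f (g p).
Proof.
move=> kj Cg dg g0 p bp; apply: is_derive_eps => e e0.
(* [w1] starts with at most [|h|] and has source [C * |h|], so the Gronwall bound is
   [2 * (1 + C * r) * |h|]; [M] has a factor 2 to spare. [K] bounds the quadratic remainder of [b]
   for displacements of at most [(1 + M) * |h|]. *)
pose M := 2 * (2 * (1 + C * r)).
pose K := C * (1 + M) ^+ 2.
have M0 : 0 <= M by have := mulr_gt0 C0 r0; rewrite /M; lra.
have K0 : 0 < K by rewrite /K mulr_gt0 // exprn_gt0 // ltr_pwDl.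
have Kr0 : 0 < 2 * (K * r) by rewrite mulr_gt0 // mulr_gt0.
have N1 : \forall h \near (0 : R), `|h| <= e / (2 * (K * r)).
  by apply: nbhs0_le; rewrite divr_gt0.
have /nbhs_ballP[z /= z0 Hz] := open_nbhs_nbhs (conj oQ bp).
have N2 : \forall h \near (0 : R), `|h| < z by exact: nbhs0_lt.
apply: filterS2 N1 N2 => h h1 h2.
set p' := p + h *: delta_mx 0 k.
have bp' : Q p'.
  apply: Hz; rewrite -ball_normE /= opprD addNKr normrN normrZ.
  by apply: le_lt_trans h2; rewrite ler_piMr // norm_delta.
have p'j : p' 0 j = p 0 j by rewrite /p' add_upd upd_ne // eq_sym.
pose w1 s := f (upd p' j s) - f (upd p j s).
(* Displacement of the slot along [k] caused by [h]. It is zero for [k = i], where the coordinate of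
   [p] is overwritten by the unknown; the displacement along [i] is [w1]. *)
pose kap := (k != i)%:R * h.
have E s : upd p' j s = upd (upd p j s) k (p 0 k + h).
  by rewrite /p' add_upd upd_comm.
have slotE s : slot (upd p' j s) = slot (upd p j s) + kap *: delta_mx 0 k + w1 s *: delta_mx 0 i.
  rewrite /slot /kap /w1; have [ki|ki] /= := eqVneq k i.
    by rewrite mul0r scale0r addr0 upd_add subrKC E ki upd_upd.
  rewrite mul1r E -/(upd _ i _).
  have -> : upd (upd p j s) i (f (upd p j s)) + h *: delta_mx 0 k
     = upd (upd (upd p j s) k (p 0 k + h)) i (f (upd p j s)).
    by rewrite add_upd upd_comm 1?eq_sym // upd_ne // upd_ne.
  by rewrite upd_add subrKC.
have bs s : Num.min (c 0 j) (p 0 j) <= s <= Num.max (c 0 j) (p 0 j) ->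
    [/\ Q (upd p j s), Q (upd p' j s),
    box c d (slot (upd p j s)), box c d (slot (upd p j s) + kap *: delta_mx 0 k) &
    box c d (slot (upd p' j s))].
  move=> sb; have sr := btw bp sb.
  have B1 : Q (upd p j s) by exact: box_upd.
  have B2 : Q (upd p' j s) by exact: box_upd.
  split => //; [exact: f_box| |exact: f_box].
  rewrite /kap; have [ki|ki] /= := eqVneq k i.
    by rewrite mul0r scale0r addr0; exact: f_box.
  rewrite mul1r add_upd; apply: box_upd; first exact: f_box.
  rewrite /slot upd_ne // upd_ne //; have := bp' k; rewrite /p' add_upd upd_at => H.
  exact: lt_le_trans rd.
have kaph : `|kap| <= `|h|.
  by rewrite /kap; case: (k != i); rewrite ?mul1r // mul0r normr0.
have pj0 : Num.min (c 0 j) (p 0 j) <= p 0 j <= Num.max (c 0 j) (p 0 j).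
  by rewrite ge_min le_max !lexx !orbT.
have dw1 s : Num.min (c 0 j) (p 0 j) <= s <= Num.max (c 0 j) (p 0 j) ->
   is_derive s 1 w1 (b (slot (upd p' j s)) - b (slot (upd p j s))).
  move=> /bs [B1 B2 _ _ _].
  exact: (is_deriveB ((is_derive_upd _ _ _ _ _).1 (f_ode B2))
      ((is_derive_upd _ _ _ _ _).1 (f_ode B1))).
have w10 : w1 (c 0 j) = (k == i)%:R * h.
  rewrite /w1 !f_init // E; have [ki|ki] /= := eqVneq k i.
    by rewrite -ki upd_at upd_ne // mul1r addrC addKr.
  by rewrite upd_ne 1?eq_sym // subrr mul0r.
have w10h : `|w1 (c 0 j)| <= `|h|.
  by rewrite w10; case: (k == i); rewrite ?mul1r // mul0r normr0.
have pr : `|p 0 j - c 0 j| <= r by exact/ltW/bp.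
have H1 s : Num.min (c 0 j) (p 0 j) <= s <= Num.max (c 0 j) (p 0 j) -> `|w1 s| <= M * `|h|.
  move=> sb.
  have sc : `|s - c 0 j| <= r by apply: le_trans pr; exact: between_norm.
  have := @gronwall_short _ w1 (fun s => b (slot (upd p' j s)) - b (slot (upd p j s))) (c 0 j)
      s (C * `|h|) C (ltW C0).
  move=> G; apply: (le_trans (G _ _)).
  - move=> t tb.
    have tb' : Num.min (c 0 j) (p 0 j) <= t <= Num.max (c 0 j) (p 0 j).
      move: sb tb; case: (leP (c 0 j) (p 0 j)) => at_ /andP[s1 s2].
        by rewrite (min_idPl s1) (max_idPr s1) => /andP[-> /le_trans ->].
      by rewrite (min_idPr s2) (max_idPl s2) => /andP[/(le_trans s1) -> ->].
    split; first exact: dw1.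
    have [B1 B2 B3 B4 B5] := bs t tb'; rewrite slotE in B5 *.
    have [A _] := C2_increment Hb B3 B4 B5; apply: le_trans A _.
    have : C * `|kap| <= C * `|h| by rewrite ler_pM2l.
    by lra.
  - by apply: le_trans Cr; rewrite ler_pM2l.
  - rewrite /M -!mulrA ler_pM2l //.
    have : C * `|h| * `|s - c 0 j| <= C * `|h| * r by rewrite ler_wpM2l // mulr_ge0 // ltW.
    have : 0 <= C * r * `|h| by rewrite !mulr_ge0 // ltW.
    by have : 0 <= `|h| by []; move: w10h; lra.
pose w2 s := w1 s - h * g (upd p j s).
have -> : f p' - f p - h * g p = w2 (p 0 j).
  have E' : upd p' j (p 0 j) = p' by rewrite -p'j upd_id.
  by rewrite /w2 /w1 E' !upd_id.
have w20 : w2 (c 0 j) = 0.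
  by rewrite /w2 w10 g0 // mulrC subrr.
pose dw2 s := (b (slot (upd p' j s)) - b (slot (upd p j s))) - h *
    (alpha (upd p j s) * g (upd p j s) + beta k (upd p j s)).
have := @gronwall_short _ w2 dw2 (c 0 j) (p 0 j) (K * `|h| ^+ 2) C (ltW C0).
move=> G; apply: (le_trans (G _ _)).
- move=> s sb; have [B1 B2 B3 B4 B5] := bs s sb; split.
    exact: (is_deriveB (dw1 s sb) (is_deriveZ h ((is_derive_upd _ _ _ _ _).1 (dg _ B1)))).
  rewrite slotE in B5; have [_ A] := C2_increment Hb B3 B4 B5.
  rewrite -slotE -/(alpha _) in A.
  (* The bracket is the Taylor remainder of [b], which becomes the source; [alpha * w2] is the
     linear term of the Gronwall bound. *)
  have -> : dw2 s = (b (slot (upd p' j s)) - b (slot (upd p j s)) - kap * 'D_(delta_mx 0 k) b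
      (slot (upd p j s)) - w1 s * alpha (upd p j s)) + alpha (upd p j s) * w2 s.
    rewrite /dw2 /w2 /beta /kap; move: ('D_(delta_mx 0 k) b _) (_%:R) => X Y; ring.
  apply: le_trans (ler_normD _ _) _; rewrite addrC; apply: lerD.
    rewrite normrM ler_wpM2r //; case: Hb => _ _ _ B _.
    by have [] := B _ i B3.
  apply: le_trans A _; rewrite /K -mulrA ler_pM2l // -exprMn.
  rewrite ler_pXn2r ?nnegrE ?addr_ge0 ?mulr_ge0 //; last by rewrite addr_ge0.
  by have := H1 s sb; lra.
- by apply: le_trans Cr; rewrite ler_pM2l.
- rewrite w20 normr0 add0r.
  have : K * `|h| ^+ 2 * `|p 0 j - c 0 j| <= K * `|h| ^+ 2 * r.
    by rewrite ler_wpM2l // mulr_ge0 ?exprn_ge0 // ltW.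
  have : 2 * (K * r) * `|h| * `|h| <= e * `|h|.
    by rewrite ler_wpM2r // mulrC -ler_pdivlMr.
  by rewrite expr2; lra.
Qed.

(** The candidates [g k] are chosen once, before the induction on [m]. They and, in direction [j],
    [b] along the solution are the partials of [f] and have the class of [f], which thus gains a
    derivative on the same [Q]. *)
Lemma ode_smooth m : Ck m Q f.
Proof.
have /choice [g Hg] : forall k, exists g, k != j -> (forall m, Ck m Q f -> Ck m Q g) /\
    forall p, Q p -> is_derive p (delta_mx 0 k) f (g p).
  move=> k; have [_|kj] := eqVneq k j; first by exists f.
  have [g [g1 g2 g3]] := linear_solution kj; exists g => _; split => //.
  exact: derive_param kj (g1 0%N Cf) g2 g3.
elim: m => // m IH.
apply: (@Ck_partials _ _ _ _ _ (fun k => if k == j then fun p => b (slot p) else g k)) => //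
    [p k bp|k].
  have [->|kj] := eqVneq k j; first exact: f_ode.
  by have [_] := Hg k kj; apply.
have [_|kj] := eqVneq k j; first exact: Ck_slot.
by have [H _] := Hg k kj; exact: H.
Qed.

End OdeSmooth.

(* The time variable is the [j]-th coordinate, and the unknown takes the place of
   the [i]-th one, whose value in [p] serves as initial condition.  The case
   [i = j], where the equation is autonomous, is used to invert functions. *)
Lemma scalar_ode {R : realType} {n : nat} (U : set 'rV[R]_n) (b : 'rV[R]_n -> R) c (i j : 'I_n) :
  open U -> U c -> (forall k, Ck k U b) ->
  exists r f, [/\ 0 < r, forall k, Ck k (box c r) f,
    forall p, box c r p -> U (upd p i (f p)),
    forall p, box c r p -> is_derive p (delta_mx 0 j) f (b (upd p i (f p))) &
    forall p, box c r p -> p 0 j = c 0 j -> f p = p 0 i].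
Proof.
move=> oU Uc Cb.
have [d [C [dU Hb]]] := C2_bounded_exists oU Uc (Cb 2).
have [d0 C0 _ _ _] := Hb.
have Sb k : Ck k (box c d) b by exact: Ck_subset dU (Cb k).
(* The first bound confines the solution to the box of radius [d], the second gives the contraction
   factor one half. *)
pose r := Num.min (d / (1 + C)) (2^-1 / C).
have C1 : 0 < 1 + C by rewrite addr_gt0.
have r0 : 0 < r by rewrite lt_min !divr_gt0 // invr_gt0.
have rd : r + C * r <= d.
  have : r <= d / (1 + C) by rewrite ge_min lexx.
  by rewrite ler_pdivlMr // mulrDr mulr1 mulrC.
have Cr : C * r <= 2^-1 by rewrite mulrC -ler_pdivlMr // ge_min lexx orbT.
have [f Cf [f1 f2 f3]] := picard i j Hb Sb r0 rd Cr.
have rd' : r <= d by have := mulr_gt0 C0 r0; move: rd; lra.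
exists r, f; split => //.
- exact: (ode_smooth Hb Sb r0 rd' Cr Cf f1 f2 f3).
- by move=> p /f1/dU.
- by move=> p bp pj; have := f3 p bp; rewrite -pj upd_id.
Qed.

(** * Local diffeomorphisms *)

Lemma open_preimage_on (T T' : topologicalType) (F : T -> T') (O : set T) (N : set T') :
  open O -> (forall x, O x -> {for x, continuous F}) -> open N -> open (O `&` F @^-1` N).
Proof.
move=> oO cF oN; rewrite openE => x [Ox Nx]; apply: filterI; first exact: open_nbhs_nbhs.
by apply: (cF x Ox); exact: open_nbhs_nbhs.
Qed.

Section Diffeo.
Context {R : realType} {n : nat}.
Local Notation V := ('rV[R]_n).
Implicit Types (O U N : set V) (F G : V -> V) (p q : V).

Lemma smooth_rowP O m (F : V -> 'rV[R]_m) : open O ->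
  smooth_on O F <-> forall i, smooth_on O (fun x => F x 0 i : R).
Proof.
move=> oO; split=> [H i k|H k].
  by apply: (Ck_rowP k F oO).1; exact: H.
by apply/(Ck_rowP k F oO) => i; exact: H.
Qed.

Lemma smooth_comp O U F (f : V -> R) : open O -> (forall x, O x -> U (F x)) ->
  smooth_on O F -> smooth_on U f -> smooth_on O (fun x => f (F x)).
Proof.
move=> oO FU HF Hf k; apply: (@Ck_comp _ _ _ _ _ _ U) => // i.
by apply: (Ck_rowP k F oO).1; exact: HF.
Qed.

Lemma smooth_compV O U F m (f : V -> 'rV[R]_m) : open O -> open U -> (forall x, O x -> U (F x)) ->
  smooth_on O F -> smooth_on U f -> smooth_on O (fun x => f (F x)).
Proof.
move=> oO oU FU HF Hf; apply/smooth_rowP => // i.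
by apply: (smooth_comp (f:=fun x => f x 0 i) oO FU HF); exact: (smooth_rowP f oU).1.
Qed.

Lemma smooth_coord O i : open O -> smooth_on O (fun p : V => p 0 i : R).
Proof. by move=> oO k; exact: Ck_coord. Qed.

Lemma smooth_id O : open O -> smooth_on O (fun p : V => p).
Proof. by move=> oO; apply/smooth_rowP => // i; exact: smooth_coord. Qed.

Lemma smooth_upd O m F (f : V -> R) : open O -> smooth_on O F -> smooth_on O f ->
  smooth_on O (fun p => upd (F p) m (f p)).
Proof.
move=> oO HF Hf; apply/smooth_rowP => // i.
have [->|im] := eqVneq i m.
  by move=> k; apply: (Ck_ext oO _ (Hf k)) => x _; rewrite upd_at.
by move=> k; apply: (Ck_ext oO _ ((smooth_rowP F oO).1 HF i k)) => x _; rewrite upd_ne.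
Qed.

Lemma smooth_continuous O (W : normedModType R) (f : V -> W) p : smooth_on O f -> O p ->
    {for p, continuous f}.
Proof. by move=> H Op; exact: Ck_continuous (H 0%N) Op. Qed.

Lemma smooth_open_preimage O (W : normedModType R) (f : V -> W) (N : set W) :
  open O -> smooth_on O f -> open N -> open (O `&` f @^-1` N).
Proof.
move=> oO sf oN; apply: (open_preimage_on oO _ oN) => x Ox.
exact: smooth_continuous sf Ox.
Qed.

Lemma smooth_differentiable O (W : normedModType R) (f : V -> W) p : smooth_on O f -> O p ->
    differentiable f p.
Proof. by move=> H Op; exact: Ck_differentiable (H 1%N) Op. Qed.

Lemma smooth_is_derive O (W : normedModType R) (f : V -> W) p v : smooth_on O f -> O p ->
  is_derive p v f ('D_v f p).
Proof. by move=> H Op; apply: derivableP; apply: diff_derivable; exact: smooth_differentiable H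
    Op. Qed.

Lemma smooth_derive O (W : normedModType R) (f : V -> W) v : smooth_on O f -> smooth_on O
    ('D_v f).
Proof. by move=> H k; have [_] := H k.+1; apply. Qed.

Lemma smooth_subset O U (W : normedModType R) (f : V -> W) : O `<=` U -> smooth_on U f ->
    smooth_on O f.
Proof. by move=> OU H k; exact: Ck_subset OU (H k). Qed.

(** The inverse is explicit because coordinate functions are components of [F], while coordinate
    vectors are partial derivatives of [G]. *)
Definition diffeo (O O' : set V) (F G : V -> V) :=
 [/\ open O, open O', smooth_on O F, smooth_on O' G &
   [/\ forall x, O x -> O' (F x), forall y, O' y -> O (G y),
       forall x, O x -> G (F x) = x & forall y, O' y -> F (G y) = y]].

Lemma diffeo_comp O O' P P' F G F' G' : diffeo O O' F G -> diffeo P P' F' G' ->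
  diffeo (O `&` F @^-1` P) (P' `&` G' @^-1` O') (F' \o F) (G \o G').
Proof.
move=> [oO oO' sF sG [FO GO GF FG]] [oP oP' sF' sG' [FO' GO' GF' FG']].
have o1 : open (O `&` F @^-1` P) by exact: smooth_open_preimage oO sF oP.
have o2 : open (P' `&` G' @^-1` O') by exact: smooth_open_preimage oP' sG' oO'.
split => //.
- apply: (smooth_compV o1 oP _ _ sF') => [x []//|]; exact: smooth_subset sF.
- apply: (smooth_compV o2 oO' _ _ sG) => [x []//|]; exact: smooth_subset sG'.
- split=> [x [Ox Px]|y [Py Oy]|x [Ox Px]|y [Py Oy]] /=.
  + by split; [exact: FO'|rewrite /preimage /= GF' //; exact: FO].
  + by split; [exact: GO|rewrite /preimage /= FG //; exact: GO'].
  + by rewrite GF' // GF.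
  + by rewrite FG // FG'.
Qed.

(** Points with the same image differ at most in the [m]-th coordinate and have equal values of [h];
    were they distinct, the [m]-th partial would vanish between them. *)
Lemma upd_injective_on (h : V -> R) c (r : R) m :
  (forall p, box c r p -> is_derive p (delta_mx 0 m) h ('D_(delta_mx 0 m) h p)) ->
  (forall p, box c r p -> 'D_(delta_mx 0 m) h p != 0) ->
  forall p q, box c r p -> box c r q -> upd p m (h p) = upd q m (h q) -> p = q.
Proof.
move=> dh h0 p q.
wlog pq : p q / p 0 m <= q 0 m.
  move=> H bp bq E; have /orP[pq|qp] := le_total (p 0 m) (q 0 m); first exact: H E.
  by apply/esym; exact: (H q p).
move=> bp bq E.
have Ek k : k != m -> p 0 k = q 0 k.
  by move=> km; have := congr1 (fun x : V => x 0 k) E; rewrite !upd_ne.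
have hpq : h p = h q by have := congr1 (fun x : V => x 0 m) E; rewrite !upd_at.
have qE : q = upd p m (q 0 m).
  apply/rowP => k; have [->|km] := eqVneq k m; first by rewrite upd_at.
  by rewrite upd_ne // Ek.
suff pqm : p 0 m = q 0 m by rewrite qE -pqm upd_id.
apply/eqP; apply: contraT => npq.
have lt_pq : p 0 m < q 0 m by rewrite lt_neqAle npq.
have D s : p 0 m <= s <= q 0 m -> box c r (upd p m s).
  move=> sb; apply: box_upd => //; apply: (box_between bp (bq m)).
  by rewrite (min_idPl pq) (max_idPr pq).
have [||s sb] := @MVT R (fun s => h (upd p m s)) (fun s => 'D_(delta_mx 0 m) h (upd p m s)) _ _
    lt_pq.
- move=> s; rewrite in_itv /= => /andP[/ltW s1 /ltW s2].
  by apply/is_derive_upd/dh/D; rewrite s1.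
- apply: derivable_within_continuous => s; rewrite in_itv /= => sb.
  by have [] := (is_derive_upd h p m s _).1 (dh _ (D s sb)).
rewrite -qE upd_id hpq subrr => /esym/eqP; rewrite mulf_eq0 subr_eq0 (gt_eqF lt_pq) orbF.
move: sb; rewrite in_itv /= => /andP[/ltW s1 /ltW s2].
by apply/contraLR => _; apply: h0; apply: D; rewrite s1.
Qed.

(** Along a solution [f] of the autonomous equation with right-hand side [1 / Dh], the function [h]
    grows at unit speed. Prescribing the value of [h] then amounts to prescribing the time, which
    gives the inverse. *)
Lemma slot_diffeo U (h : V -> R) c m : open U -> U c -> smooth_on U h ->
  'D_(delta_mx 0 m) h c != 0 ->
  exists O O' G, [/\ O c, O `<=` U & diffeo O O' (fun p => upd p m (h p)) G].
Proof.
move=> oU Uc Sh hc.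
pose Dh := 'D_(delta_mx 0 m) h.
have SDh : smooth_on U Dh by exact: smooth_derive.
pose U1 := U `&` Dh @^-1` [set x | x != 0].
have oU1 : open U1.
  by apply: (smooth_open_preimage oU SDh); exact: open_neq.
have U1c : U1 c by [].
have Sb k : Ck k U1 (fun p => (Dh p)^-1).
  by apply: Ck_inv => // [x []//|]; apply: Ck_subset (SDh k) => x [].
have [r [f [r0 Sf fU fD f0]]] := scalar_ode m m oU1 U1c Sb.
have [r' r'0 r'U] := nbhs_box (open_nbhs_nbhs (conj oU1 U1c)).
pose rho := Num.min r r'.
have rho0 : 0 < rho by rewrite lt_min r0.
have B1 : box c rho `<=` box c r by apply: box_le; rewrite ge_min lexx.
have B2 : box c rho `<=` U1.
  by move=> x H; apply: r'U; apply: box_le x H; rewrite ge_min lexx orbT.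
have H p : box c r p -> box c rho (upd p m (c 0 m)) ->
  h (upd p m (f p)) = h (upd p m (c 0 m)) + p 0 m - c 0 m.
  move=> bp bp'.
  pose w s := h (upd p m (f (upd p m s))) - s.
  suff : w (p 0 m) = w (c 0 m).
    have bpc : box c r (upd p m (c 0 m)) by exact: B1.
    by rewrite /w upd_id (f0 _ bpc) ?upd_at //; lra.
  apply/eqP; rewrite -subr_eq0 -normr_le0.
  have := @mvt_abs _ w (fun=> 0) (c 0 m) (p 0 m) 0; rewrite mul0r; apply=> s sb.
  rewrite normr0; split => //.
  have bs : box c r (upd p m s).
    by apply: box_upd => //; apply: le_lt_trans (bp m); exact: between_norm.
  have Us := fU _ bs; rewrite upd_upd in Us.
  have Df : is_derive s 1 (fun t => f (upd p m t)) (Dh (upd p m (f (upd p m s))))^-1.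
    by have := (is_derive_upd _ _ _ _ _).1 (fD _ bs); rewrite upd_upd.
  have Dg : is_derive s 1 (fun t => upd p m (f (upd p m t)))
     ((Dh (upd p m (f (upd p m s))))^-1 *: delta_mx 0 m).
    apply: is_derive_row => i; rewrite !mxE /=; have [->|im] := eqVneq i m.
      by rewrite mulr1 (_ : (fun x => _) = (fun t => f (upd p m t))) //; apply/funext => t;
          rewrite upd_at.
    rewrite mulr0 (_ : (fun x => _) = fun=> p 0 i); first exact: is_derive_cst.
    by apply/funext => t; rewrite upd_ne.
  have Dhf := is_derive_chain Dg (smooth_differentiable Sh Us.1).
  have := is_deriveB Dhf (is_derive_id s 1).
  rewrite -[X in 'D_X h _]addr0 derive_linear; last exact: smooth_differentiable Sh Us.1.
  rewrite derive0 addr0 -/(Dh _) (_ : _ *: _ = 1) ?subrr //.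
  by rewrite /GRing.scale /= mulVf //; exact: Us.2.
(* By [H], the time at which [h] reaches the value [y 0 m]. *)
pose sig (y : V) := y 0 m - h (upd y m (c 0 m)) + c 0 m.
pose G y := upd y m (f (upd y m (sig y))).
pose N0 : set V := [set y | box c rho (upd y m (c 0 m))].
have oN0 : open N0.
  have := @open_preimage_on _ _ (fun y => upd y m (c 0 m)) setT (box c rho) openT.
  rewrite setTI; apply; last exact: open_box.
  move=> x _; apply: (@smooth_continuous setT) => //.
  by apply: smooth_upd; [exact: openT|apply: smooth_id; exact: openT|move=> k; exact: Ck_cst].
have Ssig : smooth_on N0 sig.
  move=> k; apply: Ck_add => //; last exact: Ck_cst.
  apply: Ck_sub => //; first exact: Ck_coord.
  apply: (smooth_comp (U:=U1) (F:=fun y => upd y m (c 0 m)) (f:=h)) => //.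
  - by move=> x; exact: B2.
  - by apply: smooth_upd => //; [exact: smooth_id|move=> l; exact: Ck_cst].
  - by apply: smooth_subset Sh => x [].
pose N : set V := N0 `&` sig @^-1` [set s | `|s - c 0 m| < rho].
have oN : open N.
  apply: (smooth_open_preimage oN0 Ssig).
  rewrite (_ : [set s | _] = ball (c 0 m) rho); first exact: ball_open.
  by apply/seteqP; split=> y /=; rewrite -ball_normE /= distrC.
have Nsig y : N y -> box c r (upd y m (sig y)).
  by move=> [y1 y2]; apply: B1; rewrite -(upd_upd y m (c 0 m)); exact: box_upd.
have SG : smooth_on N G.
  apply: smooth_upd => //; first exact: smooth_id.
  apply: (smooth_comp (U:=box c r) (F:=fun y => upd y m (sig y)) (f:=f)) => //.
  by apply: smooth_upd => //; [exact: smooth_id|apply: smooth_subset Ssig => x []].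
pose Th p := upd p m (h p).
have ThG y : N y -> Th (G y) = y.
  move=> Ny; rewrite /Th /G upd_upd.
  have := H _ (Nsig y Ny); rewrite !upd_upd upd_at => ->; last by case: Ny.
  by rewrite /sig (_ : _ + _ - _ = y 0 m) ?upd_id //; ring.
have STh : smooth_on (box c rho) Th.
  apply: smooth_upd; [exact: open_box|apply: smooth_id; exact: open_box|].
  by apply: smooth_subset Sh => x /B2 [].
(* In the box [Th] is injective, so that [Th (G y) = y] also yields [G (Th p) = p]. *)
pose O' := N `&` G @^-1` (box c rho).
have oO' : open O'.
  by apply: (smooth_open_preimage oN SG); exact: open_box.
pose O := box c rho `&` Th @^-1` O'.
have oO : open O.
  by apply: (smooth_open_preimage _ STh oO'); exact: open_box.
exists O, O', G.
have bc : box c rho c by exact: box_center.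
have NTc : N (Th c).
  by split; rewrite /N0 /preimage /= /Th ?upd_upd ?upd_id // /sig upd_upd upd_id upd_at subrr
      add0r subrr normr0.
have GTc : G (Th c) = c.
  rewrite /G /Th !upd_upd /sig upd_upd upd_id upd_at subrr add0r upd_id f0 ?upd_id //.
  exact: box_center.
split.
- by split => //; split => //; rewrite /preimage /= GTc.
- by move=> x [/B2 []].
- split => //.
  + by apply: smooth_subset STh => x [].
  + by apply: smooth_subset SG => x [].
  + split=> [x [_ //]|y [Ny By]|x [Bx [Nx GBx]]|y [Ny _]].
    * by split => //; rewrite /preimage /= ThG.
    * apply: (@upd_injective_on h c rho m) => //.
      - by move=> p /B2 [Up _]; exact: smooth_is_derive Sh Up.
      - by move=> p /B2 [].
      - exact: ThG.
    * exact: ThG.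
Qed.
End Diffeo.

(** * Frobenius theorem *)

Section Frobenius.
Context {R : realType} {n : nat}.
Local Notation V := ('rV[R]_n).
Local Notation "''e_' i" := (delta_mx 0 i : V) (at level 8, i at level 2).
Implicit Types (O U N : set V) (p q c : V) (f g : V -> R) (x y z : 'I_n).

Lemma is_derive_upd_fun (F : V -> V) f p v w (d : R) m : is_derive p v F w -> is_derive p v f d ->
  is_derive p v (fun p => upd (F p) m (f p)) (upd w m d).
Proof.
move=> DF Df; apply: is_derive_row => i; have [->|im] := eqVneq i m.
  have -> : (fun q => upd (F q) m (f q) 0 m) = f by apply/funext => q; rewrite upd_at.
  by rewrite upd_at.
have -> : (fun q => upd (F q) m (f q) 0 i) = fun q => F q 0 i.
  by apply/funext => q; rewrite upd_ne.
by rewrite upd_ne //; exact: is_derive_coord.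
Qed.

Lemma delta_ne x z : x != z -> 'e_x 0 z = 0.
Proof. by move=> xz; rewrite mxE eqxx /= eq_sym (negbTE xz). Qed.

Lemma delta_at x : 'e_x 0 x = 1.
Proof. by rewrite mxE !eqxx. Qed.

Lemma upd_delta x z (s : R) : x != z -> upd 'e_x z s = 'e_x + s *: 'e_z.
Proof. by move=> xz; rewrite updE delta_ne // subr0. Qed.

Lemma is_derive_unique (W : normedModType R) (f : V -> W) p v d d' :
  is_derive p v f d -> is_derive p v f d' -> d = d'.
Proof. by move=> [_ <-] [_ <-]. Qed.

Lemma derive_upd_delta f p x z (s : R) : x != z -> differentiable f p ->
  'D_(upd 'e_x z s) f p = 'D_('e_x) f p + s * 'D_('e_z) f p.
Proof. by move=> xz D; rewrite upd_delta // addrC derive_linear // addrC. Qed.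

(* [E] is obtained by inverting the flow [Z] of the field [e_y + b e_z] in [z];
   the last clause holds because [g] is constant along the flow lines. *)
Lemma transport U (b : V -> R) c y z : y != z -> open U -> U c -> smooth_on U b ->
  exists E O, [/\ open O, O c, O `<=` U, smooth_on O E &
   [/\ forall q, O q -> 'D_(upd 'e_y z (b q)) E q = 0,
      forall q, O q -> 'D_('e_z) E q != 0,
      forall q, O q -> q 0 y = c 0 y -> E q = q 0 z &
      forall N, open N -> N c -> exists O', [/\ open O', O' c, O' `<=` N, O' `<=` O &
        forall g, (forall q, O' q -> differentiable g q) ->
          (forall q, O' q -> 'D_(upd 'e_y z (b q)) g q = 0) ->
          (forall q, O' q -> q 0 y = c 0 y -> g q = 0) -> forall q, O' q -> g q = 0]]].
Proof.
move=> yz oU Uc Sb.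
have [r [Z [r0 SZ ZU ZD Z0]]] := scalar_ode z y oU Uc Sb.
have oB := @open_box R n c r; have bc := box_center c r0.
have zy : z != y by rewrite eq_sym.
have Zz : 'D_('e_z) Z c != 0.
  suff -> : 'D_('e_z) Z c = 1 by exact: oner_neq0.
  have D1 := smooth_is_derive 'e_z SZ bc.
  rewrite -[c in is_derive c](upd_id c z) in D1; have {}D1 := (is_derive_upd _ _ _ _ _).1 D1.
  have D2 : is_derive (c 0 z) 1 (fun t => Z (upd c z t)) 1.
    have oR : open (ball (c 0 z) r) by exact: ball_open.
    have Rc : ball (c 0 z) r (c 0 z) by exact: ballxx.
    apply: (is_derive_ext oR Rc _ (is_derive_id (c 0 z) (1 : R))) => t tb.
    rewrite Z0 ?upd_at ?upd_ne 1?eq_sym // ; apply: box_upd => //.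
    by move: tb; rewrite -ball_normE /= distrC.
  by case: D1 => _ <-; case: D2.
have [ O1 [ O2 [G [ O1c O1B [oO1 oO2 STh SG [ThO GO GTh ThG]]]]]] := slot_diffeo oB bc SZ Zz.
(* The flow issuing from the hyperplane [q 0 y = c 0 y]; by [DThy] it carries [e_y] to
   [e_y + b e_z]. The function [E], the [z]-component of its inverse, is the height at which the
   flow line of a point meets the hyperplane. *)
pose Th p := upd p z (Z p).
have Thc : Th c = c by rewrite /Th Z0 // upd_id.
have O2c : O2 c by rewrite -Thc; exact: ThO.
have Gc : G c = c by rewrite -[in G c]Thc; exact: GTh.
have DTh p v : O1 p -> is_derive p v Th (upd v z ('D_v Z p)).
  move=> Op; have DZ := smooth_is_derive v SZ (O1B _ Op).
  exact: (is_derive_upd_fun z (is_derive_id p v) DZ).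
have DThy p : O1 p -> is_derive p 'e_y Th (upd 'e_y z (b (Th p))).
  move=> Op; have := DTh p 'e_y Op.
  by have [_ ->] := ZD p (O1B _ Op).
have SE : smooth_on O2 (fun q => G q 0 z : R) by exact: (smooth_rowP G oO2).1.
have EThD p v : O1 p -> 'D_(upd v z ('D_v Z p)) (fun q => G q 0 z : R) (Th p) = v 0 z.
  move=> Op.
  apply: (is_derive_unique (is_derive_chain (DTh p v Op) (smooth_differentiable SE (ThO _ Op)))).
  apply: (@is_derive_ext _ _ _ (fun q => q 0 z) _ O1) => // [q Oq|].
    by rewrite /= GTh.
  exact: (is_derive_coord z (is_derive_id p v)).
exists (fun q => G q 0 z), O2; split => //.
- by move=> q Oq; rewrite -(ThG q Oq); apply: ZU; apply: O1B; exact: GO.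
split.
- move=> q Oq; have := EThD (G q) 'e_y (GO _ Oq); rewrite /Th ThG // delta_ne //.
  by have [_ ->] := ZD _ (O1B _ (GO _ Oq)); rewrite ThG.
- move=> q Oq; have := EThD (G q) 'e_z (GO _ Oq); rewrite /Th ThG // delta_at.
  rewrite (_ : upd _ _ _ = 'D_('e_z) Z (G q) *: 'e_z + 0); last first.
    rewrite addr0; apply/rowP => k; have [->|kz] := eqVneq k z.
      by rewrite upd_at mxE delta_at mulr1.
    by rewrite upd_ne // !mxE (negbTE kz) andbF mulr0.
  rewrite derive_linear; last exact: smooth_differentiable SE Oq.
  rewrite derive0 addr0 => H; apply: contra_eq_neq H => ->.
  by rewrite scaler0 eq_sym oner_neq0.
- move=> q Oq qy.
  have Gy : G q 0 y = c 0 y by rewrite -qy -[in RHS](ThG q Oq) upd_ne.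
  by rewrite -[in RHS](ThG q Oq) upd_at Z0 //; apply: O1B; exact: GO.
- move=> N oN Nc.
  have oM : open (O1 `&` Th @^-1` N).
    exact: smooth_open_preimage oO1 STh oN.
  have Mc : (O1 `&` Th @^-1` N) c by split => //; rewrite /preimage /= Thc.
  have [s s0 sM] := nbhs_box (open_nbhs_nbhs (conj oM Mc)).
  (* A box in flow coordinates: it contains the flow line from each of its points back to the
     hyperplane. *)
  pose O' := O2 `&` G @^-1` (box c s).
  have ThO' p : box c s p -> O' (Th p).
    by move=> bp; have [ Op _] := sM _ bp; split; [exact: ThO|rewrite /preimage /= GTh].
  exists O'; split.
  + by apply: (smooth_open_preimage oO2 SG); exact: open_box.
  + by split => //; rewrite /preimage /= Gc; exact: box_center.
  + by move=> q [ Oq /sM [_]]; rewrite /preimage /= /Th ThG.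
  + by move=> q [].
  + move=> g Dg Yg g0 q [ Oq bq].
    have O'q p : box c s p -> O' (Th p) by exact: ThO'.
    have cs : `|c 0 y - c 0 y| < s by rewrite subrr normr0.
    have := @line_bound R n (fun p => g (Th p)) (fun=> 0) (G q) y (c 0 y) (G q 0 y) 0.
    have ThGq : Th (G q) = q by exact: ThG.
    rewrite upd_id ThGq mul0r (g0 (Th (upd (G q) y (c 0 y)))) ?subr0; last first.
    * by rewrite upd_ne // upd_at.
    * by apply: ThO'; exact: box_upd.
    move=> H; apply/eqP; rewrite -normr_le0; apply: H => t tb; rewrite normr0; split => //.
    have bt : box c s (upd (G q) y t).
      by apply: box_upd => //; apply: le_lt_trans (bq y); exact: between_norm.
    have [ Ot _] := sM _ bt.
    have := is_derive_chain (DThy _ Ot) (Dg _ (ThO' _ bt)).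
    by rewrite Yg //; exact: ThO'.
Qed.

(** The hypothesis says that [X = e_x + a e_z] and [Y = e_y + b e_z] commute. The map [kap] slides
    points along [Y] onto the hyperplane [q 0 y = c 0 y], and [f] is [H \o kap] with [H] a first
    integral of the restricted field [e_x + a0 e_z]. Then [Y f = 0] because [kap] is constant along
    [Y], and [X f = 0] because [kap] carries [X] to the restricted field; this last fact is
    [W = 0]. *)
Lemma frobenius U (a b : V -> R) c x y z : x != z -> y != z -> x != y ->
  open U -> U c -> smooth_on U a -> smooth_on U b ->
  (forall q, U q -> 'D_(upd 'e_x z (a q)) b q = 'D_(upd 'e_y z (b q)) a q) ->
  exists O f, [/\ open O, O c, O `<=` U, smooth_on O f &
    forall q, O q -> [/\ 'D_(upd 'e_x z (a q)) f q = 0, 'D_(upd 'e_y z (b q)) f q = 0 &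
      'D_('e_z) f q != 0]].
Proof.
move=> xz yz xy oU Uc Sa Sb ab.
have [zx zy yx] : [/\ z != x, z != y & y != x] by rewrite ![_ == x]eq_sym [z == y]eq_sym.
have [E [ OE [oOE OEc OEU SE [YE Ez E0 uniqE]]]] := transport yz oU Uc Sb.
(* Frozen at [c 0 y], so that [transport] applies in the full space rather than in the
   hyperplane. *)
pose a0 q := a (upd q y (c 0 y)).
pose U0 : set V := (fun q => upd q y (c 0 y)) @^-1` U.
have Sup O : open O -> smooth_on O (fun q => upd q y (c 0 y)).
  by move=> oO; apply: smooth_upd => //; [exact: smooth_id|move=> k; exact: Ck_cst].
have oU0 : open U0.
  by have := smooth_open_preimage openT (Sup _ openT) oU; rewrite setTI.
have U0c : U0 c by rewrite /U0 /preimage /= upd_id.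
have Sa0 : smooth_on U0 a0.
  exact: (smooth_comp (U:=U) (F:=fun q => upd q y (c 0 y)) (f:=a) oU0 _ (Sup _ oU0) Sa).
have [H [ OG [oOG OGc _ SH [XH Hz _ _]]]] := transport xz oU0 U0c Sa0.
pose kap q := upd (upd q y (c 0 y)) z (E q).
have Skap : smooth_on OE kap by apply: smooth_upd => //; exact: Sup.
have kapc : kap c = c by rewrite /kap upd_id E0 // upd_id.
pose O1 := OE `&` kap @^-1` (OG `&` U).
have oO1 : open O1.
  by apply: (smooth_open_preimage oOE Skap); exact: openI.
have O1c : O1 c by split => //; rewrite /preimage /= kapc; split.
have [ O' [oO' O'c O'1 O'E uniq]] := uniqE O1 oO1 O1c.
have DE q v : OE q -> is_derive q v E ('D_v E q) by exact: smooth_is_derive.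
have Dkap q v : OE q -> is_derive q v kap (upd (upd v y 0) z ('D_v E q)).
  move=> Oq; apply: is_derive_upd_fun; last exact: DE.
  exact: (is_derive_upd_fun y (is_derive_id q v) (is_derive_cst (c 0 y) q v)).
have dE q : OE q -> differentiable E q by exact: smooth_differentiable.
have YEE q : OE q -> 'D_('e_y) E q + b q * 'D_('e_z) E q = 0.
  by move=> Oq; rewrite -derive_upd_delta ?YE //; exact: dE.
have kapY q : OE q -> upd (upd (upd 'e_y z (b q)) y 0) z ('D_(upd 'e_y z (b q)) E q) = 0.
  move=> Oq; rewrite YE //; apply/rowP => k; rewrite [RHS]mxE.
  have [->|kz] := eqVneq k z; first by rewrite upd_at.
  rewrite upd_ne //; have [->|ky] := eqVneq k y; first by rewrite upd_at.
  by rewrite upd_ne // upd_ne // delta_ne // eq_sym.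
(* Since the fields commute and [E] is constant along the second one, so is [W];
   it vanishes on the initial hyperplane, hence everywhere. *)
pose W q := 'D_('e_x) E q + a q * 'D_('e_z) E q - a (kap q).
have W0 q : O' q -> W q = 0.
  have SEi i : smooth_on OE ('D_('e_i) E) by exact: smooth_derive.
  have dEi i v q' : OE q' -> is_derive q' v ('D_('e_i) E) ('D_v ('D_('e_i) E) q').
    exact: smooth_is_derive.
  have DW q' : O' q' -> is_derive q' (upd 'e_y z (b q')) W
      ('D_(upd 'e_y z (b q')) ('D_('e_x) E) q' +
       (a q' * 'D_(upd 'e_y z (b q')) ('D_('e_z) E) q' + 'D_('e_z) E q' *
           'D_(upd 'e_y z (b q')) a q')).
    move=> O'q; have Oq := O'E _ O'q; have [_ [_ Uk]] := O'1 _ O'q.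
    have Uq := OEU _ Oq.
    have D1 := is_derive_chain (Dkap q' (upd 'e_y z (b q')) Oq) (smooth_differentiable Sa Uk).
    rewrite kapY // derive0 in D1.
    have D2 := is_deriveM (smooth_is_derive (upd 'e_y z (b q')) Sa Uq)
        (dEi z (upd 'e_y z (b q')) q' Oq).
    have := is_deriveB (is_deriveD (dEi x (upd 'e_y z (b q')) q' Oq) D2) D1.
    by rewrite subr0.
  apply: uniq => {}q O'q.
  - have Oq := O'E _ O'q; have [_ [_ Uk]] := O'1 _ O'q; have Uq := OEU _ Oq.
    apply: differentiableB; last first.
      apply: (@differentiable_comp _ _ _ _ kap a); first exact: smooth_differentiable Skap Oq.
      exact: smooth_differentiable Sa Uk.
    apply: differentiableD; first exact: smooth_differentiable (SEi x) Oq.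
    by apply: differentiableM; [exact: smooth_differentiable Sa Uq|exact: smooth_differentiable
        (SEi z) Oq].
  - have Oq := O'E _ O'q; have Uq := OEU _ Oq.
    have [_ ->] := DW q O'q.
    rewrite -(ab q Uq) !derive_upd_delta //; try exact: smooth_differentiable Oq.
    all: try exact: smooth_differentiable Uq.
    have sw i k : 'D_('e_i) ('D_('e_k) E) q = 'D_('e_k) ('D_('e_i) E) q.
      exact: (derive_comm _ _ oOE Oq (SE 2)).
    (* The derivative of [Y E = 0] along [v]. After mixed derivatives are swapped and [ab] is used,
       [Y W] is this expression for [e_x] plus [a] times the one for [e_z]. *)
    have Zero v : 'D_v ('D_('e_y) E) q + (b q * 'D_v ('D_('e_z) E) q + 'D_('e_z) E q * 'D_v b
        q) = 0.
      pose F q' := 'D_('e_y) E q' + b q' * 'D_('e_z) E q'.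
      have D1 : is_derive q v F ('D_v ('D_('e_y) E) q +
          (b q * 'D_v ('D_('e_z) E) q + 'D_('e_z) E q * 'D_v b q)).
        exact: (is_deriveD (dEi y v q Oq) (is_deriveM (smooth_is_derive v Sb Uq) (dEi z v q Oq))).
      have D0 : is_derive q v F 0.
        apply: (@is_derive_ext _ _ _ (fun=> 0) F OE q v 0 oOE Oq).
        by move=> q' Oq'; rewrite /F YEE.
      exact: (is_derive_unique D1 D0).
    have alg (Exy Exz Ezy Ezz Eyx Ezx Eyz Ezq bx bz aq bq : R) : Eyx = Exy -> Ezx = Exz -> Eyz
        = Ezy ->
        Exy + (bq * Exz + Ezq * bx) = 0 -> Ezy + (bq * Ezz + Ezq * bz) = 0 ->
        Eyx + bq * Ezx + (aq * (Eyz + bq * Ezz) + Ezq * (bx + aq * bz)) = 0.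
      move=> -> -> -> Zx Zz.
      rewrite (_ : _ + _ + _ = (Exy + (bq * Exz + Ezq * bx)) + aq *
          (Ezy + (bq * Ezz + Ezq * bz))); last by ring.
      by rewrite Zx Zz mulr0 addr0.
    exact: (alg _ _ _ _ _ _ _ _ _ _ _ _ (sw y x) (sw z x) (sw y z) (Zero 'e_x) (Zero 'e_z)).
  (* On the hyperplane [E] is the [z]-coordinate and [X] is tangent to it, so [X E] is the
     [z]-component [a] of [X]. *)
  - move=> qy; have Oq := O'E _ O'q.
    have kq : kap q = q.
      by rewrite /kap E0 // -qy upd_id upd_id.
    rewrite /W kq -derive_upd_delta //; last exact: dE.
    apply/eqP; rewrite subr_eq0; apply/eqP.
    pose X := upd 'e_x z (a q).
    have D1 := (is_derive_line _ _ _ _).1 (DE q X Oq).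
    have D2 : is_derive (0 : R) 1 (fun h : R => E (h *: X + q)) (a q).
      have oT : open ([set: R] `&` (fun h : R => h *: X + q) @^-1` OE).
        apply: (open_preimage_on openT _ oOE) => h _.
        by apply: cvgD; [apply: cvgZr_tmp; exact: cvg_id|exact: cvg_cst].
      have T0 : ([set: R] `&` (fun h : R => h *: X + q) @^-1` OE) 0.
        by split => //; rewrite /preimage /= scale0r add0r.
      have DL : is_derive (0 : R) 1 (fun h : R => h * a q + q 0 z) (a q).
        apply: (is_derive_eq (is_deriveD (is_deriveM (is_derive_id (0 : R) (1 : R))
            (is_derive_cst (a q) (0 : R) (1 : R))) (is_derive_cst (q 0 z) (0 : R) (1 : R)))).
        by rewrite scaler0 add0r addr0 /GRing.scale /= mulr1.
      apply: (is_derive_ext oT T0 _ DL) => h [_ Oh].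
      rewrite E0 //; first by rewrite !mxE eqxx.
      by rewrite mxE mxE upd_ne // delta_ne // mulr0 add0r.
    by case: D1 => _ <-; case: D2.
exists O', (H \o kap); split => //.
- by move=> q /O'E /OEU.
- apply: (smooth_comp (U:=OG)) => //; first by move=> q /O'1 [_ []].
  exact: smooth_subset O'E Skap.
move=> q O'q; have Oq := O'E _ O'q; have [_ [ Ok Uk]] := O'1 _ O'q.
have DH v : 'D_v (H \o kap) q = 'D_(upd (upd v y 0) z ('D_v E q)) H (kap q).
  by have [_ ->] := is_derive_chain (Dkap q v Oq) (smooth_differentiable SH Ok).
have ky : kap q 0 y = c 0 y by rewrite /kap upd_ne // upd_at.
split.
- rewrite DH; apply: etrans (XH _ Ok); congr ('D_ _ H (kap q)).
  have -> : a0 (kap q) = 'D_(upd 'e_x z (a q)) E q.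
    rewrite /a0 -ky upd_id; apply/esym/eqP; rewrite -subr_eq0 derive_upd_delta //; last exact: dE.
    by apply/eqP; exact: W0.
  by rewrite upd_comm // upd_upd -[RHS](upd_id _ y) upd_ne // delta_ne.
- by rewrite DH kapY // derive0.
- rewrite DH (_ : upd _ _ _ = 'D_('e_z) E q *: 'e_z + 0); last first.
    rewrite addr0; apply/rowP => k; rewrite [RHS]mxE; have [->|kz] := eqVneq k z.
      by rewrite upd_at delta_at mulr1.
    rewrite upd_ne // delta_ne 1?eq_sym // mulr0.
    have [->|k_y] := eqVneq k y; first by rewrite upd_at.
    by rewrite upd_ne // delta_ne 1?eq_sym.
  rewrite derive_linear; last exact: smooth_differentiable SH Ok.
  by rewrite derive0 addr0 mulf_neq0 //; [exact: Ez|exact: Hz].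
Qed.
End Frobenius.

(** * Functions on the body read in a chart *)

Section LocalRep.
Context {R : realType} {B : body R}.
Local Notation vec := ('rV[R]_3).

Lemma local_repE (W : normedModType R) (U : set B) (psi : B -> vec) (f : B -> W) x :
  {in U &, injective psi} -> U x -> local_rep U psi f (psi x) = f x.
Proof.
move=> inj Ux; rewrite /local_rep; case: xgetP => [w _ [y [Uy yx] <-]|/(_ (f x)) H].
  by congr f; apply: inj => //; rewrite inE.
by exfalso; apply: H; exists x.
Qed.

Lemma ref_rep (W : normedModType R) (U : set B) (f : B -> W) x :
  U x -> local_rep U (@ref R B) f (ref x) = f x.
Proof. by apply: local_repE => y z _ _; exact: ref_inj. Qed.

Lemma ref_rep_ext (W : normedModType R) (U : set B) (f : B -> W) (F : vec -> W) :
  (forall x, U x -> f x = F (ref x)) ->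
  forall q, (@ref R B @` U) q -> F q = local_rep U (@ref R B) f q.
Proof. by move=> fF _ [x Ux <-]; rewrite ref_rep // fF. Qed.

Lemma smooth_ext (V W : normedModType R) (O : set V) (f g : V -> W) : open O ->
  (forall x, O x -> f x = g x) -> smooth_on O f -> smooth_on O g.
Proof. by move=> oO fg H k; exact: Ck_ext oO fg (H k). Qed.

Lemma open_ref (U : set B) : open U -> open (@ref R B @` U).
Proof. exact: ref_open. Qed.

Lemma open_ref_preimage (O : set vec) : open O -> open (@ref R B @^-1` O).
Proof. by apply: open_comp => x _; exact: ref_continuous. Qed.

Lemma ref_image_preimage (U : set B) (O : set vec) : O `<=` @ref R B @` U ->
  @ref R B @` (U `&` @ref R B @^-1` O) = O.
Proof.
move=> OU; apply/seteqP; split=> [_ [x [_ Ox] <-] //|q Oq].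
by have [x Ux xq] := OU q Oq; exists x => //; split => //; rewrite /preimage /= xq.
Qed.

End LocalRep.

(** * Planes in dimension three *)

Section Dim3.
Context {F : fieldType}.
Local Notation vec := ('rV[F]_3).
Implicit Types (u v w : vec) (i j k z : 'I_3).

(** Indices in ['I_3] add modulo 3; cyclic order from [z] treats the three possible positions of a
    nonzero component alike. *)
Lemma sum3 (G : 'I_3 -> F) z : \sum_i G i = G z + G (z + 1) + G (z + 1 + 1).
Proof.
rewrite 3!big_ord_recl big_ord0 addr0.
case: z => [[|[|[|]]]] // Hz.
- by rewrite addrA; congr (G _ + G _ + G _); apply: val_inj.
- by rewrite addrC; congr (G _ + G _ + G _); apply: val_inj.
- by rewrite addrA addrC addrA; congr (G _ + G _ + G _); apply: val_inj.
Qed.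

Lemma ord3_succ z : [/\ z + 1 != z, z + 1 + 1 != z, z + 1 != z + 1 + 1 & z + 1 + 1 + 1 = z].
Proof. by case: z => [[|[|[|]]]] // Hz; split => //; apply: val_inj. Qed.

Definition dot u v : F := \sum_i u 0 i * v 0 i.
Definition cross u v : vec := \row_i (u 0 (i + 1) * v 0 (i + 1 + 1) - u 0 (i + 1 + 1) * v 0
    (i + 1)).

Lemma dotDr u v w (a : F) : dot u (a *: v + w) = a * dot u v + dot u w.
Proof.
rewrite /dot mulr_sumr -big_split; apply: eq_bigr => i _ /=.
by rewrite !mxE mulrDr mulrCA.
Qed.

Lemma dot0 u : dot u 0 = 0.
Proof. by rewrite /dot big1 // => i _; rewrite mxE mulr0. Qed.

Lemma dot_delta u z : dot u (delta_mx 0 z) = u 0 z.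
Proof.
rewrite /dot (bigD1 z) //= big1 => [|i iz]; first by rewrite addr0 mxE !eqxx mulr1.
by rewrite mxE (negbTE iz) andbF mulr0.
Qed.

Lemma dot_cross u v : dot (cross u v) u = 0 /\ dot (cross u v) v = 0.
Proof.
rewrite /dot !(sum3 _ 0) !mxE; have [_ _ _ E] := ord3_succ 0; rewrite !E.
by split; ring.
Qed.

(** If the cross product vanished, all 2 by 2 minors would, and the vectors would be proportional.
    If its component [z] is nonzero, [e_z] completes the plane to the whole space, and [dot] with
    the normal detects the coefficient of [e_z]. *)
Lemma cross_span u v : \dim <<[:: u; v]>> = 2%N -> cross u v != 0 /\
  forall w, (w \in <<[:: u; v]>>%VS) = (dot (cross u v) w == 0).
Proof.
move=> d2.
have in_dot w : w \in <<[:: u; v]>>%VS -> dot (cross u v) w = 0.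
  rewrite span_cons span_seq1 => /memv_addP [_ /vlineP[a ->] [_ /vlineP[b ->] ->]].
  have [H1 H2] := dot_cross u v.
  by rewrite -[b *: v]addr0 dotDr dotDr H1 H2 !mulr0 !add0r dot0.
have c0 : cross u v != 0.
  apply/eqP => c0.
  have cE i j : u 0 i * v 0 j = u 0 j * v 0 i.
    have H k : u 0 (k + 1) * v 0 (k + 1 + 1) = u 0 (k + 1 + 1) * v 0 (k + 1).
      by apply/eqP; rewrite -subr_eq0; have := congr1 (fun x : vec => x 0 k) c0; rewrite !mxE
          => ->.
    have [->|ij] := eqVneq i j; first by [].
    have : (j == i + 1) || (i == j + 1) by case: i j ij => [[|[|[|]]]] ? // [[|[|[|]]]] ?.
    have [_ _ _ Ei] := ord3_succ i; have [_ _ _ Ej] := ord3_succ j.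
    move=> /orP[/eqP jE|/eqP iE].
      by have := H (i + 1 + 1); rewrite !Ei -jE.
    by have := H (j + 1 + 1); rewrite !Ej -iE => ->.
  have [j vj|v0] := pickP (fun j => v 0 j != 0); last first.
    have v0' : v = 0 by apply/rowP => j; apply/eqP; rewrite mxE; have /negbFE := v0 j.
    have : (<<[:: u; v]>> <= <[u]>)%VS.
      by rewrite span_cons span_seq1 subv_add subvv -memvE v0' mem0v.
    by move/dimvS; rewrite d2 dim_vline; case: (u != 0).
  have uE : u = (u 0 j / v 0 j) *: v.
    by apply/rowP => i; rewrite mxE mulrAC cE mulfK.
  have : (<<[:: u; v]>> <= <[v]>)%VS.
    rewrite span_cons span_seq1 subv_add subvv andbT -memvE uE; exact: memvZ (memv_line v).
  by move/dimvS; rewrite d2 dim_vline; case: (v != 0).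
split => // w; apply/idP/eqP; first exact: in_dot.
move=> dw; have [z cz] : exists z, cross u v 0 z != 0.
  apply/existsP; apply: contraNT c0 => /existsPn H; apply/eqP/rowP => i.
  by rewrite [RHS]mxE; apply/eqP; have /negPn := H i.
set W := <<_>>%VS in d2 in_dot *.
pose e : vec := delta_mx 0 z.
have ez : e \notin W.
  by apply/negP => /in_dot; rewrite dot_delta; apply/eqP.
have dis : (W :&: <[e]> = 0)%VS.
  apply/eqP; rewrite -subv0; apply/subvP => y; rewrite memv_cap => /andP[yW /vlineP[t yE]].
  rewrite memv0; apply: contraNT ez; rewrite yE scaler_eq0 negb_or => /andP[t0 _].
  by rewrite -[e](scalerK t0) memvZ // -yE.
have full : (W + <[e]>)%VS = fullv.
  apply/eqP; rewrite eqEdim subvf dimvf dimv_disjoint_sum // d2 dim_vline.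
  rewrite (_ : e != 0) //; apply: contraNneq ez => ->; exact: mem0v.
have : w \in (W + <[e]>)%VS by rewrite full memvf.
move=> /memv_addP[w1 w1W [_ /vlineP[t ->] wE]].
suff t0 : t = 0 by rewrite wE t0 scale0r addr0.
move: dw; rewrite wE [w1 + _]addrC dotDr (in_dot _ w1W) addr0 dot_delta => /eqP.
by rewrite mulf_eq0 (negbTE cz) orbF => /eqP.
Qed.
End Dim3.

Lemma is_derive_bigsum {R : realType} {V : normedModType R} m (h : 'I_m -> V -> R) q v
    (d : 'I_m -> R) :
  (forall i, is_derive q v (h i) (d i)) -> is_derive q v (fun p => \sum_i h i p) (\sum_i d i).
Proof.
move=> H; have -> : (fun p => \sum_i h i p) = \sum_i h i by apply/funext => p; rewrite fct_sumE.
exact: is_derive_sum.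
Qed.

Lemma ord3_cases (z k : 'I_3) : k = z \/ k = z + 1 \/ k = z + 1 + 1.
Proof.
suff : [|| k == z, k == z + 1 | k == z + 1 + 1].
  by case/or3P => /eqP; [left|right; left|right; right].
by case: z k => [[|[|[|]]]] // ? [[|[|[|]]]].
Qed.

(** * First integrals of plane distributions *)

Section FirstIntegral.
Context {R : realType} {B : body R}.
Local Notation vec := ('rV[R]_3).
Local Notation "''e_' i" := (delta_mx 0 i : vec) (at level 8, i at level 2).
Implicit Types (D : B -> {vspace vec}) (U : set B) (O : set vec) (f : vec -> R).

Definition first_integral_at D (x0 : B) := exists O f,
  [/\ open O, O (ref x0), O `<=` @ref R B @` setT, smooth_on O f &
    forall x, O (ref x) -> forall v, v \in D x <-> 'D_v f (ref x) = 0].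

(** Product rule for the derivative along a varying field: one term differentiates the field, the
    other freezes it at [q]. Expansion in the partials of [f] reduces it to products of real
    functions. *)
Lemma is_derive_field O f (X : vec -> vec) q v : open O -> O q -> smooth_on O f ->
  smooth_on O X ->
  is_derive q v (fun q => 'D_(X q) f q) ('D_('D_v X q) f q + 'D_v ('D_(X q) f) q).
Proof.
move=> oO Oq Sf SX.
have df p : O p -> differentiable f p by exact: smooth_differentiable.
have Si i : smooth_on O ('D_('e_i) f) by exact: smooth_derive.
have DX i : is_derive q v (fun p => X p 0 i : R) ('D_v X q 0 i).
  by apply: is_derive_coord; exact: smooth_is_derive SX Oq.
have Df i : is_derive q v ('D_('e_i) f) ('D_v ('D_('e_i) f) q) by exact: smooth_is_derive
    (Si i) Oq.
have E w : 'D_v ('D_w f) q = \sum_i w 0 i * 'D_v ('D_('e_i) f) q.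
  have D0 : is_derive q v ('D_w f) ('D_v ('D_w f) q).
    exact: smooth_is_derive (smooth_derive w Sf) Oq.
  have D1 : is_derive q v (fun p => \sum_i w 0 i * 'D_('e_i) f p)
      (\sum_i w 0 i * 'D_v ('D_('e_i) f) q).
    by apply: is_derive_bigsum => i; exact: (is_deriveZ (w 0 i) (Df i)).
  have fE p : O p -> \sum_i w 0 i * 'D_('e_i) f p = 'D_w f p.
    by move=> Op; rewrite derive_row //; exact: df.
  exact: (is_derive_unique D0 (is_derive_ext oO Oq fE D1)).
have S : is_derive q v (fun p => \sum_i X p 0 i * 'D_('e_i) f p)
    (\sum_i (X q 0 i * 'D_v ('D_('e_i) f) q + 'D_('e_i) f q * 'D_v X q 0 i)).
  by apply: is_derive_bigsum => i; exact: (is_deriveM (DX i) (Df i)).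
have fE p : O p -> \sum_i X p 0 i * 'D_('e_i) f p = 'D_(X p) f p.
  by move=> Op; rewrite derive_row //; exact: df.
have {}S := is_derive_ext oO Oq fE S.
apply: (is_derive_eq S); rewrite big_split /= addrC -E (derive_row ('D_v X q) (df q Oq)).
by congr (_ + _); apply: eq_bigr => i _; rewrite mulrC.
Qed.

(** Differentiating [X f = 0] along [Y] turns the derivative of [f] along [D_Y X] into a second
    derivative of [f]. In the bracket the two second derivatives cancel by symmetry. *)
Lemma first_integral_involutive D : (forall x0, first_integral_at D x0) ->
    involutive_distribution D.
Proof.
move=> H U X Y oU [SX XD] [SY YD] x Ux.
have [ O [f [oO Ox _ Sf fD]]] := H x.
pose OO := O `&` @ref R B @` U.
have oOO : open OO by apply: openI => //; exact: open_ref.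
have OOx : OO (ref x) by split => //; exists x.
have SfO : smooth_on OO f by apply: smooth_subset Sf => q [].
have df q : OO q -> differentiable f q by exact: smooth_differentiable SfO.
have key (Z Z' : B -> vec) : smooth_on_body U Z -> (forall x, U x -> Z x \in D x) ->
    'D_('D_(Z' x) (local_rep U (@ref R B) Z) (ref x)) f (ref x) = - 'D_(Z' x) ('D_(Z x) f)
        (ref x).
  move=> SZ ZD.
  have SZO : smooth_on OO (local_rep U (@ref R B) Z) by apply: smooth_subset SZ => q [].
  have D1 := is_derive_field (Z' x) oOO OOx SfO SZO.
  rewrite ref_rep // in D1; apply/eqP; rewrite -addr_eq0; apply/eqP.
  have f0 q : OO q -> 0 = 'D_(local_rep U (@ref R B) Z q) f q.
    move=> [ Oq [y Uy yq]]; rewrite -yq ref_rep //; apply/esym.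
    by apply: (fD y _ (Z y)).1; [rewrite yq|exact: ZD].
  exact: (is_derive_unique D1 (is_derive_ext oOO OOx f0 (is_derive_cst (0 : R) (ref x) (Z' x)))).
apply: (fD x Ox _).2; rewrite /lie_bracket.
have -> : forall v w : vec, v - w = (-1) *: w + v by move=> v w; rewrite scaleN1r addrC.
rewrite derive_linear; last exact: df.
rewrite (key Y X) // (key X Y) // (derive_comm (X x) (Y x) oOO OOx (SfO 2)).
by rewrite scalerN scaleN1r opprK subrr.
Qed.

(** [D] is the kernel of the covector [al], the cross product of a local frame. Where [al z] is
    nonzero, [D] is spanned by [e_x + a e_z] and [e_y + b e_z]; their bracket is a multiple of
    [e_z], so it lies in [D] only if it vanishes, as [frobenius] requires. *)
Lemma involutive_first_integral D : distribution2 D -> involutive_distribution D ->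
  forall x0, first_integral_at D x0.
Proof.
move=> [dimD locD] invD x0.
have [U [X [Y [oU Ux0 SX SY DU]]]] := locD x0.
pose OU := @ref R B @` U; have oOU : open OU by exact: open_ref.
pose Xr := local_rep U (@ref R B) X; pose Yr := local_rep U (@ref R B) Y.
pose al i q := cross (Xr q) (Yr q) 0 i.
have crossE x : U x -> cross (X x) (Y x) = \row_i al i (ref x).
  by move=> Ux; rewrite /al /Xr /Yr !ref_rep //; apply/rowP => i; rewrite [RHS]mxE.
have memD x w : U x -> (w \in D x) = (\sum_i al i (ref x) * w 0 i == 0).
  move=> Ux; have d2 := dimD x; rewrite (DU x Ux) in d2 *.
  have [_ ->] := cross_span d2; rewrite crossE // /dot.
  by congr (_ == 0); apply: eq_bigr => i _; rewrite mxE.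
have Sal i : smooth_on OU (al i).
  have SXi j := (smooth_rowP _ oOU).1 SX j; have SYi j := (smooth_rowP _ oOU).1 SY j.
  move=> k; apply: (Ck_ext oOU (f:=fun q => Xr q 0 (i + 1) * Yr q 0 (i + 1 + 1) - Xr q 0
      (i + 1 + 1) * Yr q 0 (i + 1))).
    by move=> q _; rewrite /al mxE.
  exact: (Ck_sub oOU (Ck_mul oOU (SXi _ k) (SYi _ k)) (Ck_mul oOU (SXi _ k) (SYi _ k))).
have [z alz] : exists z, al z (ref x0) != 0.
  have c0 : cross (X x0) (Y x0) != 0.
    by have d2 := dimD x0; rewrite DU // in d2; have [] := cross_span d2.
  apply/existsP; apply: contraNT c0 => /existsPn H; rewrite crossE //.
  by apply/eqP/rowP => i; rewrite !mxE; apply/eqP; have /negPn := H i.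
pose O1 := OU `&` al z @^-1` [set t | t != 0].
have oO1 : open O1.
  by apply: (smooth_open_preimage oOU (Sal z)); exact: open_neq.
have O1x0 : O1 (ref x0) by split => //; exists x0.
have [xz yz xy zz] := ord3_succ z.
pose x := z + 1; pose y := z + 1 + 1.
pose a q := - al x q / al z q; pose b q := - al y q / al z q.
have Squot i : smooth_on O1 (fun q => - al i q / al z q).
  have S j k : Ck k O1 (al j) by apply: Ck_subset (Sal j k) => q [].
  move=> k; apply: (Ck_mul oO1 (Ck_opp oO1 (S i k))).
  by apply: Ck_inv => // q [].
have Sa : smooth_on O1 a by exact: Squot.
have Sb : smooth_on O1 b by exact: Squot.
pose U1 := U `&` @ref R B @^-1` O1.
have oU1 : open U1 by apply: openI => //; exact: open_ref_preimage.
have imU1 : @ref R B @` U1 = O1 by apply: ref_image_preimage => q [].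
pose FX q := upd 'e_x z (a q); pose FY q := upd 'e_y z (b q).
have SF (i : 'I_3) (g : vec -> R) : smooth_on O1 g -> smooth_on O1 (fun q => upd 'e_i z (g q)).
  by move=> Sg; apply: smooth_upd => // k; exact: Ck_cst.
have secX i (g : vec -> R) : i = x \/ i = y -> smooth_on O1 g ->
    (forall q, O1 q -> g q = - al i q / al z q) ->
    section_on U1 D (fun p => upd 'e_i z (g (ref p))).
  move=> ixy Sg gE; split.
    rewrite /smooth_on_body imU1; apply: smooth_ext (SF i g Sg) => // q.
    rewrite -imU1 => Oq.
    exact: (ref_rep_ext (F:=fun q => upd 'e_i z (g q)) (fun _ _ => erefl) Oq).
  move=> p [Up Op]; rewrite memD // (sum3 _ z) upd_at gE //.
  have az0 : al z (ref p) != 0 by case: Op.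
  have V k l : k != z -> upd 'e_l z (- al i (ref p) / al z (ref p)) 0 k = 'e_l 0 k.
    by move=> kz; rewrite upd_ne.
  rewrite !V //; case: ixy => ->.
    by rewrite delta_at delta_ne //; apply/eqP; field.
  by rewrite delta_at delta_ne 1?eq_sym //; apply/eqP; field.
have ab q : O1 q -> 'D_(FX q) b q = 'D_(FY q) a q.
  move=> Oq; have : (@ref R B @` U1) q by rewrite imU1.
  move=> [p U1p pq]; have [Up _] := U1p.
  have sX := secX x a (or_introl erefl) Sa (fun _ _ => erefl).
  have sY := secX y b (or_intror erefl) Sb (fun _ _ => erefl).
  have := invD U1 _ _ oU1 sX sY p U1p; rewrite /lie_bracket.
  have repD i (g : vec -> R) v : smooth_on O1 g ->
      'D_v (local_rep U1 (@ref R B) (fun p => upd 'e_i z (g (ref p)))) (ref p) = upd 0 z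
          ('D_v g q).
    move=> Sg; have D1 := is_derive_upd_fun z (is_derive_cst 'e_i q v) (smooth_is_derive v Sg Oq).
    have D2 : is_derive q v (local_rep U1 (@ref R B) (fun p => upd 'e_i z (g (ref p))))
        (upd 0 z ('D_v g q)).
      by apply: (is_derive_ext oO1 Oq _ D1) => q' Oq'; apply:
          (ref_rep_ext (F:=fun q => upd 'e_i z (g q)) (fun _ _ => erefl)); rewrite imU1.
    by rewrite pq; case: D2.
  rewrite (repD y b) // (repD x a) // pq memD // (sum3 _ z) pq.
  have Vz (s t : R) : (upd (0 : vec) z s - upd 0 z t) 0 z = s - t.
    by rewrite !mxE eqxx.
  have V k (s t : R) : k != z -> (upd (0 : vec) z s - upd 0 z t) 0 k = 0.
    by move=> /negbTE kz; rewrite !mxE kz subrr.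
  rewrite Vz !V // !mulr0 !addr0 mulf_eq0.
  have -> : (al z q == 0) = false by apply/negbTE; case: Oq.
  by rewrite subr_eq0 => /eqP.
have [ O [f [oO Ox0 OO1 Sf fP]]] := frobenius xz yz xy oO1 O1x0 Sa Sb ab.
exists O, f; split => //; first by move=> q /OO1 [[p _ <-] _]; exists p.
move=> p Op v; have O1p := OO1 _ Op; have [[p' Up' p'p] az0] := O1p.
have Up : U p by rewrite -(ref_inj p'p).
rewrite memD // (sum3 _ z) -/x -/y.
have [f1 f2 f3] := fP _ Op.
have dfp : differentiable f (ref p) by exact: smooth_differentiable Sf Op.
(* The component of [v] along [e_z] modulo the plane. On [v] the covector [al] is [al z * t] and the
   differential of [f] is [t] times its value on [e_z], so both vanish together. *)
pose t := v 0 z - a (ref p) * v 0 x - b (ref p) * v 0 y.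
have vE : v = v 0 x *: FX (ref p) + (v 0 y *: FY (ref p) + (t *: 'e_z + 0)).
  have comb (u w e : vec) (r s k' : R) k : (r *: u + (s *: w + k' *: e)) 0 k = r * u 0 k +
      (s * w 0 k + k' * e 0 k).
    by rewrite !mxE.
  rewrite addr0; apply/rowP => k; rewrite comb.
  have [->|[->|->]] := ord3_cases z k.
  - by rewrite /FX /FY !upd_at delta_at /t; ring.
  - by rewrite /FX /FY !upd_ne // delta_at !delta_ne 1?eq_sym // /x; ring.
  - by rewrite /FX /FY !upd_ne // delta_at !delta_ne 1?eq_sym // /y; [ring|rewrite eq_sym].
have -> : 'D_v f (ref p) = t * 'D_('e_z) f (ref p).
  by rewrite {1}vE !derive_linear // derive0 f1 f2 !scaler0 !add0r addr0.
have -> : al z (ref p) * v 0 z + al x (ref p) * v 0 x + al y (ref p) * v 0 y = al z (ref p) * t.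
  by rewrite /t /a /b; field.
have {}az0 : al z (ref p) != 0 by exact: az0.
split=> [|/eqP]; first by rewrite mulf_eq0 (negbTE az0) /= => /eqP ->; rewrite mul0r.
by rewrite !mulf_eq0 (negbTE f3) orbF => ->; rewrite orbT.
Qed.
End FirstIntegral.

(** * Adapted coordinates *)

Section Exchange.
Context {R : realType} {n : nat}.
Local Notation V := ('rV[R]_n).
Local Notation "''e_' i" := (delta_mx 0 i : V) (at level 8, i at level 2).
Implicit Types (O N : set V) (F G : V -> V).

Lemma derive_rowV (W : normedModType R) (f : V -> W) p v : differentiable f p ->
  'D_v f p = \sum_i v 0 i *: 'D_('e_i) f p.
Proof.
move=> D; rewrite deriveE // {1}(row_sum_delta v) linear_sum.
by apply: eq_bigr => i _; rewrite linearZ /= deriveE.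
Qed.

Lemma diffeo_ext O O' F F1 G : (forall x, O x -> F x = F1 x) ->
  diffeo O O' F G -> diffeo O O' F1 G.
Proof.
move=> E [oO oO' sF sG [FO GO GF FG]]; split => //.
  by move=> k; exact: Ck_ext oO E (sF k).
split => // [x Ox|x Ox|y Oy].
- by rewrite -E //; exact: FO.
- by rewrite -E //; exact: GF.
- by rewrite -E ?FG //; exact: GO.
Qed.

Lemma diffeo_sym O O' F G : diffeo O O' F G -> diffeo O' O G F.
Proof. by move=> [? ? ? ? []]. Qed.

Lemma diffeo_dual O O' F G q v : diffeo O O' F G -> O q -> 'D_('D_v F q) G (F q) = v.
Proof.
move=> [oO oO' sF sG [FO GO GF FG]] Oq.
have D1 := is_derive_chain (smooth_is_derive v sF Oq) (smooth_differentiable sG (FO _ Oq)).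
apply: (is_derive_unique D1).
by apply: (is_derive_ext oO Oq _ (is_derive_id q v)) => x Ox; rewrite /= GF.
Qed.

Lemma diffeo_codual O O' F G q v : diffeo O O' F G -> O q -> 'D_('D_v G (F q)) F q = v.
Proof.
move=> D Oq; have D' := diffeo_sym D; have [_ _ _ _ [FO _ GF _]] := D.
by have := diffeo_dual v D' (FO _ Oq); rewrite GF.
Qed.

(** In the coordinates [F] the function [h] is [h \o G], whose [m]-th partial is the derivative of
    [h] along the [m]-th coordinate vector. A coordinate can thus be replaced by any function not
    stationary along its vector. *)
Lemma exchange O O' F G c N (h : V -> R) m : diffeo O O' F G -> O c ->
  open N -> N c -> smooth_on N h -> 'D_('D_('e_m) G (F c)) h c != 0 ->
  exists P P' G1, [/\ P c, P `<=` O `&` N & diffeo P P' (fun q => upd (F q) m (h q)) G1].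
Proof.
move=> D Oc oN Nc Sh hc; have [oO oO' sF sG [FO GO GF FG]] := D.
have oS0 : open (O' `&` G @^-1` N).
  exact: smooth_open_preimage oO' sG oN.
have Gc : G (F c) = c by exact: GF.
have S0c : (O' `&` G @^-1` N) (F c) by split; [exact: FO|rewrite /preimage /= Gc].
have Sk : smooth_on (O' `&` G @^-1` N) (fun y => h (G y)).
  apply: (smooth_comp (U:=N)) => // [y []//|].
  by apply: smooth_subset sG => y [].
have kc : 'D_('e_m) (fun y => h (G y)) (F c) != 0.
  have dh : differentiable h (G (F c)) by rewrite Gc; exact: smooth_differentiable Sh Nc.
  have [_ E] := is_derive_chain (smooth_is_derive 'e_m sG (FO _ Oc)) dh.
  by rewrite Gc in E; rewrite [X in X != 0]E.
have [S [S' [K [Sc SO DK]]]] := slot_diffeo oS0 S0c Sk kc.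
exists (O `&` F @^-1` S), (S' `&` K @^-1` O'), (G \o K); split.
- by split.
- by move=> q [Oq /SO [_]]; rewrite /preimage /= GF.
- apply: diffeo_ext (diffeo_comp D DK) => q [Oq _].
  by rewrite /= GF.
Qed.
End Exchange.

(** * Alternating trilinear forms *)

Section Alternating.
Context {R : realType}.
Local Notation vec := ('rV[R]_3).
Local Notation "''e_' i" := (delta_mx 0 i : vec) (at level 8, i at level 2).
Variable w : vec -> vec -> vec -> R.
Hypothesis wA : alternating_trilinear w.

Lemma scalar_row (n : nat) (phi : 'rV[R]_n -> R) v : scalar phi ->
  phi v = \sum_i v 0 i * phi (delta_mx 0 i).
Proof.
move=> H; pose Lphi := GRing.isLinear.Build R 'rV[R]_n R *%R phi H.
pose phi' : {scalar 'rV[R]_n} := HB.pack phi Lphi.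
rewrite -[LHS]/(phi' v) {1}(row_sum_delta v) linear_sum.
by apply: eq_bigr => i _; rewrite linearZ.
Qed.

Lemma alt_lin1 a u v b c : w (a *: u + v) b c = a * w u b c + w v b c.
Proof. by case: wA => H _ _ _; exact: H. Qed.
Lemma alt_lin2 a u v b c : w b (a *: u + v) c = a * w b u c + w b v c.
Proof. by case: wA => _ H _ _; exact: H. Qed.
Lemma alt_lin3 a u v b c : w b c (a *: u + v) = a * w b c u + w b c v.
Proof. by case: wA => _ _ H _; exact: H. Qed.

Lemma alt_swap12 u v c : w u v c = - w v u c.
Proof.
case: wA => _ _ _ Z; have [H _ _] := Z (1 *: u + v) c.
have [H1 _ _] := Z u c; have [H2 _ _] := Z v c.
by move: H; rewrite alt_lin1 !alt_lin2 H1 H2; lra.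
Qed.

Lemma alt_swap23 u v c : w c u v = - w c v u.
Proof.
case: wA => _ _ _ Z; have [_ _ H] := Z (1 *: u + v) c.
have [_ _ H1] := Z u c; have [_ _ H2] := Z v c.
by move: H; rewrite alt_lin2 !alt_lin3 H1 H2; lra.
Qed.

(** This is how a frame changes when its middle coordinate is replaced: [b] is rescaled and
    multiples of it are added to the others. *)
Lemma alt_shear a b c (h r k : R) : w (h *: b + a) (r *: b + 0) (k *: b + c) = r * w a b c.
Proof.
case: wA => _ _ _ Z.
have Z1 u v : w u u v = 0 by case: (Z u v).
have Z3 u v : w v u u = 0 by case: (Z u v).
have Z0 u v : w u 0 v = 0.
  by have := alt_lin2 (-1) 0 0 u v; rewrite scaler0 addr0 mulN1r addNr.
by rewrite alt_lin2 Z0 addr0 alt_lin1 Z1 mulr0 add0r alt_lin3 Z3 mulr0 add0r.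
Qed.

Lemma alt_expand a b c : w a b c = \sum_i \sum_j \sum_k a 0 i *
    (b 0 j * (c 0 k * w 'e_i 'e_j 'e_k)).
Proof.
case: wA => L1 L2 L3 _.
rewrite (@scalar_row _ (fun v => w v b c) a (L1 b c)); apply: eq_bigr => i _.
rewrite (@scalar_row _ (fun v => w 'e_i v c) b (L2 _ c)) mulr_sumr; apply: eq_bigr => j _.
rewrite (@scalar_row _ (fun v => w 'e_i 'e_j v) c (L3 _ _)) !mulr_sumr; apply: eq_bigr => k _.
by [].
Qed.

Lemma ord3 (l : 'I_3) : l = 0 \/ l = 1 \/ l = 2.
Proof.
suff : [|| l == 0, l == 1 | l == 2].
  by case/or3P => /eqP; [left|right; left|right; right].
by case: l => [[|[|[|]]]].
Qed.

Lemma alt_eq0 (W : 'I_3 -> vec) : w (W 0) (W 1) (W 2) = 0 ->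
  forall i j k, w (W i) (W j) (W k) = 0.
Proof.
move=> H012.
have H102 : w (W 1) (W 0) (W 2) = 0 by rewrite alt_swap12 H012 oppr0.
have H021 : w (W 0) (W 2) (W 1) = 0 by rewrite alt_swap23 H012 oppr0.
have H120 : w (W 1) (W 2) (W 0) = 0 by rewrite alt_swap23 H102 oppr0.
have H201 : w (W 2) (W 0) (W 1) = 0 by rewrite alt_swap12 H021 oppr0.
have H210 : w (W 2) (W 1) (W 0) = 0 by rewrite alt_swap12 H120 oppr0.
case: wA => _ _ _ Z.
have Z1 u v : w u u v = 0 by case: (Z u v).
have Z2 u v : w u v u = 0 by case: (Z u v).
have Z3 u v : w v u u = 0 by case: (Z u v).
by move=> i j k; case: (ord3 i) => [->|[->|->]]; case: (ord3 j) => [->|[->|->]]; case: (ord3 k)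
    => [->|[->|->]].
Qed.
End Alternating.

(** * Coordinates adapted to two functions and a volume form *)

Section AdaptedChart.
Context {R : realType}.
Local Notation vec := ('rV[R]_3).
Local Notation "''e_' i" := (delta_mx 0 i : vec) (at level 8, i at level 2).
Implicit Types (O P : set vec) (F G : vec -> vec).

Lemma is_derive_mulmx m n (M : 'M[R]_(m, n)) (p v : 'rV[R]_m) :
  is_derive p v (fun q => q *m M) (v *m M).
Proof.
apply: is_derive_row => i.
have -> : (fun q : 'rV[R]_m => (q *m M) 0 i) = fun q => \sum_k q 0 k * M k i.
  by apply/funext => q; rewrite mxE.
rewrite mxE; apply: is_derive_bigsum => k.
apply: (is_derive_eq (is_deriveM (is_derive_coord k (is_derive_id p v))
    (is_derive_cst (M k i) p v))).
by rewrite scaler0 add0r /GRing.scale /= mulrC.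
Qed.

Lemma smooth_mulmx m n (M : 'M[R]_(m, n)) : smooth_on setT (fun q : 'rV[R]_m => q *m M).
Proof.
have oT : open (setT : set 'rV[R]_m) by exact: openT.
move=> k; apply/(Ck_rowP k _ oT) => i.
have H : Ck k setT (fun q : 'rV[R]_m => \sum_l q 0 l * M l i).
  by apply: Ck_sum => // l; apply: (Ck_mul oT (Ck_coord k l oT) (Ck_cst k setT (M l i))).
by apply: (Ck_ext oT _ H) => q _; rewrite mxE.
Qed.

Lemma diffeo_mulmx n (A : 'M[R]_n) : A \in unitmx ->
  diffeo setT setT (fun q : 'rV[R]_n => q *m invmx A) (fun y => y *m A).
Proof.
move=> uA; split; [exact: openT|exact: openT|exact: smooth_mulmx|exact: smooth_mulmx|].
by split => // x _; rewrite ?mulmxKV ?mulmxK.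
Qed.

Lemma alt_pullback (w : vec -> vec -> vec -> R) G y : alternating_trilinear w ->
  differentiable G y -> alternating_trilinear (fun a b c => w ('D_a G y) ('D_b G y) ('D_c G y)).
Proof.
move=> wA dG; split.
- by move=> b c a u v; rewrite derive_linear // (alt_lin1 wA).
- by move=> b c a u v; rewrite derive_linear // (alt_lin2 wA).
- by move=> b c a u v; rewrite derive_linear // (alt_lin3 wA).
- by move=> u v; case: wA => _ _ _ Z; exact: Z.
Qed.

(** Every vector is a derivative of [G] in some direction, and an alternating form that vanishes on
    the standard basis vanishes on all triples. *)
Lemma alt_frame_neq0 (w : vec -> vec -> vec -> R) P P' F G q : alternating_trilinear w ->
  diffeo P P' F G -> P q -> (exists v1 v2 v3, w v1 v2 v3 != 0) ->
  w ('D_('e_0) G (F q)) ('D_('e_1) G (F q)) ('D_('e_2) G (F q)) != 0.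
Proof.
move=> wA D Pq [v1 [v2 [v3]]]; apply: contraNneq => w0.
have [oP oP' sF sG [FP _ _ _]] := D.
have A := alt_pullback wA (smooth_differentiable sG (FP _ Pq)).
rewrite -(diffeo_dual v1 D Pq) -(diffeo_dual v2 D Pq) -(diffeo_dual v3 D Pq).
rewrite [X in X == 0](alt_expand A) big1 // => i _; rewrite big1 // => j _; rewrite big1 // =>
    k _.
by rewrite (@alt_eq0 _ _ A (fun l => 'e_l) w0) !mulr0.
Qed.

(** The rows of [A] are the coordinate vectors of a linear chart. The last is transverse to the
    kernel of [df] at [c], so the last coordinate can be exchanged for [f]; the first lies in this
    kernel and is transverse to that of [dg], so the first can then be exchanged for [g]. The middle
    coordinate absorbs the density. *)
Lemma adapted_chart O c (f g : vec -> R) (w : vec -> vec -> vec -> vec -> R) (A : 'M[R]_3) :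
  open O -> O c -> smooth_on O f -> smooth_on O g ->
  (forall q, O q -> alternating_trilinear (w q)) ->
  (forall v1 v2 v3, smooth_on O (fun q => w q v1 v2 v3 : R)) ->
  (forall q, O q -> exists v1 v2 v3, w q v1 v2 v3 != 0) ->
  A \in unitmx -> 'D_(row 0 A) f c = 0 -> 'D_(row 2 A) f c != 0 -> 'D_(row 0 A) g c != 0 ->
  exists P P' F G, [/\ P c, P `<=` O, diffeo P P' F G &
    forall q, P q -> [/\ F q 0 0 = g q, F q 0 2 = f q &
      w q ('D_('e_0) G (F q)) ('D_('e_1) G (F q)) ('D_('e_2) G (F q)) = 1]].
Proof.
move=> oO Oc Sf Sg wA Sw wn0 uA f0 f2 g0.
have D0 := diffeo_mulmx uA.
have DA y i : 'D_('e_i) (fun y : vec => y *m A) y = row i A.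
  by have [_ ->] := is_derive_mulmx A y 'e_i; rewrite rowE.
have c1 : 'D_('D_('e_2) (fun y : vec => y *m A) (c *m invmx A)) f c != 0 by rewrite DA.
have [P1 [P1' [G1 [P1c P1O D1]]]] := exchange D0 I oO Oc Sf c1.
have df : differentiable f c by exact: smooth_differentiable Sf Oc.
pose F1 (q : vec) := upd (q *m invmx A) 2 (f q).
(* After [f] has become the last coordinate, the first coordinate vector at [c]
   is still the first row of [A]. *)
have c2 : 'D_('D_('e_0) G1 (F1 c)) g c != 0.
  set v := 'D_('e_0) _ _.
  have E0 : 'D_v F1 c = 'e_0 by exact: (diffeo_codual _ D1 P1c).
  have E1 : is_derive c v F1 (upd (v *m invmx A) 2 ('D_v f c)).
    exact: (is_derive_upd_fun 2 (is_derive_mulmx (invmx A) c v) (smooth_is_derive v Sf Oc)).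
  have E : upd (v *m invmx A) 2 ('D_v f c) = 'e_0 by rewrite -E0; case: E1.
  have vf : 'D_v f c = 0 by have := congr1 (fun x : vec => x 0 2) E; rewrite upd_at mxE.
  pose t := (v *m invmx A) 0 2.
  have vE : v *m invmx A = t *: 'e_2 + 'e_0.
    have comb (u x : vec) s k : (s *: u + x) 0 k = s * u 0 k + x 0 k by rewrite !mxE.
    rewrite -E; apply/rowP => k; rewrite comb; have [->|k2] := eqVneq k 2.
      by rewrite delta_at upd_at vf mulr1 addr0.
    by rewrite delta_ne 1?eq_sym // mulr0 add0r upd_ne.
  have vE' : v = t *: row 2 A + row 0 A.
    by rewrite -[LHS](mulmxKV uA) vE mulmxDl -scalemxAl -!rowE.
  move: vf; rewrite vE' (derive_linear t (row 2 A) (row 0 A) df) f0 addr0 => /eqP.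
  by rewrite scaler_eq0 (negbTE f2) orbF => /eqP ->; rewrite scale0r add0r.
have [P2 [P2' [G2 [P2c P2O D2]]]] := exchange D1 P1c oO Oc Sg c2.
pose F2 (q : vec) := upd (F1 q) 0 (g q).
have [oP2 oP2' sF2 sG2 [FP2 GP2 GF2 FG2]] := D2.
have P2Oq q : P2 q -> O q by move=> /P2O [].
pose W2 i y := 'D_('e_i) G2 y.
(* Density of the form in the coordinates [F2]; the primitive [H] is taken along the middle one. *)
pose rho y := w (G2 y) (W2 0 y) (W2 1 y) (W2 2 y).
have Srho : smooth_on P2' rho.
  have SW i j : smooth_on P2' (fun y => W2 i y 0 j : R).
    by apply: (smooth_rowP _ oP2').1; exact: smooth_derive.
  have Swe i j k : smooth_on P2' (fun y => w (G2 y) 'e_i 'e_j 'e_k : R).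
    apply: (smooth_comp (f:=fun q => w q 'e_i 'e_j 'e_k : R) oP2' _ sG2 (Sw _ _ _)).
    by move=> y /GP2 /P2Oq.
  move=> m; apply: (Ck_ext oP2' (f:=fun y => \sum_i \sum_j \sum_k
      W2 0 y 0 i * (W2 1 y 0 j * (W2 2 y 0 k * w (G2 y) 'e_i 'e_j 'e_k)))).
    by move=> y Py; rewrite /rho (alt_expand (wA _ (P2Oq _ (GP2 _ Py)))).
  apply: Ck_sum => // i; apply: Ck_sum => // j; apply: Ck_sum => // k.
  exact: (Ck_mul oP2' (SW 0 i m) (Ck_mul oP2' (SW 1 j m) (Ck_mul oP2' (SW 2 k m) (Swe i j k m)))).
have rho0 q : P2 q -> rho (F2 q) != 0.
  move=> Pq; rewrite /rho GF2 //.
  exact: (alt_frame_neq0 (wA _ (P2Oq _ Pq)) D2 Pq (wn0 _ (P2Oq _ Pq))).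
have [r r0 rP] := nbhs_box (open_nbhs_nbhs (conj oP2' (FP2 _ P2c))).
have Srho' : smooth_on (box (F2 c) r) rho by exact: smooth_subset Srho.
have [H HD H0] := param_primitive_exists 1 r0 (Srho' 0%N).
have SH : smooth_on (box (F2 c) r) H by move=> k; exact: Ck_param_primitive HD H0 (Srho' k).
pose N := P2 `&` F2 @^-1` (box (F2 c) r).
have oN : open N.
  by apply: (smooth_open_preimage oP2 sF2); exact: open_box.
have Nc : N c by split => //; exact: box_center.
have Sh : smooth_on N (fun q => H (F2 q)).
  apply: (smooth_comp (U:=box (F2 c) r)) => // [q []//|].
  by apply: smooth_subset sF2 => q [].
have DhE q i : N q -> is_derive q (W2 i (F2 q)) (fun q => H (F2 q)) ('D_('e_i) H (F2 q)).
  move=> [Pq Bq].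
  have := is_derive_chain (smooth_is_derive (W2 i (F2 q)) sF2 Pq) (smooth_differentiable SH Bq).
  by rewrite (diffeo_codual 'e_i D2 Pq).
have H1 q : N q -> 'D_('e_1) H (F2 q) = rho (F2 q).
  by move=> [_ Bq]; case: (HD _ Bq).
have c3 : 'D_('D_('e_1) G2 (F2 c)) (fun q => H (F2 q)) c != 0.
  by have [_ ->] := DhE c 1 Nc; rewrite H1 //; exact: rho0.
have [P3 [P3' [G3 [P3c P3N D3]]]] := exchange D2 P2c oN Nc Sh c3.
exists P3, P3', (fun q => upd (F2 q) 1 (H (F2 q))), G3; split => //.
  by move=> q /P3N [/P2Oq].
move=> q Pq; have [P2q Nq] := P3N _ Pq; have Oq := P2Oq _ P2q.
have ne (a b : 'I_3) : val a != val b -> a != b by [].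
split.
- by rewrite upd_ne // upd_at.
- by rewrite upd_ne // upd_ne // upd_at.
pose F3 (q : vec) := upd (F2 q) 1 (H (F2 q)).
pose W3 i := 'D_('e_i) G3 (F3 q).
have [_ _ _ sG3 [FP3 _ _ _]] := D3.
have dG3 : differentiable G3 (F3 q) by exact: smooth_differentiable sG3 (FP3 _ Pq).
(* The new chart differs from [F2] in the middle slot only. So in the new frame the old vector keeps
   its components, except the middle one, which becomes the [i]-th partial of [H]; for [i = 1] this
   is [rho]. *)
have W23 i : W2 i (F2 q) = 'D_(upd 'e_i 1 ('D_('e_i) H (F2 q))) G3 (F3 q).
  rewrite -[LHS](diffeo_dual _ D3 Pq); congr ('D_ _ G3 _).
  have D := is_derive_upd_fun 1 (smooth_is_derive (W2 i (F2 q)) sF2 P2q) (DhE q i Nq).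
  by rewrite (diffeo_codual 'e_i D2 P2q) in D; case: D.
have W20 i : i != 1 -> W2 i (F2 q) = 'D_('e_i) H (F2 q) *: W3 1 + W3 i.
  by move=> i1; rewrite W23 upd_delta // addrC derive_linear.
have W21 : W2 1 (F2 q) = rho (F2 q) *: W3 1 + 0.
  rewrite W23 H1 // addr0 (_ : upd _ _ _ = rho (F2 q) *: 'e_1 + 0).
    by rewrite (derive_linear (rho (F2 q)) 'e_1 0 dG3) derive0 addr0.
  by rewrite addr0; apply/rowP => k; rewrite !mxE; case: (k == 1); rewrite ?mulr1 ?mulr0.
have wAq := wA q Oq.
have E : rho (F2 q) = rho (F2 q) * w q (W3 0) (W3 1) (W3 2).
  rewrite {1}/rho GF2 // (W20 0) // (W20 2) // W21.
  exact: (alt_shear wAq).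
by apply: (mulfI (rho0 _ P2q)); rewrite mulr1 [RHS]E.
Qed.
End AdaptedChart.

(** * Coordinate frames and the planes they span *)

Section FrameSpan.
Context {R : realType}.
Local Notation vec := ('rV[R]_3).
Local Notation "''e_' i" := (delta_mx 0 i : vec) (at level 8, i at level 2).

Lemma frame_expand (O O' : set vec) F G q v : diffeo O O' F G -> O q ->
  v = \sum_l 'D_v F q 0 l *: 'D_('e_l) G (F q).
Proof.
move=> D Oq; have [_ _ _ sG [FO _ _ _]] := D.
rewrite -{1}(diffeo_dual v D Oq) derive_rowV //.
exact: smooth_differentiable sG (FO _ Oq).
Qed.

Lemma frame_span (O O' : set vec) F G q v (i j k : 'I_3) : diffeo O O' F G -> O q ->
  k != i -> k != j -> (forall l, l = i \/ l = j \/ l = k) ->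
  v \in <<[:: 'D_('e_i) G (F q); 'D_('e_j) G (F q)]>>%VS <-> 'D_v F q 0 k = 0.
Proof.
move=> D Oq ki kj ijk; have [_ _ sF _ _] := D.
have dF : differentiable F q by exact: smooth_differentiable sF Oq.
rewrite span_cons span_seq1; split=> [/memv_addP[_ /vlineP[a ->] [_ /vlineP[b ->] ->]]|vk].
  rewrite -[b *: _]addr0 (derive_linear a _ _ dF) (derive_linear b _ 0 dF) derive0
    (diffeo_codual 'e_i D Oq) (diffeo_codual 'e_j D Oq).
  by rewrite addr0 !mxE (negbTE ki) (negbTE kj) !andbF !mulr0 addr0.
rewrite (frame_expand v D Oq); apply: memv_suml => l _.
have [->|[->|->]] := ijk l.
- by rewrite memvE; apply: subv_trans (addvSl _ _); rewrite -memvE memvZ ?memv_line.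
- by rewrite memvE; apply: subv_trans (addvSr _ _); rewrite -memvE memvZ ?memv_line.
- by rewrite vk scale0r mem0v.
Qed.

Lemma frame_basis (O O' : set vec) F G q : diffeo O O' F G -> O q ->
  basis_of fullv [:: 'D_('e_0) G (F q); 'D_('e_1) G (F q); 'D_('e_2) G (F q)].
Proof.
move=> D Oq; rewrite basisEdim dimvf andbT; apply/subvP => v _.
rewrite (frame_expand v D Oq); apply: memv_suml => l _.
apply: memvZ; apply: memv_span; rewrite !inE.
by have [->|[->|->]] := ord3 l; apply/or3P;
  [apply: Or31|apply: Or32|apply: Or33]; exact: eqxx.
Qed.

(** Distinct planes do not contain one another, and in dimension 3 they share a nonzero vector
    because [2 + 2 > 3]. *)
Lemma planes_adapted_basis (D1 D2 : {vspace vec}) : \dim D1 = 2%N -> \dim D2 = 2%N -> D1 != D2 ->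
  exists u0 u1 u2, [/\ (u0 \in D1) && (u0 \notin D2), [&& u1 \in D1, u1 \in D2 & u1 != 0] &
    (u2 \in D2) && (u2 \notin D1)].
Proof.
move=> d1 d2 D12.
have H (E1 E2 : {vspace vec}) : \dim E1 = 2%N -> \dim E2 = 2%N -> E1 != E2 ->
    exists u, (u \in E1) && (u \notin E2).
  move=> e1 e2; rewrite eqEdim e1 e2 leqnn andbT => /subvPn [u uE1 uE2].
  by exists u; rewrite uE1.
have [u0 u0P] := H _ _ d1 d2 D12.
have [u2 u2P] : exists u, (u \in D2) && (u \notin D1) by apply: H => //; rewrite eq_sym.
have cap0 : (D1 :&: D2)%VS != 0%VS.
  rewrite -dimv_eq0; have := dimv_sum_cap D1 D2; rewrite d1 d2.
  have := dimvS (subvf (D1 + D2)%VS); rewrite dimvf /dim /=.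
  by move=> le3 E; apply/eqP => c0; move: E le3; rewrite c0 addn0 => ->.
exists u0, (vpick (D1 :&: D2)%VS), u2; split => //.
have := memv_pick (D1 :&: D2)%VS; rewrite memv_cap => /andP[-> ->] /=.
by rewrite vpick0.
Qed.
End FrameSpan.

(** * Charts of the body and the equivalence *)

Section MainDirections.
Context {R : realType} {B : body R}.
Local Notation vec := ('rV[R]_3).
Local Notation "''e_' i" := (delta_mx 0 i : vec) (at level 8, i at level 2).

Lemma coords_diffeo (U : set B) psi : local_coords U psi ->
  diffeo (@ref R B @` U) (psi @` U) (local_rep U (@ref R B) psi) (local_rep U psi (@ref R B)).
Proof.
move=> [oU inj opsi S1 S2]; split => //; first exact: open_ref.
split=> [_ [x Ux <-]|_ [x Ux <-]|_ [x Ux <-]|_ [x Ux <-]].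
- by rewrite ref_rep //; exists x.
- by rewrite local_repE //; exists x.
- by rewrite ref_rep // local_repE.
- by rewrite local_repE // ref_rep.
Qed.

(** The remaining coordinate [k] is the first integral. *)
Lemma coord_span_first_integral (D : B -> {vspace vec}) (i j k : 'I_3) :
  k != i -> k != j -> (forall l, l = i \/ l = j \/ l = k) ->
  (forall x0, exists U psi, [/\ local_coords U psi, U x0 &
     forall x, U x -> <<[:: coord_frame U psi x i; coord_frame U psi x j]>>%VS = D x]) ->
  forall x0, first_integral_at D x0.
Proof.
move=> ki kj ijk H x0; have [U [psi [C Ux0 DU]]] := H x0.
have Df := coords_diffeo C; have [oO _ sF _ _] := Df.
exists (@ref R B @` U), (fun q => local_rep U (@ref R B) psi q 0 k); split.
- exact: oO.
- by exists x0.
- by move=> _ [x _ <-]; exists x.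
- exact: (smooth_rowP _ oO).1.
- move=> x Ox v; have [y Uy /ref_inj yx] := Ox; rewrite yx in Uy.
  have := frame_span v Df Ox ki kj ijk; rewrite ref_rep // DU // => ->.
  by have [_ ->] := is_derive_coord k (smooth_is_derive v sF Ox).
Qed.

Lemma integrable_chart (O O' : set vec) (F G : vec -> vec) (x0 : B) : diffeo O O' F G -> O
    (ref x0) ->
  O `<=` @ref R B @` setT ->
  exists U psi, [/\ local_coords U psi, U x0 & forall x, U x -> O (ref x) /\
    forall i, coord_frame U psi x i = 'D_('e_i) G (F (ref x))].
Proof.
move=> [oO oO' sF sG [FO GO GF FG]] Ox0 OB.
pose U := @ref R B @^-1` O; pose psi (x : B) := F (ref x).
have imU : @ref R B @` U = O.
  apply/seteqP; split=> [_ [x Ux <-] //|q Oq].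
  by have [x _ xq] := OB _ Oq; exists x => //; rewrite /U /preimage /= xq.
have impsi : psi @` U = O'.
  apply/seteqP; split=> [_ [x Ux <-]|y Oy]; first exact: FO.
  have [x _ xq] := OB _ (GO _ Oy).
  by exists x; rewrite /U /preimage /psi /= xq ?FG //; exact: GO.
have inj : {in U &, injective psi}.
  move=> x y; rewrite !inE => Ux Uy; rewrite /psi => E.
  by apply: ref_inj; rewrite -(GF _ Ux) -(GF _ Uy) E.
have GE y : O' y -> G y = local_rep U psi (@ref R B) y.
  by rewrite -impsi => -[x Ux <-]; rewrite local_repE // GF.
exists U, psi; split => //.
- split => //; first exact: open_ref_preimage.
  + by rewrite impsi.
  + rewrite /smooth_on_body imU; apply: smooth_ext sF => // q.
    by rewrite -imU; exact: (ref_rep_ext (F:=F) (fun _ _ => erefl)).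
  + by rewrite impsi; exact: smooth_ext oO' GE sG.
- move=> x Ux; split => // i; rewrite /coord_frame.
  have D1 := smooth_is_derive 'e_i sG (FO _ Ux).
  by case: (is_derive_ext oO' (FO _ Ux) GE D1).
Qed.

End MainDirections.

Theorem proposition6p14 (R : realType) (B : body R) (P : G3A_structure B) :
  integrable_structure (G3A_frames P) <->
  involutive_distribution (D1 P) /\ involutive_distribution (D2 P).
Proof.
split=> [H|[inv1 inv2] x0].
  split; apply: first_integral_involutive.
    apply: (@coord_span_first_integral _ _ _ 0 1 2) => // [l|x0]; first exact: ord3.
    have [U [psi [C Ux0 HU]]] := H x0; exists U, psi; split => // x /HU.
    by case.
  apply: (@coord_span_first_integral _ _ _ 1 2 0) => // [l|x0].
    by case: (ord3 l) => [->|[->|->]]; [right; right|left|right; left].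
  have [U [psi [C Ux0 HU]]] := H x0; exists U, psi; split => // x /HU.
  by case.
have [ Of [f [oOf Ofx OfB Sf fP]]] := involutive_first_integral (D1_distribution P) inv1 x0.
have [ Og [g [oOg Ogx _ Sg gP]]] := involutive_first_integral (D2_distribution P) inv2 x0.
pose O := Of `&` Og; have oO : open O by exact: openI.
have Ox0 : O (ref x0) by [].
have OB : O `<=` @ref R B @` setT by move=> q [/OfB].
have SfO : smooth_on O f by apply: smooth_subset Sf => q [].
have SgO : smooth_on O g by apply: smooth_subset Sg => q [].
(* A left inverse of [ref], through which [Omega] is read on the image of the chart; the default
   [x0] only occurs outside this image. *)
pose s (q : 'rV[R]_3) := xget x0 [set x : B | ref x = q].
have sK x : s (ref x) = x.
  by rewrite /s; case: xgetP => [y _ /ref_inj //|/(_ x)]; case.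
have [wA wS w0] := Omega_volume P.
have [u0 [u1 [u2 [/andP[u01 u02] /and3P[u11 u12 u1n] /andP[u22 u21]]]]] :=
  planes_adapted_basis ((D1_distribution P).1 x0) ((D2_distribution P).1 x0) (D1_neq_D2 P x0).
(* Row by row: a vector in [D1] only, one in both planes, one in [D2] only, which is the pattern of
   the frames of the structure. *)
pose A : 'M[R]_3 := \matrix_(i < 3) (if i == 0 then u0 else if i == 1 then u1 else u2).
have A0 : row 0 A = u0 by rewrite rowK.
have A2 : row 2 A = u2 by rewrite rowK.
have A1 : row 1 A = u1 by rewrite rowK.
have f0 v : v \in D1 P x0 -> 'D_v f (ref x0) = 0 by exact: (fP x0 Ofx v).1.
have g0 v : v \in D2 P x0 -> 'D_v g (ref x0) = 0 by exact: (gP x0 Ogx v).1.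
have f1 v : v \notin D1 P x0 -> 'D_v f (ref x0) != 0.
  by apply: contraNneq => /(fP x0 Ofx v).2.
have g1 v : v \notin D2 P x0 -> 'D_v g (ref x0) != 0.
  by apply: contraNneq => /(gP x0 Ogx v).2.
(* In a vanishing combination of the rows, [df] isolates the coefficient of [u2] and [dg] that of
   [u0]; the third vanishes because [u1] is nonzero. *)
have uA : A \in unitmx.
  rewrite -row_free_unit; apply: inj_row_free => v vA.
  have vE : v 0 0 *: u0 + (v 0 2 *: u2 + (v 0 1 *: u1 + 0)) = 0.
    have s3 (E : 'I_3 -> 'rV[R]_3) : \sum_i E i = E 0 + (E 1 + E 2).
      by rewrite 3!big_ord_recl big_ord0 addr0; congr (E _ + (E _ + E _)); apply: val_inj.
    by rewrite addr0 -[RHS]vA mulmx_sum_row s3 A0 A1 A2 [_ *: u2 + _]addrC.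
  have df : differentiable f (ref x0) by exact: smooth_differentiable Sf Ofx.
  have dg : differentiable g (ref x0) by exact: smooth_differentiable Sg Ogx.
  have v2 : v 0 2 = 0.
    have := congr1 (fun u => 'D_u f (ref x0)) vE; rewrite /= !derive_linear // !derive0.
    rewrite (f0 u0) // (f0 u1) // !scaler0 !addr0 add0r => /eqP.
    by rewrite scaler_eq0 (negbTE (f1 _ u21)) orbF => /eqP.
  have v0 : v 0 0 = 0.
    have := congr1 (fun u => 'D_u g (ref x0)) vE; rewrite /= !derive_linear // !derive0.
    rewrite (g0 u1) // (g0 u2) // !scaler0 !addr0 => /eqP.
    by rewrite scaler_eq0 (negbTE (g1 _ u02)) orbF => /eqP.
  have v1 : v 0 1 = 0.
    move: vE; rewrite v0 v2 !scale0r !add0r addr0 => /eqP.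
    by rewrite scaler_eq0 (negbTE u1n) orbF => /eqP.
  apply/rowP => i; rewrite [RHS]mxE.
  by case: (ord3 i) => [->|[->|->]].
have Sw v1 v2 v3 : smooth_on O (fun q => Omega P (s q) v1 v2 v3 : R).
  have H := wS v1 v2 v3; rewrite /smooth_on_body in H.
  apply: smooth_ext (smooth_subset OB H) => // q /OB [x _ <-].
  by rewrite ref_rep // sK.
have [Q [Q' [F [G [Qx QO DFG QP]]]]] := adapted_chart oO Ox0 SfO SgO (fun q _ => wA (s q)) Sw
  (fun q _ => w0 (s q)) uA (etrans (congr1 (fun u => 'D_u f (ref x0)) A0) (f0 _ u01))
  (etrans (congr1 (fun u => 'D_u f (ref x0) != 0) A2) (f1 _ u21))
  (etrans (congr1 (fun u => 'D_u g (ref x0) != 0) A0) (g1 _ u02)).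
have [U [psi [C Ux0 HU]]] := integrable_chart DFG Qx (subset_trans QO OB).
exists U, psi; split => // x Ux; have [Qr W] := HU x Ux.
have [oQ _ sF _ _] := DFG.
have [ Oq Og'] := QO _ Qr; have [_ _ w1] := QP _ Qr.
have comp (k : 'I_3) (h : 'rV[R]_3 -> R) v : (forall q, Q q -> F q 0 k = h q) ->
    'D_v F (ref x) 0 k = 'D_v h (ref x).
  move=> E; have D1 := is_derive_coord k (smooth_is_derive v sF Qr).
  by case: (is_derive_ext oQ Qr E D1).
rewrite /G3A_frames /=; split.
- by rewrite !W; exact: frame_basis DFG Qr.
- apply/vspaceP => v; rewrite !W; apply/idP/idP.
    move=> /(frame_span v DFG Qr _ _ ord3).1 => /(_ isT isT) vk; apply: (fP x Oq v).2.
    by rewrite -vk; apply/esym/comp => q /QP[].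
  move=> /(fP x Oq v).1 vk; apply/(frame_span v DFG Qr _ _ ord3) => //.
  by rewrite -vk; apply: comp => q /QP[].
- have ord3' (l : 'I_3) : l = 1 \/ l = 2 \/ l = 0.
    by case: (ord3 l) => [->|[->|->]]; [right; right|left|right; left].
  apply/vspaceP => v; rewrite !W; apply/idP/idP.
    move=> /(frame_span v DFG Qr _ _ ord3').1 => /(_ isT isT) vk; apply: (gP x Og' v).2.
    by rewrite -vk; apply/esym/comp => q /QP[].
  move=> /(gP x Og' v).1 vk; apply/(frame_span v DFG Qr _ _ ord3') => //.
  by rewrite -vk; apply: comp => q /QP[].
- by move: w1; rewrite sK !W.
Qed.
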